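(* Let $u,v,w\in W$ with $u\le v\le w$ in the Bruhat order, with fixed reduced expressions $\underline u,\underline v,\underline w$. Let $$\Phi^{u,v}_{\underline w}:\operatorname{Hom}^{\mathbb{Z}}(BS(\underline w),R_v)\otimes_R\mathbb{R}\to\operatorname{Hom}^{\mathbb{Z}}(BS(\underline w),R_u)\otimes_R\mathbb{R}$$ be the $\mathbb{R}$-linear map determined on the basis $\{(\beta_v\circ l)\otimes1: l\in\mathbb{L}_{\underline w}(v)\}$ by $(\beta_v\circ l)\otimes1\mapsto(\beta_u\circ G^u_v\circ l)\otimes1$. Then $\Phi^{u,v}_{\underline w}$ is a homogeneous homomorphism of right $A_{\underline w}$-modules of degree $l(v)-l(u)$.
   Context: **Bott-Samelson and standard bimodules.** $(W,S)$ is a Coxeter system with length $l$, Bruhat order $\le$, $m_{st}$ the order of $st$. An expression is a finite sequence $\underline{w}=s_1\ldots s_n$ of elements of $S$; $w\in W$ denotes its product; it is reduced if $l(w)=n$. Fix a reflection-faithful representation $V$ of $W$ over $\mathbb{R}$ (finite-dimensional, faithful, and an element has fixed space of codimension one iff it is conjugate to an element of $S$). $R$ is the algebra of regular functions on $V$, graded with $R_2=V^*$, with its $W$-action; $R^+$ is the ideal generated by elements of positive degree, and $\mathbb{R}\cong R/R^+$. For $s\in S$, $R^s$ is the ring of $s$-invariants, $x_s\in V^*$ is an equation of the hyperplane fixed by $s$, and $\partial_s(f)=(f-s\cdot f)/(2x_s)$. For a graded bimodule $B$, $B(k)_i=B_{k+i}$. Put $B_s=R\otimes_{R^s}R(1)$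 and $BS(\underline w)=B_{s_1}\otimes_R\cdots\otimes_R B_{s_n}$, $BS(\emptyset)=R$; thus $BS(\underline w)\cong R\otimes_{R^{s_1}}R\otimes\cdots\otimes_{R^{s_n}}R(n)$. For graded $(R,R)$-bimodules, $\operatorname{Hom}^{\mathbb{Z}}(B,B')$ is the direct sum over $k\in\mathbb{Z}$ of the spaces of bimodule homomorphisms homogeneous of degree $k$ (i.e. $f(B_i)\subset B'_{i+k}$ for all $i$); it is a right $R$-module. $\operatorname{End}^{\mathbb{Z}}(B)=\operatorname{Hom}^{\mathbb{Z}}(B,B)$. For $x\in W$ the standard bimodule $R_x$ is $R$ as a left module, with right action $r\cdot r'=r\,x(r')$, graded so that $1\in R_x$ has degree $-l(x)$. For a reduced expression $\underline x=s_1\ldots s_k$ of $x$, $\beta_x:BS(\underline x)\to R_x$ is the bimodule morphism $p_0\otimes p_1\otimes\cdots\otimes p_k\mapsto p_0\,s_1(p_1)\,(s_1s_2)(p_2)\cdots(s_1\cdots s_k)(p_k)$ (it has degree 0). **Leaves.** Basic morphisms: $m_s:BS(s)\to R$, $p\otimes q\mapsto pq$ (degree 1); $j_s:BS(ss)\to BS(s)$, $1\otimes p\otimes1\mapsto\partial_s(p)\otimes1$ (degree $-1$); for $m_{sr}<\infty$, $f_{sr}:BS(srs\cdots)\to BS(rsr\cdots)$ ($m_{sr}$ letters each), the unique degree 0 morphism sending $1\otimes\cdots\otimes1$ to $1\otimes\cdots\otimes1$. For an expression $\underline w=s_1\ldots s_n$ a binary tree $\mathbb{T}_{\underline w}$ is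 built, with nodes Bott-Samelson bimodules and edges morphisms. The root is $BS(\underline w)$. A node of depth $k-1$ ($1\le k\le n$) is $BS(t_1\ldots t_i)BS(s_k\ldots s_n)$ with $t_1\ldots t_i$ reduced (empty for $k=1$). (a) If $l(t_1\cdots t_is_k)>l(t_1\cdots t_i)$, its two children are $BS(t_1\ldots t_i)BS(s_{k+1}\ldots s_n)$ via $\mathrm{id}\otimes m_{s_k}\otimes\mathrm{id}$, and $BS(t_1\ldots t_is_k)BS(s_{k+1}\ldots s_n)$ via the identity. (b) If $l(t_1\cdots t_is_k)<l(t_1\cdots t_i)$, fix a sequence of braid moves from $t_1\ldots t_i$ to a reduced expression $t_1'\ldots t_{i-1}'s_k$, apply the corresponding composition of morphisms $f_{sr}$ (tensored with identity), then $\mathrm{id}\otimes j_{s_k}\otimes\mathrm{id}$, arriving at $BS(t_1'\ldots t_{i-1}'s_k)BS(s_{k+1}\ldots s_n)$; the two children are obtained by then applying $\mathrm{id}\otimes m_{s_k}\otimes\mathrm{id}$ (giving $BS(t_1'\ldots t_{i-1}')BS(s_{k+1}\ldots s_n)$) or the identity. After $n$ steps each endpoint is $BS(\underline{u}')$ with $\underline u'$ reduced. Fix once and for all a reduced expression $\underline u$ for every $u\in W$, and for each reduced expression $\underline u'$ of $u$ a sequence of braid moves to $\underline u$; compose each endpoint with the corresponding composition of morphisms $f_{sr}$, $BS(\underline u')\to BS(\underline u)$. The resulting composite morphism $BS(\underline w)\to BS(\underline u)$ along a root-to-endpoint path is called a leaf; $\mathbb{L}_{\underline w}(u)\subset\operatorname{Hom}^{\mathbb{Z}}(BS(\underline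 w),BS(\underline u))$ is the set of leaves ending at $BS(\underline u)$. All choices are fixed; the expressions $\underline u,\underline v,\underline w$ in the claim are the chosen ones, and the unique leaf in $\mathbb{L}_{\underline w}(w)$ is taken to be the identity (similarly for $\underline u,\underline v$). **Known facts used to make sense of the claim.** The set $\{\beta_x\circ l: l\in\mathbb{L}_{\underline w}(x)\}$ is a right $R$-basis of $\operatorname{Hom}^{\mathbb{Z}}(BS(\underline w),R_x)$. For $u\le v$ there is a unique leaf in $\mathbb{L}_{\underline v}(u)$ of degree $l(v)-l(u)$; it is denoted $G^u_v:BS(\underline v)\to BS(\underline u)$. **Module structure.** $A_{\underline w}=\operatorname{End}^{\mathbb{Z}}(BS(\underline w))\otimes_R\mathbb{R}$ is a graded $\mathbb{R}$-algebra under composition, and $\operatorname{Hom}^{\mathbb{Z}}(BS(\underline w),R_x)\otimes_R\mathbb{R}$ is a graded right $A_{\underline w}$-module via $(g\otimes1)(a\otimes1)=(g\circ a)\otimes1$. *)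

(* Defs.v *)
From HB Require Import structures.
From mathcomp Require Import all_boot all_order all_algebra ring_quotient.
From mathcomp Require Import boolp classical_sets functions reals.
From mathcomp Require Import freeg mpoly.

Set Implicit Arguments.
Unset Strict Implicit.
Unset Printing Implicit Defensive.

Import GRing.Theory.

Local Open Scope ring_scope.

Section Presentation.
Variables (W : groupType) (S : Type) (gen : S -> W).

Definition word_prod (e : seq S) : W := foldr (fun s x => (gen s * x)%g) 1%g e.

(* [g] has finite order [n]; no [n] qualifies when the order is infinite. *)
Definition has_order (g : W) (n : nat) : Prop :=
  [/\ (0 < n)%N, (g ^+ n = 1)%g &
      forall k, (0 < k < n)%N -> (g ^+ k)%g <> 1%g].

(* The congruence on words generated by (st)^m_st = 1. The case s = t, where
   m_ss = 1, is the relation ss = 1, so inverses of generators are not needed. *)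
Inductive cox_equiv : seq S -> seq S -> Prop :=
| cox_refl e : cox_equiv e e
| cox_sym e e' : cox_equiv e e' -> cox_equiv e' e
| cox_trans e e' e'' : cox_equiv e e' -> cox_equiv e' e'' -> cox_equiv e e''
| cox_rel a b s t m : has_order (gen s * gen t)%g m ->
    cox_equiv (a ++ flatten (nseq m [:: s; t]) ++ b) (a ++ b).

End Presentation.

(* [S] is an index set for the simple reflections, embedded in [W] by [gen]. *)
Record coxeter_system (W : groupType) (S : Type) := CoxeterSystem {
  gen :> S -> W;
  gen_inj : injective gen;
  gen_invol : forall s, (gen s * gen s = 1)%g;
  gen_surj : forall x : W, exists e, word_prod gen e = x;
  gen_pres : forall e e',
    word_prod gen e = word_prod gen e' -> cox_equiv gen e e'
}.

Section Coxeter.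
Variables (W : groupType) (S : Type) (C : coxeter_system W S).

Lemma length_subproof (x : W) :
  exists n, `[< exists e, size e = n /\ word_prod C e = x >].
Proof.
by have [e <-] := gen_surj C x; exists (size e); apply/asboolP; exists e.
Qed.

Definition length (x : W) : nat := ex_minn (length_subproof x).

Definition reduced (e : seq S) : bool := size e == length (word_prod C e).

Definition is_reflection (t : W) : Prop :=
  exists (x : W) (s : S), t = (x * gen C s * x^-1)%g.

Inductive bruhat (u : W) : W -> Prop :=
| bruhat_refl : bruhat u u
| bruhat_step v t : bruhat u v -> is_reflection t ->
    (length v < length (v * t)%g)%N -> bruhat u (v * t)%g.

Fixpoint alternating (s r : S) (m : nat) : seq S :=
  if m is m'.+1 then s :: alternating r s m' else [::].

Inductive braid_moves : seq S -> seq S -> Type :=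
| BraidNil e : braid_moves e e
| BraidCons a b s r m e : s <> r -> has_order (gen C s * gen C r)%g m ->
    braid_moves (a ++ (alternating r s m ++ b)) e ->
    braid_moves (a ++ (alternating s r m ++ b)) e.

End Coxeter.

Section GradedBimodules.
Variables (K : realType) (d : nat).
Local Notation R := {mpoly K[d]}.

(* Linear forms have degree 2. *)
Definition polygr (i : int) (p : R) : Prop :=
  p = 0 \/ exists2 n : nat, i = (2 * n)%:Z & p \is n.-homog.

Lemma polygr0 i : polygr i 0. Proof. by left. Qed.

Lemma polygrB i p q : polygr i p -> polygr i q -> polygr i (p - q).
Proof.
move=> [->|[n -> hp]] [->|[m em hq]]; rewrite ?subrr ?sub0r ?subr0;
  [by left | by right; exists m; rewrite // rpredN
  | by right; exists n |].
right; exists n => //; apply: rpredB => //.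
have enm : n = m by move: em => [] /eqP; rewrite !mul2n -!muln2 eqn_pmul2r // => /eqP.
by rewrite enm.
Qed.

Lemma polygrM i j p q : polygr i p -> polygr j q -> polygr (i + j) (p * q).
Proof.
move=> [->|[n -> hp]]; first by rewrite mul0r; left.
move=> [->|[m -> hq]]; first by rewrite mulr0; left.
by right; exists (n + m)%N; rewrite ?mulnDr ?PoszD //; apply: dhomogM.
Qed.

(* [gr i] is the component of degree [i]; that the bimodule is the direct sum
   of its components is not part of the structure. *)
Record gbimod := GBimod {
  bcar :> zmodType;
  lact : R -> bcar -> bcar;
  ract : bcar -> R -> bcar;
  gr : int -> bcar -> Prop;
  lactDr : forall r x y, lact r (x + y) = lact r x + lact r y;
  lactDl : forall r r' x, lact (r + r') x = lact r x + lact r' x;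
  lactA : forall r r' x, lact (r * r') x = lact r (lact r' x);
  lact1 : forall x, lact 1 x = x;
  ractDl : forall x y r, ract (x + y) r = ract x r + ract y r;
  ractDr : forall x r r', ract x (r + r') = ract x r + ract x r';
  ractA : forall x r r', ract x (r * r') = ract (ract x r) r';
  ract1 : forall x, ract x 1 = x;
  lractA : forall r x r', lact r (ract x r') = ract (lact r x) r';
  gr0 : forall i, gr i 0;
  grB : forall i x y, gr i x -> gr i y -> gr i (x - y);
  grl : forall i j r x, polygr i r -> gr j x -> gr (i + j) (lact r x);
  grr : forall i j x r, gr i x -> polygr j r -> gr (i + j) (ract x r)
}.

Section GbimodTheory.
Variable B : gbimod.
Implicit Types (x y : B) (r : R).

Lemma lact0r r : lact r 0 = 0 :> B.
Proof. by apply: (addrI (lact r 0)); rewrite -lactDr !addr0. Qed.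

Lemma lact0l x : lact 0 x = 0.
Proof. by apply: (addrI (lact 0 x)); rewrite -lactDl !addr0. Qed.

Lemma lactN r x : lact r (- x) = - lact r x.
Proof. by apply: (addrI (lact r x)); rewrite -lactDr !subrr lact0r. Qed.

Lemma ract0l r : ract 0 r = 0 :> B.
Proof. by apply: (addrI (ract 0 r)); rewrite -ractDl !addr0. Qed.

Lemma ract0r x : ract x 0 = 0.
Proof. by apply: (addrI (ract x 0)); rewrite -ractDr !addr0. Qed.

Lemma ractN x r : ract (- x) r = - ract x r.
Proof. by apply: (addrI (ract x r)); rewrite -ractDl !subrr ract0l. Qed.

Lemma grN i x : gr i x -> gr i (- x).
Proof. by move=> hx; rewrite -sub0r; apply: grB => //; apply: gr0. Qed.

Lemma grD i x y : gr i x -> gr i y -> gr i (x + y).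
Proof. by move=> hx hy; rewrite -[y]opprK; apply: grB => //; apply: grN. Qed.

End GbimodTheory.

Definition regular : gbimod.
refine (@GBimod R *%R *%R polygr _ _ _ _ _ _ _ _ _ _ _ _ _).
- by move=> *; rewrite mulrDr.
- by move=> *; rewrite mulrDl.
- by move=> *; rewrite mulrA.
- by move=> *; rewrite mul1r.
- by move=> *; rewrite mulrDl.
- by move=> *; rewrite mulrDr.
- by move=> *; rewrite mulrA.
- by move=> *; rewrite mulr1.
- by move=> *; rewrite mulrA.
- exact: polygr0.
- exact: polygrB.
- exact: polygrM.
- exact: polygrM.
Defined.

Lemma residue_gr i (r : R) : polygr i r -> r@_0%MM = 0 \/ i = 0.
Proof.
move=> [->|[[|n] -> hr]]; [by left; rewrite mcoeff0 | by right |].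
by left; apply: (dhomog_nemf_coeff hr); rewrite mf0.
Qed.

(* The residue field R / R^+, identified with [K] by the constant term. *)
Definition residue : gbimod.
refine (@GBimod K (fun p c => p@_0%MM * c) (fun c p => c * p@_0%MM)
  (fun i c => c = 0 \/ i = 0) _ _ _ _ _ _ _ _ _ _ _ _ _).
- by move=> *; rewrite mulrDr.
- by move=> *; rewrite mcoeffD mulrDl.
- by move=> r r' x; rewrite rmorphM /= mulrA.
- by move=> x; rewrite rmorph1 mul1r.
- by move=> *; rewrite mulrDl.
- by move=> *; rewrite mcoeffD mulrDr.
- by move=> r r' x; rewrite rmorphM /= mulrA.
- by move=> x; rewrite rmorph1 mulr1.
- by move=> *; rewrite mulrA.
- by left.
- by move=> i x y [->|->] [->|hy]; rewrite ?subr0; [left|right|right|right].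
- move=> i j r x hr [->|->]; first by left; rewrite mulr0.
  by case: (residue_gr hr) => [->|->]; [left; rewrite mul0r | right; rewrite addr0].
- move=> i j x r [->|->] hr; first by left; rewrite mul0r.
  by case: (residue_gr hr) => [->|->]; [left; rewrite mulr0 | right; rewrite addr0].
Defined.

Definition shift (k : int) (B : gbimod) : gbimod.
refine (@GBimod B (@lact B) (@ract B) (fun i => gr (k + i))
  _ _ _ _ _ _ _ _ _ _ _ _ _).
- exact: lactDr.
- exact: lactDl.
- exact: lactA.
- exact: lact1.
- exact: ractDl.
- exact: ractDr.
- exact: ractA.
- exact: ract1.
- exact: lractA.
- by move=> i; apply: gr0.
- by move=> i; apply: grB.
- by move=> i j r x hr hx; rewrite addrCA; apply: grl.
- by move=> i j x r hx hr; rewrite addrA; apply: grr.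
Defined.

(* The tensor product of [M] and [N] over a set [A] of scalars: the free
   abelian group on M * N modulo biadditivity and A-balancedness. *)
Section Tensor.
Variables (A : {pred R}) (M N : gbimod).

Inductive tens_rel : {freeg (M * N)%type} -> Prop :=
| tens_rel0 : tens_rel 0
| tens_relB x y : tens_rel x -> tens_rel y -> tens_rel (x - y)
| tens_relDl m m' n :
    tens_rel (<< (m + m', n) >> - << (m, n) >> - << (m', n) >>)
| tens_relDr m n n' :
    tens_rel (<< (m, n + n') >> - << (m, n) >> - << (m, n') >>)
| tens_relA m a n : a \in A ->
    tens_rel (<< (ract m a, n) >> - << (m, lact a n) >>).

Definition tens_pred : {pred {freeg (M * N)%type}} := fun x => `[< tens_rel x >].

Lemma tens_pred_closed : zmod_closed tens_pred.
Proof.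
split; first by apply/asboolP; constructor.
by move=> x y /asboolP hx /asboolP hy; apply/asboolP; constructor.
Qed.

HB.instance Definition _ :=
  GRing.isZmodClosed.Build {freeg (M * N)%type} tens_pred tens_pred_closed.

Definition tens : Type := Quotient.quot tens_pred.
HB.instance Definition _ := GRing.Zmodule.on tens.

Definition pure (m : M) (n : N) : tens :=
  \pi_(Quotient.quot tens_pred)%qT << (m, n) >>.

(* The additive map induced by [phi], meaningful when [phi] is biadditive and
   balanced, see [tens_lift_pure]. *)
Definition tens_lift (P : zmodType) (phi : M -> N -> P) (x : tens) : P :=
  fglift (fun mn => phi mn.1 mn.2 : zmodule P)
    (repr (x : Quotient.quot tens_pred)).

Lemma tens_ind (Q : tens -> Prop) : Q 0 ->
  (forall x y, Q x -> Q y -> Q (x - y)) ->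
  (forall m n, Q (pure m n)) -> forall x, Q x.
Proof.
move=> Q0 QB Qp x.
have QD y z : Q y -> Q z -> Q (y + z).
  by move=> hy hz; rewrite -[z]opprK -[- z]sub0r; apply: (QB) => //; apply: QB.
have QMn y n : Q y -> Q (y *+ n).
  by move=> hy; elim: n => [|n IH]; rewrite ?mulr0n // mulrS; apply: QD.
rewrite -[x]reprK -[repr x]freeg_sumE raddf_sum.
elim/big_ind: _ => // [[m n]] _.
rewrite -[coeff _ _]intz -freegU_mulz raddfMz /=.
case: (coeff _ _) => k /=; first exact: QMn (Qp _ _).
by rewrite NegzE mulrNz -sub0r; apply: (QB) => //; apply: QMn (Qp _ _).
Qed.

Lemma tens_pi_rel x :
  tens_rel x -> \pi_(Quotient.quot tens_pred)%qT x = 0.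
Proof.
move=> hx; rewrite -[RHS](raddf0 (\pi_(Quotient.quot tens_pred)%qT)).
by apply/eqP; rewrite -Quotient.idealrBE subr0; apply/asboolP.
Qed.

Lemma pureDl m m' n : pure (m + m') n = pure m n + pure m' n.
Proof.
apply/eqP; rewrite -subr_eq0 opprD addrA; apply/eqP.
by rewrite /pure -!raddfB; apply/tens_pi_rel/tens_relDl.
Qed.

Lemma pureDr m n n' : pure m (n + n') = pure m n + pure m n'.
Proof.
apply/eqP; rewrite -subr_eq0 opprD addrA; apply/eqP.
by rewrite /pure -!raddfB; apply/tens_pi_rel/tens_relDr.
Qed.

Lemma pureA m a n : a \in A -> pure (ract m a) n = pure m (lact a n).
Proof.
move=> hA; apply/eqP; rewrite -subr_eq0; apply/eqP.
by rewrite /pure -raddfB; apply/tens_pi_rel/tens_relA.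
Qed.

Lemma pure0l n : pure 0 n = 0.
Proof. by apply: (addrI (pure 0 n)); rewrite -pureDl !addr0. Qed.

Lemma pure0r m : pure m 0 = 0.
Proof. by apply: (addrI (pure m 0)); rewrite -pureDr !addr0. Qed.

Section Lift.
Variables (P : zmodType) (phi : M -> N -> P).

Definition balanced : Prop :=
  [/\ forall m m' n, phi (m + m') n = phi m n + phi m' n,
      forall m n n', phi m (n + n') = phi m n + phi m n' &
      forall m a n, a \in A -> phi (ract m a) n = phi m (lact a n)].

Hypothesis hphi : balanced.
Let flift := fglift (fun mn : M * N => phi mn.1 mn.2 : zmodule P).

Lemma fliftB x y : flift (x - y) = flift x - flift y.
Proof. exact: lift_is_additive. Qed.

Lemma flift_rel x : tens_rel x -> flift x = 0.
Proof.
case: hphi => hDl hDr hA.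
have fB := fliftB.
elim=> {x} [|x y _ hx _ hy|m m' n|m n n'|m a n ha].
- by have := fB 0 0; rewrite !subrr.
- by rewrite fB hx hy subr0.
- by rewrite !fB /flift !liftU !scale1r /= hDl addrAC addrK subrr.
- by rewrite !fB /flift !liftU !scale1r /= hDr addrAC addrK subrr.
- by rewrite fB /flift !liftU !scale1r /= hA // subrr.
Qed.

Lemma tens_lift_pi x :
  tens_lift phi (\pi_(Quotient.quot tens_pred)%qT x) = flift x.
Proof.
apply/eqP; rewrite -subr_eq0 -[tens_lift _ _]/(flift _) -fliftB.
apply/eqP/flift_rel/asboolP; rewrite -[`[< _ >]]/(_ \in tens_pred).
by rewrite Quotient.idealrBE reprK.
Qed.

Lemma tens_lift_pure m n : tens_lift phi (pure m n) = phi m n.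
Proof. by rewrite tens_lift_pi /flift liftU scale1r. Qed.

Lemma tens_liftB x y :
  tens_lift phi (x - y) = tens_lift phi x - tens_lift phi y.
Proof.
rewrite -[x]reprK -[y]reprK -(raddfB (\pi_(Quotient.quot tens_pred)%qT)).
by rewrite !tens_lift_pi fliftB.
Qed.

Lemma tens_lift0 : tens_lift phi 0 = 0.
Proof. by rewrite -[0]subr0 tens_liftB subrr. Qed.

Lemma tens_liftD x y :
  tens_lift phi (x + y) = tens_lift phi x + tens_lift phi y.
Proof.
by rewrite -{1}[y]opprK tens_liftB -[- y]sub0r tens_liftB tens_lift0 sub0r opprK.
Qed.

End Lift.

(* The component of degree [i] is spanned by the pure tensors of homogeneous
   elements of total degree [i]. *)
Inductive tens_gr (i : int) : tens -> Prop :=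
| tens_gr0 : tens_gr i 0
| tens_grB x y : tens_gr i x -> tens_gr i y -> tens_gr i (x - y)
| tens_gr_pure j k m n :
    gr j m -> gr k n -> i = j + k -> tens_gr i (pure m n).

Definition tens_lact (r : R) : tens -> tens :=
  tens_lift (fun m n => pure (lact r m) n).

Definition tens_ract (x : tens) (r : R) : tens :=
  tens_lift (fun m n => pure m (ract n r)) x.

Lemma tens_lact_bal r : balanced (fun m n => pure (lact r m) n).
Proof.
split=> [m m' n|m n n'|m a n hA]; rewrite ?lactDr ?pureDl ?pureDr //.
by rewrite lractA pureA.
Qed.

Lemma tens_ract_bal r : balanced (fun m n => pure m (ract n r)).
Proof.
split=> [m m' n|m n n'|m a n hA]; rewrite ?ractDl ?pureDl ?pureDr //.
by rewrite pureA // lractA.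
Qed.

Lemma tens_lact_pure r m n : tens_lact r (pure m n) = pure (lact r m) n.
Proof. exact/tens_lift_pure/tens_lact_bal. Qed.

Lemma tens_ract_pure m n r : tens_ract (pure m n) r = pure m (ract n r).
Proof. exact/(tens_lift_pure (phi := fun m n => pure m (ract n r)))/tens_ract_bal. Qed.

Lemma tens_lactB r x y : tens_lact r (x - y) = tens_lact r x - tens_lact r y.
Proof. exact/tens_liftB/tens_lact_bal. Qed.

Lemma tens_ractB x y r : tens_ract (x - y) r = tens_ract x r - tens_ract y r.
Proof. exact/tens_liftB/tens_ract_bal. Qed.

Lemma tens_lact0 r : tens_lact r 0 = 0.
Proof. exact/tens_lift0/tens_lact_bal. Qed.

Lemma tens_ract0 r : tens_ract 0 r = 0.
Proof. exact/tens_lift0/tens_ract_bal. Qed.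

Definition tensor : gbimod.
refine (@GBimod tens tens_lact tens_ract tens_gr _ _ _ _ _ _ _ _ _ _ _ _ _).
- by move=> r x y; apply/tens_liftD/tens_lact_bal.
- move=> r r'; elim/tens_ind => [|x y hx hy|m n].
  + by rewrite !tens_lact0 addr0.
  + by rewrite !tens_lactB hx hy opprD addrACA.
  + by rewrite !tens_lact_pure lactDl pureDl.
- move=> r r'; elim/tens_ind => [|x y hx hy|m n].
  + by rewrite !tens_lact0.
  + by rewrite !tens_lactB hx hy.
  + by rewrite !tens_lact_pure lactA.
- elim/tens_ind => [|x y hx hy|m n].
  + by rewrite !tens_lact0.
  + by rewrite !tens_lactB hx hy.
  + by rewrite !tens_lact_pure lact1.
- by move=> x y r; apply/tens_liftD/tens_ract_bal.
- move=> x r r'; elim/tens_ind: x => [|x y hx hy|m n].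
  + by rewrite !tens_ract0 addr0.
  + by rewrite !tens_ractB hx hy opprD addrACA.
  + by rewrite !tens_ract_pure ractDr pureDr.
- move=> x r r'; elim/tens_ind: x => [|x y hx hy|m n].
  + by rewrite !tens_ract0.
  + by rewrite !tens_ractB hx hy.
  + by rewrite !tens_ract_pure ractA.
- elim/tens_ind => [|x y hx hy|m n].
  + by rewrite !tens_ract0.
  + by rewrite !tens_ractB hx hy.
  + by rewrite !tens_ract_pure ract1.
- move=> r x r'; elim/tens_ind: x => [|x y hx hy|m n].
  + by rewrite tens_lact0 !tens_ract0 tens_lact0.
  + by rewrite tens_lactB !tens_ractB tens_lactB hx hy.
  + by rewrite tens_lact_pure !tens_ract_pure tens_lact_pure.
- exact: tens_gr0.
- exact: tens_grB.
- move=> i j r x hr; elim=> {x} [|x y _ hx _ hy|k l m n hm hn ->].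
  + by rewrite tens_lact0; apply: tens_gr0.
  + by rewrite tens_lactB; apply: tens_grB.
  + rewrite tens_lact_pure; apply: (@tens_gr_pure _ (i + k) l) => //.
      exact: grl.
    by rewrite addrA.
- move=> i j x r hx hr; elim: hx => {x} [|x y _ hx _ hy|k l m n hm hn ->].
  + by rewrite tens_ract0; apply: tens_gr0.
  + by rewrite tens_ractB; apply: tens_grB.
  + rewrite tens_ract_pure; apply: (@tens_gr_pure _ k (l + j)) => //.
      exact: grr.
    by rewrite addrA.
Defined.

End Tensor.

Section Hom.
Variables (B B' : gbimod).

Definition bimod_hom (f : B -> B') : Prop :=
  [/\ forall x y, f (x + y) = f x + f y,
      forall r x, f (lact r x) = lact r (f x) &
      forall x r, f (ract x r) = ract (f x) r].

Definition hom_degree (k : int) (f : B -> B') : Prop :=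
  bimod_hom f /\ forall i x, gr i x -> gr (i + k) (f x).

Inductive isHomZ : (B -> B') -> Prop :=
| isHomZ0 : isHomZ 0
| isHomZD k f g : hom_degree k f -> isHomZ g -> isHomZ (f + g).

Definition HomZ_pred : {pred B -> B'} := fun f => `[< isHomZ f >].

Lemma hom_degreeN k f : hom_degree k f -> hom_degree k (- f).
Proof.
move=> [[fD fl fr] fg]; split; first split.
- by move=> x y; rewrite !fctE fD opprD.
- by move=> r x; rewrite !fctE fl lactN.
- by move=> x r; rewrite !fctE fr ractN.
- by move=> i x hx; rewrite !fctE; apply/grN/fg.
Qed.

Lemma hom_degreeD k f g :
  hom_degree k f -> hom_degree k g -> hom_degree k (f + g).
Proof.
move=> [[fD fl fr] fg] [[gD gl gr'] gg]; split; first split.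
- by move=> x y; rewrite !fctE fD gD addrACA.
- by move=> r x; rewrite !fctE fl gl lactDr.
- by move=> x r; rewrite !fctE fr gr' ractDl.
- by move=> i x hx; rewrite !fctE; apply: grD; [apply: fg|apply: gg].
Qed.

Lemma hom_degree0 k : hom_degree k (0 : B -> B').
Proof.
split; first split.
- by move=> x y; rewrite -[LHS]/(0 : B') -[RHS]/(0 + 0 : B') addr0.
- by move=> r x; rewrite -[LHS]/(0 : B') -[RHS]/(lact r (0 : B')) lact0r.
- by move=> x r; rewrite -[LHS]/(0 : B') -[RHS]/(ract (0 : B') r) ract0l.
- by move=> i x hx; apply: gr0.
Qed.

Lemma isHomZ1 k f : hom_degree k f -> isHomZ f.
Proof.
by move=> hf; rewrite -[f]addr0; apply: isHomZD hf _; apply: isHomZ0.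
Qed.

Lemma isHomZ_add f g : isHomZ f -> isHomZ g -> isHomZ (f + g).
Proof.
move=> hf hg; elim: hf => [|k f1 f2 hf1 _ IH]; first by rewrite add0r.
by rewrite -addrA; apply: isHomZD hf1 IH.
Qed.

Lemma isHomZ_opp f : isHomZ f -> isHomZ (- f).
Proof.
elim=> [|k f1 f2 hf1 _ IH]; first by rewrite oppr0; apply: isHomZ0.
by rewrite opprD; apply: isHomZD IH; apply: hom_degreeN hf1.
Qed.

Lemma isHomZ_bimod f : isHomZ f -> bimod_hom f.
Proof.
elim=> [|k f1 f2 [[fD fl fr] _] _ [gD gl gr']].
  by have [] := hom_degree0 0.
split.
- by move=> x y; rewrite !fctE fD gD addrACA.
- by move=> r x; rewrite !fctE fl gl lactDr.
- by move=> x r; rewrite !fctE fr gr' ractDl.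
Qed.

Lemma HomZ_closed : zmod_closed HomZ_pred.
Proof.
split=> [|f g /asboolP hf /asboolP hg]; apply/asboolP; first exact: isHomZ0.
by apply: isHomZ_add => //; apply: isHomZ_opp.
Qed.

HB.instance Definition _ :=
  GRing.isZmodClosed.Build (B -> B') HomZ_pred HomZ_closed.

Record homZ := HomZ { homZ_fun :> B -> B'; _ : homZ_fun \in HomZ_pred }.

HB.instance Definition _ := [isSub for homZ_fun].
HB.instance Definition _ := [Choice of homZ by <:].
HB.instance Definition _ := [SubChoice_isSubZmodule of homZ by <:].

Lemma homZP (f : homZ) : isHomZ f.
Proof. by case: f => f hf; apply/asboolP. Qed.

Lemma homZ_bimod (f : homZ) : bimod_hom f.
Proof. exact/isHomZ_bimod/homZP. Qed.

Lemma homZ_eq (f g : homZ) : (forall x, f x = g x) -> f = g.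
Proof. by move=> e; apply: val_inj; apply/funext. Qed.

Definition mkHomZ (f : B -> B') (hf : isHomZ f) : homZ := HomZ (asboolT hf).

Lemma homZDE (f g : homZ) x : (f + g) x = f x + g x.
Proof. by rewrite -[homZ_fun _]/(val (f + g)) raddfD. Qed.

Lemma mpoly_ind_gr (Q : R -> Prop) : (forall i r, polygr i r -> Q r) ->
  (forall r r', Q r -> Q r' -> Q (r + r')) -> forall r, Q r.
Proof.
move=> Qg QD r; rewrite [r]mpolyE; elim/big_ind: _ => //.
  exact/(Qg 0)/polygr0.
move=> m _; apply: (Qg (2 * mdeg m)%:Z); right; exists (mdeg m) => //.
by apply: dhomogZ; rewrite dhomogX /=.
Qed.

Lemma isHomZ_lact r f : isHomZ f -> isHomZ (fun x => lact r (f x)).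
Proof.
elim=> [|k f1 f2 hf1 _ IH].
  suff -> : (fun x => lact r ((0 : B -> B') x)) = 0 by apply: isHomZ0.
  by apply/funext => x; exact: lact0r.
suff -> : (fun x => lact r ((f1 + f2) x)) =
    (fun x => lact r (f1 x)) + (fun x => lact r (f2 x)).
  apply: isHomZ_add IH; move: r; apply: mpoly_ind_gr => [i r hr|r r' h h'].
    apply: (@isHomZ1 (i + k)); case: hf1 => -[fD fl fr] fg; split; first split.
    - by move=> x y; rewrite fD lactDr.
    - by move=> r' x; rewrite fl -!lactA mulrC.
    - by move=> x r'; rewrite fr lractA.
    - by move=> j x /fg hx; rewrite addrCA; apply: grl.
  suff -> : (fun x => lact (r + r') (f1 x)) =
    (fun x => lact r (f1 x)) + (fun x => lact r' (f1 x)) by apply: isHomZ_add.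
  by apply/funext => x; rewrite !fctE lactDl.
by apply/funext => x; rewrite !fctE lactDr.
Qed.

Lemma isHomZ_ract r f : isHomZ f -> isHomZ (fun x => ract (f x) r).
Proof.
elim=> [|k f1 f2 hf1 _ IH].
  suff -> : (fun x => ract ((0 : B -> B') x) r) = 0 by apply: isHomZ0.
  by apply/funext => x; exact: ract0l.
suff -> : (fun x => ract ((f1 + f2) x) r) =
    (fun x => ract (f1 x) r) + (fun x => ract (f2 x) r).
  apply: isHomZ_add IH; move: r; apply: mpoly_ind_gr => [i r hr|r r' h h'].
    apply: (@isHomZ1 (k + i)); case: hf1 => -[fD fl fr] fg; split; first split.
    - by move=> x y; rewrite fD ractDl.
    - by move=> r' x; rewrite fl lractA.
    - by move=> x r'; rewrite fr -!ractA mulrC.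
    - by move=> j x /fg hx; rewrite addrA; apply: grr.
  suff -> : (fun x => ract (f1 x) (r + r')) =
    (fun x => ract (f1 x) r) + (fun x => ract (f1 x) r') by apply: isHomZ_add.
  by apply/funext => x; rewrite !fctE ractDr.
by apply/funext => x; rewrite !fctE ractDl.
Qed.

Definition homZ_lact r (f : homZ) : homZ := mkHomZ (isHomZ_lact r (homZP f)).
Definition homZ_ract (f : homZ) r : homZ := mkHomZ (isHomZ_ract r (homZP f)).

Definition HomZ_bimod : gbimod.
refine (@GBimod homZ homZ_lact homZ_ract (fun k f => hom_degree k f)
  _ _ _ _ _ _ _ _ _ _ _ _ _).
- by move=> r f g; apply: homZ_eq => x; rewrite homZDE -lactDr -homZDE.
- by move=> r r' f; apply: homZ_eq => x; rewrite homZDE /= lactDl.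
- by move=> r r' f; apply: homZ_eq => x; rewrite /= lactA.
- by move=> f; apply: homZ_eq => x; rewrite /= lact1.
- by move=> f g r; apply: homZ_eq => x; rewrite homZDE -ractDl -homZDE.
- by move=> f r r'; apply: homZ_eq => x; rewrite homZDE /= ractDr.
- by move=> f r r'; apply: homZ_eq => x; rewrite /= ractA.
- by move=> f; apply: homZ_eq => x; rewrite /= ract1.
- by move=> r f r'; apply: homZ_eq => x; rewrite /= lractA.
- exact: hom_degree0.
- by move=> k f g hf hg; apply: hom_degreeD => //; apply: hom_degreeN.
- move=> i k r f hr [[fD fl fr] fg]; split; first split.
  + by move=> x y; rewrite /= fD lactDr.
  + by move=> r' x; rewrite /= fl -!lactA mulrC.
  + by move=> x r'; rewrite /= fr lractA.
  + by move=> j x /fg hx; rewrite addrCA; apply: grl.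
- move=> k i f r [[fD fl fr] fg] hr; split; first split.
  + by move=> x y; rewrite /= fD ractDl.
  + by move=> r' x; rewrite /= fl lractA.
  + by move=> x r'; rewrite /= fr -!ractA mulrC.
  + by move=> j x /fg hx; rewrite addrA; apply: grr.
Defined.

End Hom.

Lemma isHomZ_comp (B1 B2 B3 : gbimod) (g : B2 -> B3) (f : B1 -> B2) :
  isHomZ g -> isHomZ f -> isHomZ (g \o f).
Proof.
elim=> [_|l g1 g2 hg1 _ IH hf]; first exact: isHomZ0.
suff -> : (g1 + g2) \o f = (g1 \o f) + (g2 \o f).
  apply: isHomZ_add (IH hf) => {IH}; case: hg1 => -[gD gl gr'] gg.
  have g0 : g1 0 = 0 by apply: (addrI (g1 0)); rewrite -gD !addr0.
  elim: hf => [|k f1 f2 [[fD fl fr] fg] _ IH].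
    suff -> : g1 \o (0 : B1 -> B2) = 0 by apply: isHomZ0.
    by apply/funext => x.
  suff -> : g1 \o (f1 + f2) = (g1 \o f1) + (g1 \o f2).
    apply: isHomZ_add IH; apply: (@isHomZ1 _ _ (k + l)).
    split; first split.
    - by move=> x y; rewrite /= fD gD.
    - by move=> r x; rewrite /= fl gl.
    - by move=> x r; rewrite /= fr gr'.
    - by move=> i x /fg /gg; rewrite addrA.
  by apply/funext => x; exact: gD.
by apply/funext => x.
Qed.

Definition homZ_comp (B1 B2 B3 : gbimod) (g : homZ B2 B3) (f : homZ B1 B2) :
  homZ B1 B3 := mkHomZ (isHomZ_comp (homZP g) (homZP f)).

(* Hom^Z(B, B') tensored over [R] with the residue field. *)
Definition redhom_bimod (B B' : gbimod) : gbimod :=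
  tensor predT (HomZ_bimod B B') residue.
Definition redhom (B B' : gbimod) : Type := redhom_bimod B B'.

Section RedHom.
Variables B B' : gbimod.
HB.instance Definition _ := GRing.Zmodule.on (redhom B B').

Definition redhom_scale (c : K) (x : redhom B B') : redhom B B' :=
  @ract (redhom_bimod B B') x c%:MP.

Lemma redhom_scaleA a b v :
  redhom_scale a (redhom_scale b v) = redhom_scale (a * b) v.
Proof. by rewrite /redhom_scale -ractA -mpolyCM mulrC. Qed.
Lemma redhom_scale1 : left_id 1 redhom_scale.
Proof. by move=> v; rewrite /redhom_scale ract1. Qed.
Lemma redhom_scaleDr : right_distributive redhom_scale +%R.
Proof. by move=> c v w; apply: ractDl. Qed.
Lemma redhom_scaleDl v : {morph redhom_scale^~ v : a b / a + b}.
Proof. by move=> a b; rewrite /redhom_scale mpolyCD ractDr. Qed.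

HB.instance Definition _ := GRing.Zmodule_isLmodule.Build K (redhom B B')
  redhom_scaleA redhom_scale1 redhom_scaleDr redhom_scaleDl.

Definition redhom_gr (i : int) (x : redhom B B') : Prop :=
  @gr (redhom_bimod B B') i x.

Definition redhom_tens (f : homZ B B') (c : K) : redhom B B' :=
  @pure predT (HomZ_bimod B B') residue f c.

End RedHom.

(* Composition is extended by (g (x) c)(a (x) e) = (g o a) (x) ce, see
   [redhom_compE]; it makes [redhom B B] an algebra and [redhom B B'] a right
   module over it. *)
Definition redhom_comp (B1 B2 B3 : gbimod)
    (x : redhom B2 B3) (y : redhom B1 B2) : redhom B1 B3 :=
  tens_lift (fun (g : HomZ_bimod B2 B3) (c : residue) =>
    tens_lift (fun (a : HomZ_bimod B1 B2) (e : residue) =>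
      redhom_tens (homZ_comp g a) (c * e)) y) x.

Section RedHomComp.
Variables B1 B2 B3 : gbimod.

Lemma redhom_comp_bal1 (g : homZ B2 B3) (c : K) :
  balanced predT (fun (a : HomZ_bimod B1 B2) (e : residue) =>
    redhom_tens (homZ_comp g a) (c * e)).
Proof.
have [gD gl gr'] := homZ_bimod g.
split=> [a a' e|a e e'|a r e _].
- rewrite -pureDl; congr pure; apply: homZ_eq => x.
  by rewrite homZDE /= -gD -homZDE.
- by rewrite mulrDr -pureDr.
- transitivity (@pure predT (HomZ_bimod B1 B3) residue
    (ract (homZ_comp g a : HomZ_bimod B1 B3) r) (c * e)).
    by congr pure; apply: homZ_eq => x; apply: gr'.
  by rewrite pureA //=; congr pure; rewrite /= mulrCA.
Qed.

Lemma redhom_comp_bal2 (y : redhom B1 B2) :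
  balanced predT (fun (g : HomZ_bimod B2 B3) (c : residue) =>
    tens_lift (fun (a : HomZ_bimod B1 B2) (e : residue) =>
      redhom_tens (homZ_comp g a) (c * e)) y).
Proof.
split=> [g g' c|g c c'|g r c _]; elim/tens_ind: y => [|x y hx hy|a e].
- by rewrite !(tens_lift0 (redhom_comp_bal1 _ _)) addr0.
- by rewrite !(tens_liftB (redhom_comp_bal1 _ _)) hx hy opprD addrACA.
- rewrite !(tens_lift_pure (redhom_comp_bal1 _ _)) -pureDl; congr pure.
  by apply: homZ_eq => x; rewrite homZDE /= -homZDE.
- by rewrite !(tens_lift0 (redhom_comp_bal1 _ _)) addr0.
- by rewrite !(tens_liftB (redhom_comp_bal1 _ _)) hx hy opprD addrACA.
- by rewrite !(tens_lift_pure (redhom_comp_bal1 _ _)) mulrDl -pureDr.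
- by rewrite !(tens_lift0 (redhom_comp_bal1 _ _)).
- by rewrite !(tens_liftB (redhom_comp_bal1 _ _)) hx hy.
- rewrite !(tens_lift_pure (redhom_comp_bal1 _ _)).
  transitivity (@pure predT (HomZ_bimod B1 B3) residue
    (ract (homZ_comp g a : HomZ_bimod B1 B3) r) (c * e)).
    by congr pure; apply: homZ_eq.
  by rewrite pureA //=; congr pure; rewrite /= mulrA.
Qed.

Lemma redhom_compE (g : homZ B2 B3) (a : homZ B1 B2) (c e : K) :
  redhom_comp (redhom_tens g c) (redhom_tens a e) =
  redhom_tens (homZ_comp g a) (c * e).
Proof.
rewrite /redhom_comp (tens_lift_pure (redhom_comp_bal2 _)).
by rewrite (tens_lift_pure (redhom_comp_bal1 _ _)).
Qed.

End RedHomComp.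

End GradedBimodules.

Arguments regular {K d}.
Arguments residue {K d}.

(* The representation is on column vectors; [kermx (rho x - 1)^T] is the
   (transposed) fixed space of [x]. [root s] is the row of coefficients of an
   equation x_s of the hyperplane fixed by [s]. *)
Record refl_faithful (W : groupType) (S : Type) (C : coxeter_system W S)
    (K : realType) (d : nat) := ReflFaithful {
  rho :> W -> 'M[K]_d;
  rho1 : rho 1%g = 1%:M;
  rhoM : forall x y, rho (x * y)%g = rho x *m rho y;
  rho_inj : injective rho;
  rho_refl : forall x,
    ((\rank (kermx (rho x - 1%:M)^T)).+1 = d)%N <-> is_reflection C x;
  root : S -> 'rV[K]_d;
  rootP : forall s (v : 'cV[K]_d), root s *m v = 0 <-> rho (gen C s) *m v = v
}.

Section BottSamelson.
Variables (W : groupType) (S : Type) (C : coxeter_system W S).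
Variables (K : realType) (d : nat) (V : refl_faithful C K d).
Local Notation R := {mpoly K[d]}.

(* (x . p)(v) = p(x^-1 v) *)
Definition coord_act (x : W) : d.-tuple R :=
  [tuple \sum_j (rho V x^-1%g i j) *: 'X_j | i < d].
Definition wact (x : W) (p : R) : R := p \mPo coord_act x.

Definition xs (s : S) : R := \sum_i (root V s 0 i) *: 'X_i.

Definition invariants (s : S) : {pred R} := [pred p | wact (gen C s) p == p].

(* The quotient (p - s.p) / (2 x_s), unique since [R] is a domain. *)
Definition demazure (s : S) (p : R) : R :=
  xget 0 [set q | (2%:R * xs s) * q = p - wact (gen C s) p].

Lemma polygr_wact i x p : polygr i p -> polygr i (wact x p).
Proof.
move=> [->|[n -> hp]]; first by left; rewrite /wact comp_mpoly0.
right; exists n => //; rewrite /wact comp_mpolyE.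
rewrite big_seq; apply: rpred_sum => m hm; apply: dhomogZ.
have <- : mdeg m = n by apply: (dhomog_mf hp).
rewrite mdegE; elim/big_rec2: _ => [|j k q _ hq]; first exact: dhomog1.
apply: dhomogM hq; rewrite tnth_mktuple.
set q' := (\sum_l _).
have /(dhomogMn (m j)) : q' \is 1.-homog.
  apply: rpred_sum => l _; apply: dhomogZ.
  by rewrite dhomogX /= mdeg1.
by rewrite mul1n.
Qed.

Lemma wactM x : {morph wact x : p q / p * q}.
Proof. by move=> p q; rewrite /wact rmorphM. Qed.

Definition standard (x : W) : gbimod K d.
refine (@GBimod K d R *%R (fun p q => p * wact x q)
  (fun i => polygr (i + (length C x)%:Z)) _ _ _ _ _ _ _ _ _ _ _ _ _).
- by move=> *; rewrite mulrDr.
- by move=> *; rewrite mulrDl.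
- by move=> *; rewrite mulrA.
- by move=> *; rewrite mul1r.
- by move=> *; rewrite mulrDl.
- by move=> *; rewrite /wact rmorphD mulrDr.
- by move=> *; rewrite wactM mulrA.
- by move=> *; rewrite /wact rmorph1 mulr1.
- by move=> *; rewrite mulrA.
- by move=> i; apply: polygr0.
- by move=> i; apply: polygrB.
- by move=> i j r p hr hp; rewrite -addrA; apply: polygrM.
- by move=> i j p r hp hr; rewrite addrAC; apply: polygrM => //; apply: polygr_wact.
Defined.

(* With e = s_1 ... s_n, this is R (x)_1 (R (x)_2 ... (R (x)_n R)) shifted by
   n, where (x)_i is the tensor product over the s_i-invariants of [R]. *)
Fixpoint BS (e : seq S) : gbimod K d :=
  if e is s :: e' then shift 1 (tensor (invariants s) regular (BS e'))
  else regular.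

Definition ptens (s : S) (e : seq S) (p : R) (y : BS e) : BS (s :: e) :=
  @pure K d (invariants s) regular (BS e) p y.
Arguments ptens s {e}.

Definition plift (P : zmodType) (s : S) (e : seq S) (phi : R -> BS e -> P) :
  BS (s :: e) -> P :=
  @tens_lift K d (invariants s) regular (BS e) P phi.

Fixpoint BS1 (e : seq S) : BS e :=
  if e is s :: e' then ptens s 1 (BS1 e') else (1 : R).

(* (p_0 (x) ... (x) p_n) (q_0 (x) ... (x) q_m)
     = p_0 (x) ... (x) p_n q_0 (x) ... (x) q_m,
   through which BS(a ++ b) is the tensor product of BS(a) and BS(b) over R. *)
Fixpoint BScat (a b : seq S) : BS a -> BS b -> BS (a ++ b) :=
  match a return BS a -> BS b -> BS (a ++ b) with
  | [::] => fun p x => lact (p : R) x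
  | s :: a' => fun y x => plift (fun p z => ptens s p (BScat z x)) y
  end.

(* The additive map on BS(a ++ b) induced by an R-balanced biadditive map on
   BS(a) * BS(b). *)
Fixpoint BScat_lift (P : zmodType) (a b : seq S) :
    (BS a -> BS b -> P) -> BS (a ++ b) -> P :=
  match a return (BS a -> BS b -> P) -> BS (a ++ b) -> P with
  | [::] => fun g x => g (1 : R) (x : BS b)
  | s :: a' => fun g => plift (fun p =>
      BScat_lift (fun (z : BS a') (x : BS b) => g (ptens s p z) x))
  end.

(* [f] tensored with [g] over [R]: it sends [BScat y x] to
   [BScat (f y) (g x)], by [BStensE] below. *)
Definition BStens (a a' b b' : seq S) (f : BS a -> BS a') (g : BS b -> BS b') :
  BS (a ++ b) -> BS (a' ++ b') :=
  BScat_lift (fun y x => BScat (f y) (g x)).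

Section BScatTheory.
Variable b : seq S.

Lemma BScat_bal (s : S) (a : seq S) (x : BS b) :
  (forall y y' : BS a, BScat (y + y') x = BScat y x + BScat y' x) ->
  (forall r (y : BS a), BScat (lact r y) x = lact r (BScat y x)) ->
  @balanced K d (invariants s) regular (BS a) _
    (fun p z => ptens s p (BScat z x)).
Proof.
move=> hD hl; split=> [p p' z|p z z'|p c z hc]; first exact: pureDl.
  by rewrite hD; apply: pureDr.
by rewrite hl; apply: pureA.
Qed.

Lemma BScat_linear (a : seq S) (x : BS b) :
  (forall y y' : BS a, BScat (y + y') x = BScat y x + BScat y' x) /\
  (forall r (y : BS a), BScat (lact r y) x = lact r (BScat y x)).
Proof.
elim: a => [|s a [IHD IHl]].
  by split=> [y y'|r y]; [apply: lactDl | apply: lactA].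
have hb := BScat_bal s IHD IHl.
split=> [y y'|r]; first exact: (tens_liftD hb).
elim/tens_ind => [|y y' hy hy'|p z].
- by rewrite [lact r 0]tens_lact0 /= /plift (tens_lift0 hb) [RHS]tens_lact0.
- rewrite [lact r _]tens_lactB /= /plift !(tens_liftB hb).
  rewrite [RHS]tens_lactB; congr (_ - _); [exact: hy | exact: hy'].
- rewrite [lact r _]tens_lact_pure /= /plift !(tens_lift_pure hb).
  by rewrite [RHS]tens_lact_pure.
Qed.

Lemma BScat_ptens (s : S) (a : seq S) p (z : BS a) (x : BS b) :
  BScat (ptens s p z) x = ptens s p (BScat z x).
Proof. by have [hD hl] := BScat_linear a x; apply: (tens_lift_pure (BScat_bal s hD hl)). Qed.

Definition balanced3 (P : zmodType) (a : seq S) (g : BS a -> BS b -> P) :=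
  [/\ forall y y' x, g (y + y') x = g y x + g y' x,
      forall y x x', g y (x + x') = g y x + g y x' &
      forall y r x, g (ract y r) x = g y (lact r x)].

Lemma eq_BScat_lift (P : zmodType) (a : seq S) (g g' : BS a -> BS b -> P) :
  (forall y x, g y x = g' y x) ->
  forall u, BScat_lift g u = BScat_lift g' u.
Proof.
by move=> e u; have -> : g = g' by apply/funext => y; apply/funext => x.
Qed.

Lemma BScat_liftP (P : zmodType) (a : seq S) (g : BS a -> BS b -> P) :
  balanced3 g ->
  [/\ forall u u', BScat_lift g (u + u') = BScat_lift g u + BScat_lift g u',
      forall r u, BScat_lift g (lact r u) =
        BScat_lift (fun y x => g (lact r y) x) u,
      forall g', balanced3 g' -> forall u,
        BScat_lift (fun y x => g y x + g' y x) u =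
        BScat_lift g u + BScat_lift g' u &
      forall y x, BScat_lift g (BScat y x) = g y x].
Proof.
elim: a g => [|s a IH] g hg.
  case: hg => [h1 h2 h3]; split=> //= [r u|y x]; last first.
    by rewrite -h3 /= mul1r.
  by rewrite -h3 /= mul1r mulr1.
have b3 (f : BS (s :: a) -> BS b -> P) p :
    balanced3 f -> balanced3 (fun (z : BS a) x => f (ptens s p z) x).
  move=> [h1 h2 h3]; split=> [z z' x|z x x'|z r x]; last 2 first.
  - exact: h2.
  - by rewrite -h3; congr f; rewrite [RHS]tens_ract_pure.
  by rewrite -h1; congr f; apply: pureDr.
have hb (f : BS (s :: a) -> BS b -> P) : balanced3 f ->
    @balanced K d (invariants s) regular (BS (a ++ b)) P
    (fun p => BScat_lift (fun (z : BS a) x => f (ptens s p z) x)).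
  move=> hf; have [f1 f2 f3] := hf; split=> [p p' z|p z z'|p c z hc].
  - have [_ _ h3 _] := IH _ (b3 f p hf); rewrite -(h3 _ (b3 f p' hf)).
    apply: eq_BScat_lift => y x.
    by rewrite -f1; congr f; apply: pureDl.
  - by have [-> _ _ _] := IH _ (b3 f p hf).
  - have [_ -> _ _] := IH _ (b3 f p hf).
    apply: eq_BScat_lift => y x.
    by congr f; apply: pureA.
have hbg := hb _ hg; have [g1 g2 g3] := hg.
have blact r : balanced3 (fun (y : BS (s :: a)) x => g (lact r y) x).
  split=> [y y' x|y x x'|y r' x]; first by rewrite lactDr g1.
    exact: g2.
  by rewrite -g3 lractA.
split.
- by move=> u u'; apply: (tens_liftD hbg).
- move=> r; elim/tens_ind => [|u u' hu hu'|p z].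
  + rewrite [lact r 0]tens_lact0 /= /plift (tens_lift0 hbg).
    by rewrite (tens_lift0 (hb _ (blact r))).
  + rewrite [lact r _]tens_lactB /= /plift (tens_liftB hbg).
    rewrite (tens_liftB (hb _ (blact r))).
    by congr (_ - _); [exact: hu | exact: hu'].
  + rewrite [lact r _]tens_lact_pure /= /plift (tens_lift_pure hbg).
    rewrite (tens_lift_pure (hb _ (blact r))).
    apply: eq_BScat_lift => y x.
    by congr g; rewrite [RHS]tens_lact_pure.
- move=> g' hg' u; have hbg' := hb _ hg'; have [g1' g2' g3'] := hg'.
  have hs : balanced3 (fun (y : BS (s :: a)) x => g y x + g' y x).
    split=> [y y' x|y x x'|y r x]; first by rewrite g1 g1' addrACA.
      by rewrite g2 g2' addrACA.
    by rewrite g3 g3'.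
  have hbs := hb _ hs.
  elim/tens_ind: u => [|u u' hu hu'|p z]; rewrite /= /plift.
  + by rewrite !(tens_lift0 hbs, tens_lift0 hbg, tens_lift0 hbg') addr0.
  + rewrite (tens_liftB hbs) (tens_liftB hbg) (tens_liftB hbg').
    rewrite addrACA -opprD; congr (_ - _); [exact: hu | exact: hu'].
  + rewrite (tens_lift_pure hbs) (tens_lift_pure hbg) (tens_lift_pure hbg').
    by have [_ _ h3 _] := IH _ (b3 g p hg); rewrite -(h3 _ (b3 g' p hg')).
- move=> y x; have [cD cl] := BScat_linear a x; have hc := BScat_bal s cD cl.
  have g0 : g 0 x = 0 by apply: (addrI (g 0 x)); rewrite -g1 !addr0.
  have gB y1 y2 : g (y1 - y2) x = g y1 x - g y2 x.
    by apply: (addIr (g y2 x)); rewrite -g1 !subrK.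
  elim/tens_ind: y => [|y y' hy hy'|p z].
  + by rewrite /= /plift (tens_lift0 hc) (tens_lift0 hbg) g0.
  + rewrite gB -hy -hy' /= /plift (tens_liftB hc) (tens_liftB hbg).
    by [].
  + rewrite /= /plift (tens_lift_pure hc) (tens_lift_pure hbg).
    by have [_ _ _ ->] := IH _ (b3 g p hg).
Qed.

End BScatTheory.

Lemma BScat_right (b a : seq S) :
  (forall (y : BS a) (x x' : BS b), BScat y (x + x') = BScat y x + BScat y x') /\
  (forall (y : BS a) r (x : BS b), BScat (ract y r) x = BScat y (lact r x)).
Proof.
elim: a => [|s a [IHD IHr]].
  by split=> [y x x'|y r x]; [apply: lactDr | apply: lactA].
have hc (x : BS b) := BScat_bal s (BScat_linear a x).1 (BScat_linear a x).2.
split=> [y x x'|y r x]; elim/tens_ind: y => [|y y' hy hy'|p z].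
- by rewrite /= /plift !(tens_lift0 (hc _)) addr0.
- rewrite /= /plift !(tens_liftB (hc _)) addrACA -opprD.
  by congr (_ - _); [exact: hy | exact: hy'].
- rewrite /= /plift !(tens_lift_pure (hc _)) IHD; exact: pureDr.
- by rewrite [ract 0 r]tens_ract0 /= /plift !(tens_lift0 (hc _)).
- rewrite [ract _ r]tens_ractB /= /plift !(tens_liftB (hc _)).
  by congr (_ - _); [exact: hy | exact: hy'].
- rewrite [ract _ r]tens_ract_pure /= /plift !(tens_lift_pure (hc _)).
  by rewrite IHr.
Qed.

Lemma BStensE (a a' b b' : seq S) (f : BS a -> BS a') (g : BS b -> BS b') :
  bimod_hom f -> bimod_hom g ->
  forall y x, BStens f g (BScat y x) = BScat (f y) (g x).
Proof.
move=> [fD fl fr] [gD gl gr'] y x.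
suff hb : balanced3 (fun y x => BScat (f y) (g x)).
  by have [_ _ _ h] := BScat_liftP hb; apply: h.
split=> [u u' z|u z z'|u r z].
- by rewrite fD (BScat_linear _ _).1.
- by rewrite gD (BScat_right _ _).1.
- by rewrite fr gl (BScat_right _ _).2.
Qed.

Definition BScast (a b : seq S) (e : a = b) : BS a -> BS b :=
  fun x => eq_rect a (fun c => BS c) x b e.

Definition BSmid (a b : seq S) (l r : seq S) (f : BS a -> BS b) :
  BS (l ++ (a ++ r)) -> BS (l ++ (b ++ r)) :=
  @BStens l l (a ++ r) (b ++ r) idfun (@BStens a b r r f idfun).

Arguments BSmid {a b} l r f _.

Definition m_mor (s : S) : BS [:: s] -> BS [::] :=
  @plift R s [::] (fun p (q : R) => p * q).

Definition j_mor (s : S) : BS [:: s; s] -> BS [:: s] :=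
  @plift (BS [:: s]) s [:: s] (fun p =>
    @plift (BS [:: s]) s [::] (fun q (r : R) =>
      @ptens s [::] (p * demazure s q) r)).

(* p_0 (x) ... (x) p_k |-> p_0 s_1(p_1 s_2(p_2 ... s_k(p_k))) *)
Fixpoint beta (e : seq S) : BS e -> R :=
  match e return BS e -> R with
  | [::] => fun p => p
  | s :: e' => @plift R s e' (fun p y => p * wact (gen C s) (beta y))
  end.

Fixpoint braid_mor
    (f : forall s r m, BS (alternating s r m) -> BS (alternating r s m))
    (e e' : seq S) (mv : braid_moves C e e') : BS e -> BS e' :=
  match mv in braid_moves _ e e' return BS e -> BS e' with
  | BraidNil _ => idfun
  | BraidCons a b s r m _ _ _ mv' =>
      fun x => braid_mor f mv' (BSmid a b (f s r m) x)
  end.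

(* A node of the tree of [e] is addressed by the list of booleans leading to it
   from the root, where [false] stands for the child obtained by applying
   [m_mor]; the braid moves may be chosen independently at every node. *)
Record leaf_choices := LeafChoices {
  rex : W -> seq S;
  rexP : forall x, word_prod C (rex x) = x /\ reduced C (rex x);
  f_mor : forall s r m, BS (alternating s r m) -> BS (alternating r s m);
  f_morP : forall s r m, s <> r -> has_order (gen C s * gen C r)%g m ->
    hom_degree 0 (@f_mor s r m) /\
    @f_mor s r m (BS1 (alternating s r m)) = BS1 (alternating r s m);
  node_moves : forall (e : seq S) (path : seq bool) (t : seq S) (s : S),
    reduced C t ->
    (length C (word_prod C t * gen C s)%g < length C (word_prod C t))%N ->
    {t' : seq S & braid_moves C t (t' ++ [:: s])};
  end_moves : forall t, reduced C t -> braid_moves C t (rex (word_prod C t))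
}.

Variable L : leaf_choices.

(* The morphism BS(t) BS(s r) -> BS(t' s) BS(r) given by the braid moves from
   [t] to t' s followed by j_s. *)
Definition down_mor (t t' : seq S) (s : S) (r : seq S)
    (mv : braid_moves C t (t' ++ [:: s])) :
    BS (t ++ s :: r) -> BS (t' ++ ([:: s] ++ r)) :=
  BSmid t' r (@j_mor s) \o
  BScast (esym (catA t' [:: s] (s :: r))) \o
  BStens (braid_mor (@f_mor L) mv) (@idfun (BS (s :: r))).

Arguments down_mor {t t' s} r mv _.

(* [tree_node e path t r h]: the node BS(t) BS(r) of the tree of [e] at address
   [path], with [h] the composite of the morphisms from the root to it. *)
Inductive tree_node (e : seq S) :
    seq bool -> forall t r : seq S, (BS e -> BS (t ++ r)) -> Prop :=
| tree_root : @tree_node e [::] [::] e idfun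
| tree_up0 path t s r h : @tree_node e path t (s :: r) h ->
    (length C (word_prod C t) < length C (word_prod C t * gen C s)%g)%N ->
    @tree_node e (rcons path false) t r (BSmid t r (@m_mor s) \o h)
| tree_up1 path t s r h : @tree_node e path t (s :: r) h ->
    (length C (word_prod C t) < length C (word_prod C t * gen C s)%g)%N ->
    @tree_node e (rcons path true) (t ++ [:: s]) r
      (BScast (catA t [:: s] r) \o h)
| tree_down0 path t s r h (ht : reduced C t)
    (hs : (length C (word_prod C t * gen C s)%g < length C (word_prod C t))%N) :
    @tree_node e path t (s :: r) h ->
    @tree_node e (rcons path false) (projT1 (node_moves L e path ht hs)) r
      (BSmid _ r (@m_mor s) \o down_mor r (projT2 (node_moves L e path ht hs)) \o h)
| tree_down1 path t s r h (ht : reduced C t)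
    (hs : (length C (word_prod C t * gen C s)%g < length C (word_prod C t))%N) :
    @tree_node e path t (s :: r) h ->
    @tree_node e (rcons path true) (projT1 (node_moves L e path ht hs) ++ [:: s]) r
      (BScast (catA _ [:: s] r) \o
       down_mor r (projT2 (node_moves L e path ht hs)) \o h).

(* [leaf e u l]: [l] belongs to L_e(u). *)
Inductive leaf (e : seq S) : forall u : W, (BS e -> BS (rex L u)) -> Prop :=
| LeafEnd path t h (ht : reduced C t) : @tree_node e path t [::] h ->
    @leaf e (word_prod C t)
      (braid_mor (@f_mor L) (end_moves L ht) \o BScast (cats0 t) \o h).

End BottSamelson.

Arguments BS {W S C K d} V e.
Arguments standard {W S C K d} V x.
Arguments beta {W S C K d V e} _.
Arguments rex {W S C K d V} L x : rename.
Arguments leaf {W S C K d V} L e u l : rename.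
Arguments redhom_tens {K d B B'} f c.
Arguments redhom_gr {K d B B'} i x.
Arguments redhom_comp {K d B1 B2 B3} x y.
Arguments hom_degree {K d B B'} k f.

(* Main.v *)
(* Let e be the chosen expression of w, and let D(M) be the sequence of descents
   met by a subexpression M of e. Putting x_s before each letter s at which D(M)
   has a descent, and 1 elsewhere, gives an element b_M of BS(e). The leaf of M
   sends b_M to 1 (x) ... (x) 1, and it kills b_N when the first difference
   between D(M) and D(N) is a descent of M. As M is determined by D(M) and its
   endpoint, the leaves ending at x pair unitriangularly with the b_M; as
   Hom(BS(e), R_x) has at most one dimension per subexpression over the fraction
   field, they form a basis.

   The degree of G forces its path to have no descents, so that beta_u o G is the
   evaluation of BS(v) at a subexpression M all of whose steps ascend. It remains
   to see that beta_v f = 0 implies that beta_u G f vanishes modulo R^+, for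
   f : BS(e) -> BS(v). Delete from the expression of v the first letter s that M
   skips, t being the prefix before it. The shorter expression v' is still
   reduced, and beta_v' composed with id (x) m_s (x) id agrees with beta_v modulo
   the linear form t(x_s). Hence beta_v' (id (x) m_s (x) id) f = t(x_s) beta_v' h
   for some h : BS(e) -> BS(v'), by the spanning property of the leaves, and one
   concludes by induction applied to (id (x) m_s (x) id) f - t(x_s) h. *)

Require Import Defs.
From HB Require Import structures.
From mathcomp Require Import all_boot all_order all_algebra.
From mathcomp Require Import boolp classical_sets functions reals.
From mathcomp Require Import freeg mpoly ring.
Import Defs.

Set Implicit Arguments.
Unset Strict Implicit.
Unset Printing Implicit Defensive.

(** * Reflections and ascending subexpressions *)

Section CoxeterCombinatorics.
Variables (W : groupType) (S : Type) (C : coxeter_system W S).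
Implicit Types (x y z t : W) (s r : S) (e : seq S).
Local Open Scope group_scope.
Local Notation wp := (word_prod C).
Local Notation len := (length C).

Lemma word_prod_cat e e' : wp (e ++ e') = wp e * wp e'.
Proof. by elim: e => [|s e IH]; rewrite /= ?mul1g // IH mulgA. Qed.

Lemma word_prod1 s : wp [:: s] = C s.
Proof. by rewrite /= mulg1. Qed.

Lemma genK s x : C s * (C s * x) = x.
Proof. by rewrite mulgA gen_invol mul1g. Qed.

Lemma mulgenK s x : x * C s * C s = x.
Proof. by rewrite -mulgA gen_invol mulg1. Qed.

Lemma genV s : (C s)^-1 = C s.
Proof. by apply: (mulgI (C s)); rewrite mulgV gen_invol. Qed.

Lemma length_word e : len (wp e) <= size e.
Proof.
by rewrite /length; case: ex_minnP => n _; apply; apply/asboolP; exists e.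
Qed.

Lemma length_witness x : exists2 e, size e = len x & wp e = x.
Proof.
rewrite /length; case: ex_minnP => n /asboolP[e [hn he]] _.
by exists e.
Qed.

Lemma length1 : len 1 = 0.
Proof. by apply/eqP; rewrite -leqn0 -[1]/(wp [::]) length_word. Qed.

Lemma length_mul x y : len (x * y) <= len x + len y.
Proof.
have [e <- ex] := length_witness x; have [e' <- ey] := length_witness y.
by rewrite -size_cat -ex -ey -word_prod_cat length_word.
Qed.

Lemma length_gen_le s : len (C s) <= 1.
Proof. by rewrite -word_prod1 length_word. Qed.

(** A relator (st)^m has 2m letters, so the presentation changes the number of letters only by even
    amounts. *)
Lemma cox_equiv_parity e e' : cox_equiv C e e' -> odd (size e) = odd (size e').
Proof.
elim=> // [a e1 e2 _ -> _ -> //|a b s t m _].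
rewrite !size_cat !oddD size_flatten /shape map_nseq sumn_nseq /=.
by rewrite oddM.
Qed.

Lemma length_parity e : odd (len (wp e)) = odd (size e).
Proof.
have [e' <- /gen_pres] := length_witness (wp e); exact: cox_equiv_parity.
Qed.

Lemma length_mulgen_neq x s : len (x * C s) != len x.
Proof.
have [e _ <-] := length_witness x.
have -> : wp e * C s = wp (rcons e s) by rewrite -cats1 word_prod_cat word_prod1.
apply/eqP => /(congr1 odd); rewrite !length_parity size_rcons /=.
by case: odd.
Qed.

Lemma length_mulgen_gtNlt x s : (len x < len (x * C s)) = ~~ (len (x * C s) < len x).
Proof. by rewrite -leqNgt ltn_neqAle eq_sym length_mulgen_neq. Qed.

Lemma length_mulgen_up x s : len x < len (x * C s) -> len (x * C s) = (len x).+1.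
Proof.
move=> h; apply/eqP; rewrite eqn_leq h andbT.
by rewrite (leq_trans (length_mul _ _)) // -addn1 leq_add2l length_gen_le.
Qed.

Lemma length_mulgen_down x s :
  len (x * C s) < len x -> len x = (len (x * C s)).+1.
Proof.
by move=> h; have := @length_mulgen_up (x * C s) s; rewrite mulgenK; apply.
Qed.

Lemma reducedP e : reduced C e -> size e = len (wp e).
Proof. by move/eqP. Qed.

Lemma reduced_cat e e' : reduced C (e ++ e') -> reduced C e /\ reduced C e'.
Proof.
rewrite /reduced size_cat word_prod_cat => /eqP h.
have h1 := length_mul (wp e) (wp e'); have h2 := length_word e.
have h3 := length_word e'; rewrite -h in h1.
split; rewrite eqn_leq ?h2 ?h3 andbT.
  by rewrite -(leq_add2r (size e')) (leq_trans h1) // leq_add2l.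
by rewrite -(leq_add2l (size e)) (leq_trans h1) // leq_add2r.
Qed.

Lemma reduced_up e s :
  reduced C e -> len (wp e) < len (wp e * C s) -> reduced C (e ++ [:: s]).
Proof.
move=> /reducedP he hs; rewrite /reduced word_prod_cat word_prod1 size_cat addn1.
by rewrite he length_mulgen_up.
Qed.

(* The parity of the number of occurrences of [t] among the reflections
   s_1 ... s_(i-1) s_i s_(i-1) ... s_1 attached to the word [e]. *)
Fixpoint refl_parity e t : bool :=
  if e is s :: e' then (t == C s) (+) refl_parity e' (C s * t * C s) else false.

Lemma refl_parity_cat e e' t :
  refl_parity (e ++ e') t = refl_parity e t (+) refl_parity e' ((wp e)^-1 * t * wp e).
Proof.
elim: e t => [|s e IH] t /=; first by rewrite invg1 mul1g mulg1.
by rewrite IH addbA invgM genV !mulgA.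
Qed.

(** The first two letters give the exponents 0 and 1. The remaining reflections are the same list
    conjugated by [C s * C r], which raises each exponent by two. *)
Lemma refl_parity_pow s r k t :
  refl_parity (flatten (nseq k [:: s; r])) t =
  \big[addb/false]_(0 <= i < k.*2) (t == (C s * C r) ^+ i * C s).
Proof.
elim: k t => [|k IH] t; first by rewrite big_geq.
rewrite doubleS /= IH big_nat_recl // big_nat_recl // expg0 mul1g !addbA expg1.
congr (_ (+) _ (+) _).
  by rewrite -[in RHS](inj_eq (mulgI (C s))) -(inj_eq (mulIg (C s))) !mulgA
    gen_invol mul1g mulgenK.
apply: eq_bigr => i _; set a := C s * C r; set t' := C r * _ * _.
have -> : a ^+ i.+2 * C s = a * (a ^+ i * C s) * (C r * C s).
  by rewrite expgS expgSr /a !mulgA.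
have -> : t = a * t' * (C r * C s) by rewrite /a /t' !mulgA !(mulgenK, gen_invol, mul1g).
by rewrite (inj_eq (mulIg _)) (inj_eq (mulgI _)).
Qed.

(** Since (sr)^m = 1, the exponents i and i + m give the same reflection, so a relator counts every
    reflection an even number of times. *)
Lemma refl_parity_equiv e e' t :
  cox_equiv C e e' -> refl_parity e t = refl_parity e' t.
Proof.
move=> h; elim: h t => {e e'} [//|//|e e' e'' _ h1 _ h2 t|a b s r m hm t].
  by rewrite h1 h2.
have [m_gt0 em _] := hm.
have ew : wp (flatten (nseq m [:: s; r])) = 1.
  rewrite -em; elim: m {hm m_gt0 em} => [|m IH] //=.
  by rewrite IH expgS !mulgA.
rewrite !refl_parity_cat ew invg1 mul1g mulg1.
suff -> : refl_parity (flatten (nseq m [:: s; r])) ((wp a)^-1 * t * wp a) = false.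
  by [].
rewrite refl_parity_pow -addnn (@big_cat_nat _ _ _ m) //= ?leq_addr //.
rewrite -{2}[m]addn0 addnC big_addn addnK.
under [X in _ (+) X]eq_bigr do rewrite expgnDr em mulg1.
by rewrite addbb.
Qed.

Lemma refl_parity_prod e e' t : wp e = wp e' -> refl_parity e t = refl_parity e' t.
Proof. by move=> /gen_pres; apply: refl_parity_equiv. Qed.

Lemma word_prod_rev e : wp (rev e) = (wp e)^-1.
Proof.
elim: e => [|s e IH]; first by rewrite invg1.
by rewrite rev_cons -cats1 word_prod_cat IH word_prod1 /= invgM genV.
Qed.

(** The middle letter contributes one occurrence. The contributions of [e] and of [rev e] agree
    modulo 2, because [e ++ rev e] represents 1 and so has even counts. *)
Lemma refl_parity_refl e s :
  refl_parity (e ++ s :: rev e) (wp e * C s * (wp e)^-1).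
Proof.
set t := _ * _ * _; rewrite refl_parity_cat /=.
have -> : (wp e)^-1 * t * wp e = C s by rewrite /t !mulgA mulVg mul1g mulgVK.
rewrite eqxx gen_invol mul1g.
have := refl_parity_cat e (rev e) t.
rewrite (@refl_parity_prod (e ++ rev e) [::]) /=; last first.
  by rewrite word_prod_cat word_prod_rev mulgV.
have -> : (wp e)^-1 * t * wp e = C s by rewrite /t !mulgA mulVg mul1g mulgVK.
by case: (refl_parity e t); case: refl_parity.
Qed.

(** An odd count is positive, and deleting a letter whose attached reflection is [t] multiplies the
    product by [t] on the left. *)
Lemma refl_parity_del e t : refl_parity e t ->
  exists a s b, e = a ++ s :: b /\ t * wp e = wp (a ++ b).
Proof.
elim: e t => [//|s e IH] t /=.
case: eqP => [-> _|_] /=; first by exists [::], s, e; rewrite genK.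
move=> /IH[a [r [b [-> h]]]]; exists (s :: a), r, b; split=> //=.
by rewrite -h !mulgA gen_invol mul1g.
Qed.

(** If [t] had even count in [e], then prefixing a word of [t] in which [t] has odd count would make
    its count odd in every word of [t * wp e]. A shortest such word could lose a letter and give
    [wp e], against the inequality of lengths. *)
Lemma strong_exchange e t : is_reflection C t -> len (t * wp e) < len (wp e) ->
  exists a s b, e = a ++ s :: b /\ t * wp e = wp (a ++ b).
Proof.
move=> [x [s et]] hlt; apply: refl_parity_del; apply/negPn/negP => he.
have [ex _ hx] := length_witness x.
have tt : t * t = 1 by rewrite et !mulgA mulgVK mulgenK mulgV.
have tK y : t * (t * y) = y by rewrite mulgA tt mul1g.
have [e' he' hp'] := length_witness (t * wp e).
have : refl_parity e' t.
  rewrite (@refl_parity_prod e' ((ex ++ s :: rev ex) ++ e)); last first.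
    by rewrite hp' 2!word_prod_cat /= word_prod_rev hx et !mulgA.
  rewrite refl_parity_cat {1}et -hx refl_parity_refl word_prod_cat /=.
  have -> : wp ex * (C s * wp (rev ex)) = t.
    by rewrite et hx word_prod_rev hx mulgA.
  by rewrite mulVg mul1g (negbTE he).
case/refl_parity_del=> [a [r [b [ee']]]]; rewrite hp' tK => eab.
move: hlt; rewrite -he' ee' size_cat /= addnS ltnNge => /negP; apply.
by rewrite eab (leq_trans (length_word _)) // size_cat.
Qed.

(* If x z, x s and s z are reduced, then so is x s z: for z = z' r, were
   x s z' r shorter than x s z', the reflection x s x^-1 would remove a letter
   of the reduced word x z' r, and the only candidate r forces s z' = z' r. *)
Lemma length_insert s e x :
  len (x * wp e) = len x + size e -> len x < len (x * C s) ->
  reduced C (s :: e) -> len (x * C s * wp e) = (len x).+1 + size e.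
Proof.
elim/last_ind: e => [|e r IH] hxe hxs hse.
  by rewrite /= mulg1 addn0 length_mulgen_up.
have {IH} hxse : len (x * C s * wp e) = (len x).+1 + size e.
  apply: IH => //; last first.
    by move: hse; rewrite -cats1 -cat_cons => /reduced_cat[].
  apply/eqP; rewrite eqn_leq; apply/andP; split.
    by rewrite (leq_trans (length_mul _ _)) // leq_add2l length_word.
  rewrite -(leq_add2r 1) -addnA addn1 -(size_rcons e r) -hxe -cats1.
  rewrite word_prod_cat mulgA (leq_trans (length_mul _ _)) // leq_add2l.
  exact: length_word.
have hr : reduced C (rcons e r) by move: hse; rewrite -cat1s => /reduced_cat[].
move: hxe hse hr; rewrite -cats1 size_cat addn1 word_prod_cat word_prod1 !mulgA.
move=> hxe hse /reducedP hr; move: (length_mulgen_neq (x * C s * wp e) r).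
rewrite neq_ltn => /orP[hlt|hgt]; last first.
  by rewrite length_mulgen_up // hxse addnS.
exfalso; have := length_mulgen_down hlt; rewrite hxse addSn => -[hl].
set t := x * C s * x^-1.
have [ex hex ex_x] := length_witness x.
have ew : wp (ex ++ e ++ [:: r]) = x * wp e * C r.
  by rewrite !word_prod_cat ex_x word_prod1 mulgA.
have et : t * wp (ex ++ e ++ [:: r]) = x * C s * wp e * C r.
  by rewrite ew /t !mulgA mulgVK.
have [] := @strong_exchange (ex ++ e ++ [:: r]) t.
- by exists x, s.
- by rewrite et ew hxe -hl addnS ltnS.
move=> a [q [b [eab]]]; rewrite et.
have : (size b == 0) || (0 < size b) by case: b {eab}.
case/orP => [/nilP eb|].
  move: eab; rewrite eb cats0 catA !cats1 => /rcons_inj[<- _].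
  rewrite word_prod_cat ex_x -!mulgA => /mulgI h.
  move: hse; rewrite /reduced /= word_prod_cat word_prod1 h.
  rewrite size_cat addn1 => /eqP h'.
  by have := length_word e; rewrite -h' ltnNge leqnSn.
(* The deleted letter is not the last one: cancelling [r] leaves a word for [x * C s * wp e] with
   fewer letters than its length. *)
case/lastP: b eab => [//|b r'] eab _.
move: eab; rewrite catA cats1 -rcons_cons -rcons_cat => /rcons_inj[e1 <-] {r'}.
rewrite -rcons_cat -cats1 word_prod_cat word_prod1 => /mulIg h.
have := length_word (a ++ b); rewrite -h hxse leqNgt => /negP; apply.
by rewrite addSn ltnS -hex -size_cat e1 !size_cat /= addnS ltnW.
Qed.

(* The subexpression of [e] given by the mask [M] determines a path in the tree
   of [e], and conversely; [descents 1 M e] tells the nodes of type (b) on it. *)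
Fixpoint descents y (M : seq bool) e : seq bool :=
  if e is s :: e' then
    (len (y * C s) < len y)%N ::
      descents (if head false M then y * C s else y) (behead M) e'
  else [::].

Lemma size_descents y M e : size (descents y M e) = size e.
Proof. by elim: e y M => //= s e IH y M; rewrite IH. Qed.

Lemma descents_cat y M M' e e' : size M = size e ->
  descents y (M ++ M') (e ++ e') =
  descents y M e ++ descents (y * wp (mask M e)) M' e'.
Proof.
elim: e M y => [|s e IH] [|b M] y //=; first by rewrite mulg1.
by move=> [hM]; rewrite IH //; case: b; rewrite //= mulgA.
Qed.

(** Read backwards from the endpoint: a step for the letter [s] that ends at z started at z or at
    zs. Exactly one of these two has a descent at [s], so the descent bit tells which. *)
Lemma descents_inj e M M' y y' : size M = size e -> size M' = size e ->
  descents y M e = descents y' M' e ->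
  y * wp (mask M e) = y' * wp (mask M' e) -> y = y' /\ M = M'.
Proof.
elim: e M M' y y' => [|s e IH] [|b M] [|b' M'] y y' //=.
  by rewrite !mulg1.
move=> [hM] [hM'] [hd hD] hx.
have hx' : (if b then y * C s else y) * wp (mask M e) =
    (if b' then y' * C s else y') * wp (mask M' e).
  by move: hx; case: (b); case: (b'); rewrite /= ?mulgA.
have [eyy <-] := IH M M' _ _ hM hM' hD hx'.
case: b b' {hx hD hx'} eyy => [] [] //=; first by move/mulIg.
  move=> hy; move: hd; rewrite -hy mulgenK => hd.
  by have := length_mulgen_gtNlt y s; rewrite -hd; case: ltnP.
move=> hy; move: hd; rewrite hy mulgenK => hd.
by have := length_mulgen_gtNlt y' s; rewrite hd; case: ltnP.
Qed.

(** A taken ascent raises the length by one; a skipped letter is an ascent too, and [length_insert]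
    puts it back. This is what keeps a word reduced when a skipped letter is deleted in front of
    [e]. *)
Lemma reduced_no_descents y M e : size M = size e -> reduced C e ->
  descents y M e = nseq (size e) false -> len (y * wp e) = len y + size e.
Proof.
elim: e M y => [|s e IH] [|b M] y //=; first by rewrite mulg1 addn0.
move=> [hM] he [hs hd].
have [_ he'] : reduced C [:: s] /\ reduced C e by apply: reduced_cat.
have hup : len y < len (y * C s) by rewrite length_mulgen_gtNlt hs.
case: b hd => hd; rewrite mulgA.
  by rewrite (IH M) // length_mulgen_up // addSnnS.
by rewrite length_insert ?(IH M) // addSnnS.
Qed.

End CoxeterCombinatorics.

Import GRing.Theory Num.Theory.
Local Open Scope ring_scope.

(** * The action on polynomials and Demazure operators *)

Section PolynomialAction.
Variables (W : groupType) (S : Type) (C : coxeter_system W S).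
Variables (K : realType) (d : nat) (V : refl_faithful C K d).
Implicit Types (x y : W) (s : S) (i j : int).
Local Notation R := {mpoly K[d]}.
Local Notation act := (wact V).
Local Notation xs := (xs V).
Implicit Types (p q r : R).

Lemma mpoly_ring_ind (Q : R -> Prop) :
  (forall c, Q c%:MP) -> (forall k : 'I_d, Q 'X_k) ->
  (forall p q, Q p -> Q q -> Q (p + q)) ->
  (forall p q, Q p -> Q q -> Q (p * q)) -> forall p, Q p.
Proof.
move=> QC QX QD QM p; rewrite [p]mpolyE.
elim/big_ind: _ => [|//|m _]; first by rewrite -mpolyC0.
rewrite -mul_mpolyC; apply: (QM) (QC _) _; rewrite mpolyXE_id.
elim/big_ind: _ => [|//|k _]; first by rewrite -mpolyC1.
elim: (m k) => [|n IH]; first by rewrite expr0 -mpolyC1.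
by rewrite exprS; apply: QM.
Qed.

Lemma wactD x : {morph act x : p q / p + q}.
Proof. by move=> p q; rewrite /wact rmorphD. Qed.
Lemma wactB x : {morph act x : p q / p - q}.
Proof. by move=> p q; rewrite /wact rmorphB. Qed.
Lemma wactN x : {morph act x : p / - p}.
Proof. by move=> p; rewrite /wact rmorphN. Qed.
Lemma wact0 x : act x 0 = 0.
Proof. by rewrite /wact rmorph0. Qed.
Lemma wact_one x : act x 1 = 1.
Proof. by rewrite /wact rmorph1. Qed.
Lemma wactC x c : act x c%:MP = c%:MP.
Proof. by rewrite /wact comp_mpolyC. Qed.
Lemma wactMn x n : {morph act x : p / p *+ n}.
Proof. by move=> p; rewrite /wact rmorphMn. Qed.

Definition linform (v : 'rV[K]_d) : R := \sum_k v 0 k *: 'X_k.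

Lemma linformD v w : linform (v + w) = linform v + linform w.
Proof. by rewrite /linform -big_split /=; apply: eq_bigr => k _; rewrite mxE scalerDl. Qed.

Lemma linformN v : linform (- v) = - linform v.
Proof. by rewrite /linform -sumrN; apply: eq_bigr => k _; rewrite mxE scaleNr. Qed.

Lemma linformZ a v : linform (a *: v) = a *: linform v.
Proof. by rewrite /linform scaler_sumr; apply: eq_bigr => k _; rewrite mxE scalerA. Qed.

Lemma linform_delta k : linform (delta_mx 0 k) = 'X_k.
Proof.
rewrite /linform (bigD1 k) //= mxE !eqxx scale1r big1 ?addr0 // => l.
by rewrite mxE eqxx /= => /negbTE->; rewrite scale0r.
Qed.

Lemma linform_inj : injective linform.
Proof.
move=> v w; have hc u k : (linform u)@_U_(k)%MM = u 0 k.
  rewrite /linform raddf_sum (bigD1 k) //= mcoeffZ mcoeffXU eqxx mulr1.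
  rewrite big1 ?addr0 // => l /negbTE hl.
  by rewrite mcoeffZ mcoeffXU hl mulr0.
by move=> e; apply/rowP => k; rewrite -!hc e.
Qed.

Lemma linform_gr v : polygr 2 (linform v).
Proof.
right; exists 1%N => //; apply: rpred_sum => k _; apply: dhomogZ.
by rewrite dhomogX /= mdeg1.
Qed.

Lemma wact_linform x v : act x (linform v) = linform (v *m rho V x^-1%g).
Proof.
rewrite /wact /linform (raddf_sum (comp_mpoly _)) /=.
under eq_bigr => k _.
  rewrite comp_mpolyZ comp_mpolyXU (_ : _`_k = tnth (coord_act V x) k); last first.
    by rewrite (tnth_nth 0).
  rewrite tnth_mktuple scaler_sumr; over.
rewrite exchange_big; apply: eq_bigr => l _ /=.
rewrite mxE scaler_suml; apply: eq_bigr => k _; by rewrite scalerA.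
Qed.

Lemma wactX x k : act x 'X_k = linform (row k (rho V x^-1%g)).
Proof. by rewrite -linform_delta wact_linform -rowE. Qed.

Lemma wact_id p : act 1%g p = p.
Proof.
elim/mpoly_ring_ind: p => [c|k|p q hp hq|p q hp hq]; first exact: wactC.
- by rewrite wactX invg1 rho1 row1 linform_delta.
- by rewrite wactD hp hq.
- by rewrite wactM hp hq.
Qed.

Lemma wact_mul x y p : act (x * y)%g p = act x (act y p).
Proof.
elim/mpoly_ring_ind: p => [c|k|p q hp hq|p q hp hq]; first by rewrite !wactC.
- by rewrite !wactX wact_linform invgM rhoM row_mul.
- by rewrite !wactD hp hq.
- by rewrite !wactM hp hq.
Qed.

Lemma wactK x : cancel (act x) (act x^-1%g).
Proof. by move=> p; rewrite -wact_mul mulVg wact_id. Qed.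

Lemma wactVK x : cancel (act x^-1%g) (act x).
Proof. by move=> p; rewrite -wact_mul mulgV wact_id. Qed.

Lemma wact_inj x : injective (act x).
Proof. exact: can_inj (wactK x). Qed.

Lemma wact_faithful x y : (forall p, act x p = act y p) -> x = y.
Proof.
move=> h; apply: invg_inj; apply: (@rho_inj _ _ _ _ _ V).
apply/row_matrixP => k; apply: linform_inj.
by rewrite -!wactX h.
Qed.

Lemma wact_const x p : (act x p)@_0%MM = p@_0%MM.
Proof.
elim/mpoly_ring_ind: p => [c|k|p q hp hq|p q hp hq]; first by rewrite wactC.
- rewrite wactX /linform raddf_sum big1 ?mcoeffX ?mnm1_eq0 // => l _ /=.
  by rewrite mcoeffZ mcoeffX mnm1_eq0 mulr0.
- by rewrite wactD !mcoeffD hp hq.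
- by rewrite wactM !rmorphM /= hp hq.
Qed.

Lemma root_neq0 s : root V s != 0.
Proof.
apply/eqP => hr.
have hs : rho V (C s) = 1%:M.
  apply/matrixP => k l.
  have [h _] := rootP V s (delta_mx l 0).
  have := h; rewrite hr mul0mx => /(_ erefl) /colP /(_ k).
  by rewrite -colE mxE => ->; rewrite !mxE eqxx andbT.
have [_] := rho_refl V (C s).
have rs : is_reflection C (C s) by exists 1%g, s; rewrite invg1 mul1g mulg1.
move/(_ rs); rewrite hs subrr trmx0.
by rewrite mxrank_ker mxrank0 subn0 => /eqP; rewrite eqn_leq ltnn.
Qed.

(* v + s v is fixed by s, hence killed by the root. *)
Lemma root_anti s : root V s *m rho V (C s) = - root V s.
Proof.
apply/rowP => k; rewrite [RHS]mxE; apply/eqP; rewrite -addr_eq0; apply/eqP.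
pose v : 'cV[K]_d := delta_mx k 0.
have [_] := rootP V s (rho V (C s) *m v + v).
have -> : rho V (C s) *m (rho V (C s) *m v + v) = rho V (C s) *m v + v.
  by rewrite mulmxDr mulmxA -rhoM gen_invol rho1 mul1mx addrC.
move/(_ erefl); rewrite mulmxDr mulmxA -mulmxDl -colE => /matrixP/(_ 0 0).
by rewrite !mxE.
Qed.

Lemma xsE s : xs s = linform (root V s). Proof. by []. Qed.

Lemma wact_xs s : act (C s) (xs s) = - xs s.
Proof. by rewrite !xsE wact_linform genV root_anti linformN. Qed.

Lemma xs_neq0 s : xs s != 0.
Proof.
rewrite xsE; apply/eqP; rewrite -[RHS](_ : linform 0 = 0).
  by move/linform_inj/eqP; rewrite (negbTE (root_neq0 s)).
by rewrite -[0](scale0r (0 : 'rV_d)) linformZ scale0r.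
Qed.

Lemma two_xs_neq0 s : 2%:R * xs s != 0.
Proof.
rewrite mulf_neq0 ?xs_neq0 // -mpolyC_nat mpolyC_eq0.
by rewrite pnatr_eq0.
Qed.

Lemma polygrC (c : K) : polygr 0 (c%:MP : R).
Proof. by right; exists 0%N; rewrite // -[c%:MP]mulr1 mul_mpolyC dhomogZ ?dhomog1. Qed.

Lemma xs_gr s : polygr 2 (xs s).
Proof. exact: linform_gr. Qed.

Lemma gen_actK s p : act (C s) (act (C s) p) = p.
Proof. by rewrite -wact_mul gen_invol wact_id. Qed.

(* 1 - s vanishes on the hyperplane of s, hence factors through its equation. *)
Lemma linform_sub_act s v :
  exists c : K, linform v - act (C s) (linform v) = c *: xs s.
Proof.
rewrite wact_linform genV -linformN -linformD.
suff : (v - v *m rho V (C s) <= root V s)%MS.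
  by move=> /submxP[D ->]; exists (D 0 0); rewrite [D]mx11_scalar mul_scalar_mx
    linformZ mxE eqxx mulr1n.
rewrite submxE; apply/eqP/matrixP => a b.
suff /matrixP/(_ a 0) :
    (v - v *m rho V (C s)) *m cokermx (root V s) *m delta_mx b 0 = 0 :> 'cV_1.
  by rewrite -colE [in LHS]mxE => ->; rewrite !mxE.
(* A column of the cokernel matrix is killed by the root, so it lies on the hyperplane of [s] and is
   fixed by [s]. *)
have [h _] := rootP V s (cokermx (root V s) *m delta_mx b 0).
rewrite -mulmxA mulmxBl -(mulmxA v) h ?subrr //.
by rewrite mulmxA mulmx_coker mul0mx.
Qed.

(** The rule d(pq) = d(p) q + s(p) d(q), with d the Demazure operator, reduces the existence and the
    degree of the quotient to linear forms, where the quotient is a constant. *)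
Lemma demazure_exists_gr s i p : polygr i p ->
  exists2 q, (2%:R * xs s) * q = p - act (C s) p & polygr (i - 2) q.
Proof.
have h0 j : exists2 q, (2%:R * xs s) * q = 0 - act (C s) 0 & polygr (j - 2) q.
  by exists 0; [rewrite mulr0 wact0 subrr | apply: polygr0].
have hM j k p' q' : polygr j p' -> polygr k q' ->
    (exists2 q, (2%:R * xs s) * q = p' - act (C s) p' & polygr (j - 2) q) ->
    (exists2 q, (2%:R * xs s) * q = q' - act (C s) q' & polygr (k - 2) q) ->
    exists2 q, (2%:R * xs s) * q = p' * q' - act (C s) (p' * q') &
      polygr (j + k - 2) q.
  move=> hp' hq' [f ef hf] [g eg hg]; exists (f * q' + act (C s) p' * g).
    by rewrite mulrDr mulrA ef mulrCA eg wactM mulrBl mulrBr addrA subrK.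
  rewrite -[_ * g]opprK; apply: polygrB.
    by rewrite addrAC; apply: polygrM.
  rewrite -mulNr -addrA; apply: polygrM => //; rewrite -sub0r.
  by apply: polygrB; [apply: polygr0 | apply: polygr_wact].
move=> [->|[n -> hp]]; first exact: h0.
suff hX (m : 'X_{1..d}) : exists2 q,
    (2%:R * xs s) * q = 'X_[m] - act (C s) 'X_[m] & polygr ((2 * mdeg m)%:Z - 2) q.
  rewrite [p]mpolyE big_seq.
  elim/big_ind: _ => [|a b [f ef hf] [g eg hg]|m hm]; first exact: h0.
    exists (f + g); first by rewrite mulrDr ef eg wactD opprD addrACA.
    rewrite -[g]opprK; apply: polygrB => //.
    by rewrite -sub0r; apply: polygrB => //; apply: polygr0.
  have [q eq hq] := hX m; exists (p@_m *: q).
    by rewrite -scalerAr eq scalerBr /wact comp_mpolyZ.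
  have -> : n = mdeg m by rewrite (dhomog_mf hp).
  rewrite -mul_mpolyC -[_ - 2]add0r; apply: polygrM => //.
  exact: polygrC.
(* The homogeneity of the monomial joins the induction because the product rule [hM] asks for the
   degrees of both factors. *)
suff : exists2 q, (2%:R * xs s) * q = 'X_[m] - act (C s) 'X_[m] &
    polygr ((2 * mdeg m)%:Z - 2) q /\ polygr (2 * mdeg m)%:Z ('X_[m] : R).
  by move=> [q h [h1 _]]; exists q.
rewrite mdegE mpolyXE_id.
have pgX (k : 'I_d) : polygr 2 ('X_k : R).
  by rewrite -linform_delta; apply: linform_gr.
have pg1 : polygr 0 (1 : R).
  by rewrite -mpolyC1; apply: polygrC.
have one : exists2 q, (2%:R * xs s) * q = 1 - act (C s) 1 &
    polygr ((2 * 0)%:Z - 2) q /\ polygr (2 * 0)%:Z (1 : R).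
  by exists 0; [rewrite mulr0 wact_one subrr | split => //; apply: polygr0].
have mul a b (u v : R) :
    (exists2 q, (2%:R * xs s) * q = u - act (C s) u &
      polygr ((2 * a)%:Z - 2) q /\ polygr (2 * a)%:Z u) ->
    (exists2 q, (2%:R * xs s) * q = v - act (C s) v &
      polygr ((2 * b)%:Z - 2) q /\ polygr (2 * b)%:Z v) ->
    exists2 q, (2%:R * xs s) * q = u * v - act (C s) (u * v) &
      polygr ((2 * (a + b))%:Z - 2) q /\ polygr (2 * (a + b))%:Z (u * v).
  move=> [f ef [hf hu]] [g eg [hg hv]].
  have [||q eq hq] := hM _ _ _ _ hu hv; [by exists f | by exists g |].
  exists q => //; rewrite mulnDr PoszD; split=> //; exact: polygrM.
elim/big_rec2: _ => [//|k u a _ IH]; refine (mul _ _ _ _ _ IH).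
elim: (m k) => [//|b IHb]; rewrite exprS -[b.+1]add1n; refine (mul 1%N b _ _ _ IHb).
have [c ec] := linform_sub_act s (delta_mx 0 k).
exists ((2%:R^-1 * c)%:MP).
  rewrite -linform_delta ec -mul_mpolyC mulrC mulrA -mpolyC_nat -mpolyCM.
  by rewrite mulrAC mulVf ?pnatr_eq0 // mul1r.
by split=> //; exact: polygrC.
Qed.

Lemma demazureE s p : (2%:R * xs s) * demazure V s p = p - act (C s) p.
Proof.
have : exists q, (2%:R * xs s) * q = p - act (C s) p.
  elim/mpoly_ind_gr: p => [i p /(demazure_exists_gr s)[q hq _]|p q [f hf] [g hg]].
    by exists q.
  by exists (f + g); rewrite mulrDr hf hg wactD opprD addrACA.
move=> [q hq]; rewrite /demazure; case: xgetP => //= /(_ q) h.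
by case: h.
Qed.

Lemma demazure_eq s p q : (2%:R * xs s) * q = p - act (C s) p -> demazure V s p = q.
Proof. by rewrite -demazureE => /(mulfI (two_xs_neq0 s)). Qed.

Lemma demazure_gr s i p : polygr i p -> polygr (i - 2) (demazure V s p).
Proof. by move=> /(demazure_exists_gr s)[q /demazure_eq->]. Qed.

Lemma demazureD s p q : demazure V s (p + q) = demazure V s p + demazure V s q.
Proof. by apply: demazure_eq; rewrite mulrDr !demazureE wactD opprD addrACA. Qed.

Lemma demazureMl s p q :
  act (C s) p = p -> demazure V s (p * q) = p * demazure V s q.
Proof.
by move=> hp; apply: demazure_eq; rewrite mulrCA demazureE wactM hp mulrBr.
Qed.

Lemma demazure1 s : demazure V s 1 = 0.
Proof. by apply: demazure_eq; rewrite mulr0 wact_one subrr. Qed.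

Lemma demazure_xs s : demazure V s (xs s) = 1.
Proof. by apply: demazure_eq; rewrite wact_xs opprK mulr1 mulr_natl mulr2n. Qed.

Lemma demazure_inv s p : act (C s) (demazure V s p) = demazure V s p.
Proof.
apply/esym/demazure_eq; apply: (@wact_inj (C s)).
rewrite wactM wactB gen_actK gen_actK wactM wact_xs.
have -> : act (C s) 2%:R = 2%:R by rewrite -mpolyC_nat wactC.
by rewrite mulrN mulNr demazureE opprB.
Qed.

Definition symmetrize s p : R := 2%:R^-1 *: (p + act (C s) p).

Lemma symmetrize_inv s p : act (C s) (symmetrize s p) = symmetrize s p.
Proof. by rewrite /symmetrize /wact comp_mpolyZ -!/(act _ _) wactD gen_actK addrC. Qed.

(** Both [symmetrize s p] and [demazure V s p] are [s]-invariant, so these are coordinates on 1 and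
    x_s over the invariants. They reduce the left action on the second factor of B_s to that of
    x_s. *)
Lemma split_inv s p : p = symmetrize s p + xs s * demazure V s p.
Proof.
have h2 : (2%:R : R) != 0 by rewrite -mpolyC_nat mpolyC_eq0 pnatr_eq0.
apply: (mulfI h2); rewrite mulrDr mulrA demazureE /symmetrize.
have -> q : 2%:R * (2%:R^-1 *: q) = q :> R.
  by rewrite mulr_natl -scaler_nat scalerA mulfV ?pnatr_eq0 // scale1r.
by rewrite addrACA subrr addr0 mulr_natl mulr2n.
Qed.

End PolynomialAction.

(** * Bott-Samelson bimodules *)

Section Bimodules.
Variables (K : realType) (d : nat).
Implicit Types (B : gbimod K d).

Lemma additive_0 (A A' : zmodType) (f : A -> A') :
  (forall x y, f (x + y) = f x + f y) -> f 0 = 0.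
Proof. by move=> fD; apply: (addrI (f 0)); rewrite -fD !addr0. Qed.

Lemma additive_B (A A' : zmodType) (f : A -> A') :
  (forall x y, f (x + y) = f x + f y) -> forall x y, f (x - y) = f x - f y.
Proof. by move=> fD x y; apply: (addIr (f y)); rewrite -fD !subrK. Qed.

Lemma hom_degree_id B : hom_degree 0 (@idfun B).
Proof. by split=> [|i x]; [split | rewrite addr0]. Qed.

Lemma bimod_hom_comp B1 B2 B3 (g : B2 -> B3) (f : B1 -> B2) :
  bimod_hom g -> bimod_hom f -> bimod_hom (g \o f).
Proof.
move=> [gD gl gr'] [fD fl fr]; split=> [x y|r x|x r] /=.
- by rewrite fD gD.
- by rewrite fl gl.
- by rewrite fr gr'.
Qed.

Lemma hom_degree_comp B1 B2 B3 (g : B2 -> B3) (f : B1 -> B2) k l :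
  hom_degree l g -> hom_degree k f -> hom_degree (k + l) (g \o f).
Proof.
move=> [hg gg] [hf fg]; split; first exact: bimod_hom_comp.
by move=> i x /fg /gg; rewrite addrA.
Qed.

Lemma bimod_hom_lact B B' (f : B -> B') r :
  bimod_hom f -> bimod_hom (fun x => lact r (f x)).
Proof.
move=> [fD fl fr]; split=> [x y|r' x|x r'].
- by rewrite fD lactDr.
- by rewrite fl -!lactA mulrC.
- by rewrite fr lractA.
Qed.

Lemma bimod_hom_sub B B' (f g : B -> B') :
  bimod_hom f -> bimod_hom g -> bimod_hom (fun x => f x - g x).
Proof.
move=> [fD fl fr] [gD gl gr']; split=> [x y|r x|x r].
- by rewrite fD gD opprD addrACA.
- by rewrite fl gl lactDr lactN.
- by rewrite fr gr' ractDl ractN.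
Qed.

Lemma bimod_hom_sum B B' (I : finType) (P : pred I) (f : I -> B -> B') :
  (forall i, P i -> bimod_hom (f i)) -> bimod_hom (fun x => \sum_(i | P i) f i x).
Proof.
move=> hf; split=> [x y|r x|x r].
- by rewrite -big_split; apply: eq_bigr => i /hf[].
- have h0 : lact r (0 : B') = 0 by rewrite lact0r.
  rewrite (big_morph _ (lactDr r) h0); by apply: eq_bigr => i /hf[].
- have h0 : ract (0 : B') r = 0 by rewrite ract0l.
  by rewrite (big_morph (fun x => ract x r) (fun x y => ractDl x y r) h0);
    apply: eq_bigr => i /hf[].
Qed.

Lemma isHomZ_sum B B' (I : finType) (P : pred I) (f : I -> B -> B') :
  (forall i, P i -> isHomZ (f i)) -> isHomZ (fun x => \sum_(i | P i) f i x).
Proof.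
move=> hf; rewrite (_ : (fun x => _) = \sum_(i | P i) f i); last first.
  by apply/funext => x; rewrite fct_sumE.
by elim/big_ind: _ => //; [apply: isHomZ0 | apply: isHomZ_add].
Qed.

End Bimodules.

Section BottSamelsonBimodules.
Variables (W : groupType) (S : Type) (C : coxeter_system W S).
Variables (K : realType) (d : nat) (V : refl_faithful C K d).
Local Notation R := {mpoly K[d]}.
Local Notation BS := (BS V).
Local Notation act := (wact V).
Local Notation wp := (word_prod C).
Local Notation mid l r f := (@BSmid _ _ _ _ _ V _ _ l r f).
Implicit Types (s : S) (e a b c : seq S) (M : seq bool) (p q r : R).

Lemma ptens_ind s e (Q : BS (s :: e) -> Prop) : Q 0 ->
  (forall x y, Q x -> Q y -> Q (x - y)) ->
  (forall p z, Q (ptens s p z)) -> forall x, Q x.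
Proof. exact: tens_ind. Qed.

Lemma ptens_lact s e r p (z : BS e) : lact r (ptens s p z) = ptens s (r * p) z.
Proof. exact: tens_lact_pure. Qed.

Lemma ptens_ract s e r p (z : BS e) : ract (ptens s p z) r = ptens s p (ract z r).
Proof. exact: tens_ract_pure. Qed.

Lemma ptensDl s e p q (z : BS e) : ptens s (p + q) z = ptens s p z + ptens s q z.
Proof. exact: pureDl. Qed.

Lemma ptensDr s e p (z z' : BS e) : ptens s p (z + z') = ptens s p z + ptens s p z'.
Proof. exact: pureDr. Qed.

Lemma ptens_inv s e p q (z : BS e) : act (C s) q = q ->
  ptens s (p * q) z = ptens s p (lact q z).
Proof. by move=> hq; apply: pureA; apply/eqP. Qed.

Lemma ptens_gr s e i j p (z : BS e) :
  polygr i p -> gr j z -> gr (i + j - 1) (ptens s p z).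
Proof.
move=> hp hz; refine (@tens_gr_pure K d _ regular (BS e) _ i j p z hp hz _).
by rewrite addrC subrK.
Qed.

Lemma ptens_gr_ind s e i (Q : BS (s :: e) -> Prop) : Q 0 ->
  (forall x y, Q x -> Q y -> Q (x - y)) ->
  (forall j k p z, polygr j p -> gr k z -> 1 + i = j + k -> Q (ptens s p z)) ->
  forall x, gr i x -> Q x.
Proof.
move=> Q0 QB Qp x; elim=> {x} [//|x y _ hx _ hy|j k m n hm hn e0]; first exact: QB.
exact: Qp e0.
Qed.

Lemma plift_ptens (P : zmodType) s e (phi : R -> BS e -> P) p z :
  @balanced K d (invariants V s) regular (BS e) P phi ->
  plift phi (ptens s p z) = phi p z.
Proof. by move=> h; apply: tens_lift_pure. Qed.

Lemma pliftD (P : zmodType) s e (phi : R -> BS e -> P) :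
  @balanced K d (invariants V s) regular (BS e) P phi ->
  forall x y : BS (s :: e), plift phi (x + y) = plift phi x + plift phi y.
Proof. by move=> h; apply: tens_liftD. Qed.

Lemma plift_hom s e (B : gbimod K d) (phi : R -> BS e -> B) k :
  @balanced K d (invariants V s) regular (BS e) B phi ->
  (forall r p z, phi (r * p) z = lact r (phi p z)) ->
  (forall p z r, phi p (ract z r) = ract (phi p z) r) ->
  (forall i j p z, polygr i p -> gr j z -> gr (i + j - 1 + k) (phi p z)) ->
  hom_degree k (plift phi : BS (s :: e) -> B).
Proof.
move=> hb hl hr hg; have hD := pliftD hb; have h0 := additive_0 hD.
have hB := additive_B hD.
split; first split=> // [r x|x r].
- elim/ptens_ind: x => [|x y hx hy|p z].
  + by rewrite lact0r h0 lact0r.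
  + by rewrite lactDr lactN !hB hx hy lactDr lactN.
  + by rewrite ptens_lact !plift_ptens.
- elim/ptens_ind: x => [|x y hx hy|p z].
  + by rewrite ract0l h0 ract0l.
  + by rewrite ractDl ractN !hB hx hy ractDl ractN.
  + by rewrite ptens_ract !plift_ptens.
- move=> i; apply: ptens_gr_ind => [|x y hx hy|i' j p z hp hz e0].
  + by rewrite h0; apply: gr0.
  + by rewrite hB; apply: grB.
  + have -> : i = i' + j - 1 by rewrite -e0 addrAC subrr add0r.
    by rewrite plift_ptens //; apply: hg.
Qed.

Lemma BScat1 b (x : BS b) : BScat (1 : BS [::]) x = x.
Proof. exact: lact1. Qed.

Lemma BScat_gen s p b (x : BS b) : BScat (ptens s p (1 : BS [::])) x = ptens s p x.
Proof. by rewrite BScat_ptens BScat1. Qed.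

Lemma BScatDl a b (y y' : BS a) (x : BS b) : BScat (y + y') x = BScat y x + BScat y' x.
Proof. by have [-> _] := BScat_linear a x. Qed.

Lemma BScatDr a b (y : BS a) (x x' : BS b) : BScat y (x + x') = BScat y x + BScat y x'.
Proof. by have [-> _] := @BScat_right _ _ _ _ _ V b a. Qed.

Lemma BScat_lact a b r (y : BS a) (x : BS b) : BScat (lact r y) x = lact r (BScat y x).
Proof. by have [_ ->] := BScat_linear a x. Qed.

Lemma BScat_mid a b r (y : BS a) (x : BS b) : BScat (ract y r) x = BScat y (lact r x).
Proof. by have [_ ->] := @BScat_right _ _ _ _ _ V b a. Qed.

Lemma BScat0l a b (x : BS b) : BScat (0 : BS a) x = 0.
Proof. exact: (additive_0 (fun y y' => BScatDl y y' x)). Qed.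

Lemma BScat0r a b (y : BS a) : BScat y (0 : BS b) = 0.
Proof. exact: (additive_0 (BScatDr y)). Qed.

Lemma BScatBl a b (y y' : BS a) (x : BS b) : BScat (y - y') x = BScat y x - BScat y' x.
Proof. exact: (additive_B (fun y y' => BScatDl y y' x)). Qed.

Lemma BScatBr a b (y : BS a) (x x' : BS b) : BScat y (x - x') = BScat y x - BScat y x'.
Proof. exact: (additive_B (BScatDr y)). Qed.

Lemma BScat_ract a b (y : BS a) (x : BS b) r : BScat y (ract x r) = ract (BScat y x) r.
Proof.
elim: a y => [|s a IH] y; first by rewrite /= lractA.
elim/ptens_ind: y => [|y y' hy hy'|p z].
- by rewrite !BScat0l ract0l.
- by rewrite !BScatBl hy hy' ractDl ractN.
- by rewrite !BScat_ptens IH ptens_ract.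
Qed.

Lemma BScat_ind a b (Q : BS (a ++ b) -> Prop) : Q 0 ->
  (forall x y, Q x -> Q y -> Q (x - y)) ->
  (forall (y : BS a) (x : BS b), Q (BScat y x)) -> forall u, Q u.
Proof.
elim: a Q => [|s a IH] Q Q0 QB Qc u.
  by rewrite -[u](BScat1 (b := b)); apply: Qc.
elim/ptens_ind: u => // p z; apply: (IH (fun z => Q (ptens s p z))) => [|x y|y x].
- by have -> : ptens s p (0 : BS (a ++ b)) = 0 by apply: pure0r.
- by rewrite (additive_B (ptensDr s p)); apply: QB.
- by rewrite -BScat_ptens.
Qed.

Lemma BScat_gr a b i j (y : BS a) (x : BS b) :
  gr i y -> gr j x -> gr (i + j) (BScat y x).
Proof.
elim: a i y => [|s a IH] i y; first exact: grl.
move=> hy hx; move: y hy; apply: ptens_gr_ind => [|y y' hy hy'|k l p z hp hz e0].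
- by rewrite BScat0l; apply: gr0.
- by rewrite BScatBl; apply: grB.
- have -> : i + j = k + (l + j) - 1 by rewrite addrA -e0; ring.
  by rewrite BScat_ptens; apply: ptens_gr => //; apply: IH.
Qed.

Lemma BScat_gr_ind a b i (Q : BS (a ++ b) -> Prop) : Q 0 ->
  (forall x y, Q x -> Q y -> Q (x - y)) ->
  (forall j k (y : BS a) (x : BS b), gr j y -> gr k x -> i = j + k -> Q (BScat y x)) ->
  forall u, gr i u -> Q u.
Proof.
elim: a i Q => [|s a IH] i Q Q0 QB Qc u.
  move=> hu; rewrite -[u](BScat1 (b := b)); apply: (Qc 0 i) => //.
    by rewrite -mpolyC1; apply: polygrC.
  by rewrite add0r.
move: u; apply: ptens_gr_ind => // j k p z hp hz e0; move: z hz.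
apply: (IH k (fun z => Q (ptens s p z))) => [|x y|l m y x hy hx ek].
- by have -> : ptens s p (0 : BS (a ++ b)) = 0 by apply: pure0r.
- by rewrite (additive_B (ptensDr s p)); apply: QB.
- rewrite -BScat_ptens; apply: (Qc (j + l - 1) m) => //; first exact: ptens_gr.
  by apply: (addrI 1); rewrite e0 ek; ring.
Qed.

Lemma BStens_hom a a' b b' (f : BS a -> BS a') (g : BS b -> BS b') k l :
  hom_degree k f -> hom_degree l g -> hom_degree (k + l) (BStens f g).
Proof.
move=> [hf fg] [hg gg]; have hE := BStensE hf hg.
have [fD fl fr] := hf; have [gD gl gr'] := hg.
have hD u u' : BStens f g (u + u') = BStens f g u + BStens f g u'.
  have hb : balanced3 (fun y x => BScat (f y) (g x)).
    split=> [y y' x|y x x'|y r x]; first by rewrite fD BScatDl.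
      by rewrite gD BScatDr.
    by rewrite fr gl BScat_mid.
  by have [h _ _ _] := BScat_liftP hb; apply: h.
have h0 := additive_0 hD; have hB := additive_B hD.
split; first split=> // [r u|u r].
- elim/BScat_ind: u => [|u u' hu hu'|y x].
  + by rewrite lact0r h0 lact0r.
  + by rewrite lactDr lactN !hB hu hu' lactDr lactN.
  + by rewrite -BScat_lact !hE fl BScat_lact.
- elim/BScat_ind: u => [|u u' hu hu'|y x].
  + by rewrite ract0l h0 ract0l.
  + by rewrite ractDl ractN !hB hu hu' ractDl ractN.
  + by rewrite -BScat_ract !hE gr' BScat_ract.
- move=> i; apply: BScat_gr_ind => [|u u' hu hu'|m n y x hy hx ->].
  + by rewrite h0; apply: gr0.
  + by rewrite hB; apply: grB.
  + by rewrite hE addrACA; apply: BScat_gr; [apply: fg | apply: gg].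
Qed.

Lemma BSmid_hom (l r : seq S) a b (f : BS a -> BS b) k :
  hom_degree k f -> hom_degree k (mid l r f).
Proof.
move=> hf; rewrite -[k]add0r; apply: BStens_hom; first exact: hom_degree_id.
by rewrite -[k]addr0; apply: BStens_hom => //; apply: hom_degree_id.
Qed.

Lemma BSmidE (l r : seq S) a b (f : BS a -> BS b) k (x : BS l) (y : BS a) (z : BS r) :
  hom_degree k f -> mid l r f (BScat x (BScat y z)) = BScat x (BScat (f y) z).
Proof.
move=> hf; have [hid _] := hom_degree_id (BS l).
have [hid' _] := hom_degree_id (BS r).
have hh : hom_degree (k + 0) (BStens f (@idfun (BS r))).
  by apply: BStens_hom => //; apply: hom_degree_id.
by rewrite /BSmid BStensE // ?BStensE //; [case: hf | case: hh].
Qed.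

Lemma BScast_hom a b (e : a = b) : hom_degree 0 (BScast (V := V) e).
Proof. by case: _ / e; apply: hom_degree_id. Qed.

Lemma BScast_id a (e : a = a) (x : BS a) : BScast e x = x.
Proof. by rewrite (Prop_irrelevance e erefl). Qed.

Lemma BScast_ptens s a b (e : a = b) (e' : s :: a = s :: b) p (z : BS a) :
  BScast e' (ptens s p z) = ptens s p (BScast e z).
Proof. by case: _ / e e' => e'; rewrite BScast_id. Qed.

Lemma BScat_assoc a b c (x : BS a) (y : BS b) (z : BS c) :
  BScast (catA a b c) (BScat x (BScat y z)) = BScat (BScat x y) z.
Proof.
move: (catA a b c); elim: a x => [|s a IH] x e.
  by rewrite BScast_id /= BScat_lact.
have [cD _ _] := (BScast_hom e).1.
elim/ptens_ind: x => [|x x' hx hx'|p w].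
- by rewrite !BScat0l; apply: additive_0 cD.
- by rewrite !BScatBl (additive_B cD) hx hx'.
- by rewrite !BScat_ptens (BScast_ptens (catA a b c)) IH.
Qed.

Lemma BScat_BS1 a b : BScat (BS1 V a) (BS1 V b) = BS1 V (a ++ b).
Proof.
elim: a => [|s a IH]; first exact: BScat1.
by rewrite -[RHS]/(ptens s 1 (BS1 V (a ++ b))) -IH; apply: BScat_ptens.
Qed.

Lemma BScast_BS1 a b (e : a = b) : BScast e (BS1 V a) = BS1 V b.
Proof. by case: _ / e. Qed.

(** Localization at the subexpression [M]: p_i is transported by the product of the kept letters
    among the first i, so the target is R_x for x the product of all kept letters. The full mask
    gives [beta]; letters beyond the end of [M] count as skipped. *)
Fixpoint subword_eval e M : BS e -> R :=
  match e return BS e -> R with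
  | [::] => fun p => p
  | s :: e' => @plift _ _ _ _ _ V R s e' (fun p y =>
      p * act (if head false M then C s else 1%g) (@subword_eval e' (behead M) y))
  end.
Local Notation ev := subword_eval.

Lemma eval_bal s e M :
  (forall x y, @ev e (behead M) (x + y) = ev (behead M) x + ev (behead M) y) ->
  (forall r x, @ev e (behead M) (lact r x) = r * ev (behead M) x) ->
  @balanced K d (invariants V s) regular (BS e) _ (fun p y =>
      p * act (if head false M then C s else 1%g) (@ev e (behead M) y)).
Proof.
move=> hD hl; split=> [p p' z|p z z'|p c z /eqP hc].
- by rewrite mulrDl.
- by rewrite hD wactD mulrDr.
- rewrite hl wactM mulrA; congr (_ * _ * _).
  by case: (head false M) => //; rewrite wact_id.
Qed.

Lemma eval_linear e M :
  (forall x y, @ev e M (x + y) = ev M x + ev M y) /\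
  (forall r x, @ev e M (lact r x) = r * ev M x).
Proof.
elim: e M => [|s e IH] M; first by split.
have [hD hl] := IH (behead M); have hb := eval_bal s hD hl.
have hD' : forall x y, @ev (s :: e) M (x + y) = ev M x + ev M y := pliftD hb.
have hp p z : @ev (s :: e) M (ptens s p z) =
  p * act (if head false M then C s else 1%g) (ev (behead M) z) by apply: plift_ptens hb.
split=> // r x.
elim/ptens_ind: x => [|x y hx hy|p z].
- by rewrite lact0r (additive_0 hD') mulr0.
- by rewrite lactDr lactN !(additive_B hD') hx hy mulrBr.
- by rewrite ptens_lact !hp mulrA.
Qed.

Lemma evalD e M (x y : BS e) : ev M (x + y) = ev M x + ev M y.
Proof. by have [->] := eval_linear e M. Qed.
Lemma eval_lact e M r (x : BS e) : ev M (lact r x) = r * ev M x.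
Proof. by have [_ ->] := eval_linear e M. Qed.
Lemma eval0 e M : ev M (0 : BS e) = 0.
Proof. exact: additive_0 (@evalD e M). Qed.
Lemma evalB e M (x y : BS e) : ev M (x - y) = ev M x - ev M y.
Proof. exact: additive_B (@evalD e M) x y. Qed.

Lemma eval_ptens s e (b : bool) M p (z : BS e) :
  ev (b :: M) (ptens s p z) = p * act (if b then C s else 1%g) (ev M z).
Proof.
by have [hD hl] := eval_linear e M; rewrite /= plift_ptens //; apply: (@eval_bal s e (b :: M)).
Qed.

Lemma eval_BS1 e M : ev M (BS1 V e) = 1.
Proof.
elim: e M => [|s e IH] M //=.
have [hD hl] := eval_linear e (behead M).
by rewrite plift_ptens ?IH ?wact_one ?mul1r //; apply: eval_bal.
Qed.

Lemma betaE e (x : BS e) : beta x = ev (nseq (size e) true) x.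
Proof.
elim: e x => [//|s e IH] x.
rewrite -[LHS]/(plift (fun p (y : BS e) => p * act (C s) (beta y)) x).
rewrite -[RHS]/(plift (fun p (y : BS e) =>
  p * act (C s) (ev (nseq (size e) true) y)) x).
congr (plift _ x); apply/funext => p; apply/funext => y; by rewrite IH.
Qed.

Lemma eval_nil M p : ev M (p : BS [::]) = p.
Proof. by []. Qed.

Local Opaque subword_eval.

Lemma eval_hom e M : size M = size e ->
  [/\ forall x y, @ev e M (x + y) = ev M x + ev M y,
      forall r x, @ev e M (lact r x) = r * ev M x,
      forall x r, @ev e M (ract x r) = ev M x * act (wp (mask M e)) r &
      forall i x, gr i x -> polygr (i + (size e)%:Z) (@ev e M x)].
Proof.
move=> hM; split; [exact: evalD | exact: eval_lact | |].
- elim: e M hM => [|s e IH] [|b M] // => [_|/succn_inj hM] x r.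
    by rewrite !eval_nil wact_id.
  elim/ptens_ind: x => [|x y hx hy|p z].
  + by rewrite ract0l eval0 mul0r.
  + by rewrite ractDl ractN !evalB hx hy mulrBl.
  + rewrite ptens_ract (eval_ptens s b M p (ract z r)) (eval_ptens s b M p z).
    rewrite (IH M hM) wactM mulrA; congr (_ * _).
    by case: b; rewrite /= ?wact_mul ?wact_id.
- elim: e M hM => [|s e IH] [|b M] // => [_|/succn_inj hM] i.
    by move=> x; rewrite addr0 eval_nil.
  apply: ptens_gr_ind => [|x y hx hy|j k p z hp hz e0].
  + by rewrite eval0; apply: polygr0.
  + by rewrite evalB; apply: polygrB.
  + have -> : i + (size e).+1%:Z = j + (k + (size e)%:Z).
      by rewrite [RHS]addrA -e0 -addn1 PoszD; ring.
    by rewrite eval_ptens; apply: polygrM => //; apply/polygr_wact/IH.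
Qed.

Lemma eval_cast a b (e : a = b) M (x : BS a) : ev M (BScast e x) = ev M x.
Proof. by case: _ / e. Qed.

Lemma eval_cat a b M M' (y : BS a) (z : BS b) : size M = size a ->
  ev (M ++ M') (BScat y z) = ev M y * act (wp (mask M a)) (ev M' z).
Proof.
elim: a M y => [|s a IH] [|c M] // => [y _|y /succn_inj hM].
  by rewrite eval_nil wact_id eval_lact.
rewrite -[(c :: M) ++ M']/(c :: (M ++ M')).
elim/ptens_ind: y => [|x y hx hy|p w].
- by rewrite BScat0l !eval0 mul0r.
- by rewrite BScatBl !evalB hx hy mulrBl.
- rewrite BScat_ptens (eval_ptens s c _ p (BScat w z)) (eval_ptens s c M p w).
  rewrite (IH M w hM) wactM mulrA; congr (_ * _).
  by case: c; rewrite /= ?wact_mul ?wact_id.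
Qed.

Lemma mask_ones e : mask (nseq (size e) true) e = e.
Proof. exact: mask_true. Qed.

Lemma eval_bimod e M : size M = size e ->
  bimod_hom (@ev e M : BS e -> standard V (wp (mask M e))).
Proof. by case/eval_hom. Qed.

Lemma beta_bimod e : bimod_hom (@beta _ _ _ _ _ V e : BS e -> standard V (wp e)).
Proof.
have -> : @beta _ _ _ _ _ V e = ev (nseq (size e) true) :> (BS e -> R).
  by apply/funext => x; apply: betaE.
by rewrite -{2}[e]mask_ones; apply: eval_bimod; rewrite size_nseq.
Qed.

Lemma beta_hom e : reduced C e ->
  hom_degree 0 (@beta _ _ _ _ _ V e : BS e -> standard V (wp e)).
Proof.
move=> he; split; first exact: beta_bimod.
move=> i x hx; rewrite addr0 betaE /=; rewrite -(reducedP he).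
by have [_ _ _] := eval_hom (size_nseq (size e) true); apply.
Qed.

(** * The basic morphisms m_s and j_s, and the probes *)

Lemma m_mor_bal s :
  @balanced K d (invariants V s) regular (BS [::]) R (fun p (q : R) => p * q).
Proof. by split=> [p p' z|p z z'|p c z _]; rewrite ?mulrDl ?mulrDr //= mulrA. Qed.

Lemma m_morE s p q : m_mor (ptens s p (q : BS [::])) = p * q :> R.
Proof. exact/plift_ptens/m_mor_bal. Qed.

Lemma m_mor_hom s : hom_degree 1 (@m_mor _ _ _ _ _ V s).
Proof.
apply: (@plift_hom s [::] (BS [::])) => [|r p z|p z r|i j p z hp hz].
- exact: m_mor_bal.
- by rewrite /= mulrA.
- by rewrite /= mulrA.
- by rewrite subrK; apply: polygrM.
Qed.

Lemma eval_m_mor s (y : BS [:: s]) : ev [::] (m_mor y) = ev [:: false] y.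
Proof.
have [mD _ _] := (m_mor_hom s).1.
elim/ptens_ind: y => [|x y hx hy|p z].
- by rewrite (additive_0 mD) !eval0.
- by rewrite (additive_B mD) !evalB hx hy.
- by rewrite m_morE eval_ptens !eval_nil wact_id.
Qed.

Lemma j_mor_bal1 s p :
  @balanced K d (invariants V s) regular (BS [::]) (BS [:: s])
    (fun q (r : R) => ptens s (p * demazure V s q) (r : BS [::])).
Proof.
split=> [q q' r|q r r'|q c r /eqP hc].
- by rewrite demazureD mulrDr ptensDl.
- exact: ptensDr.
- have -> : ract (q : @regular K d) c = c * q by apply: mulrC.
  by rewrite (demazureMl _ hc) mulrCA [c * _]mulrC (ptens_inv _ _ hc).
Qed.

Lemma j_mor_bal2 s :
  @balanced K d (invariants V s) regular (BS [:: s]) (BS [:: s]) (fun p =>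
    @plift _ _ _ _ _ V (BS [:: s]) s [::] (fun q (r : R) =>
      ptens s (p * demazure V s q) (r : BS [::]))).
Proof.
split=> [p p' z|p z z'|p c z /eqP hc].
- elim/ptens_ind: z => [|x y hx hy|q r].
  + by rewrite !(additive_0 (pliftD (j_mor_bal1 s _))) addr0.
  + by rewrite !(additive_B (pliftD (j_mor_bal1 s _))) hx hy opprD addrACA.
  + by rewrite !(plift_ptens _ _ (j_mor_bal1 s _)) mulrDl ptensDl.
- exact: pliftD (j_mor_bal1 s p) z z'.
- elim/ptens_ind: z => [|x y hx hy|q r].
  + by rewrite lact0r !(additive_0 (pliftD (j_mor_bal1 s _))).
  + by rewrite lactDr lactN !(additive_B (pliftD (j_mor_bal1 s _))) hx hy.
  + by rewrite ptens_lact !(plift_ptens _ _ (j_mor_bal1 s _)) demazureMl // mulrA.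
Qed.

Lemma j_morE s p q (r : BS [::]) :
  j_mor (ptens s p (ptens s q r)) = ptens s (p * demazure V s q) r.
Proof.
by rewrite /j_mor (plift_ptens _ _ (j_mor_bal2 s)) (plift_ptens _ _ (j_mor_bal1 s p)).
Qed.

Lemma j_mor_hom s : hom_degree (- 1) (@j_mor _ _ _ _ _ V s).
Proof.
apply: (@plift_hom s [:: s] (BS [:: s])) => [|r p z|p z r|i j p z hp].
- exact: j_mor_bal2.
- elim/ptens_ind: z => [|x y hx hy|q z].
  + by rewrite !(additive_0 (pliftD (j_mor_bal1 s _))) lact0r.
  + by rewrite !(additive_B (pliftD (j_mor_bal1 s _))) hx hy lactDr lactN.
  + by rewrite !(plift_ptens _ _ (j_mor_bal1 s _)) ptens_lact mulrA.
- elim/ptens_ind: z => [|x y hx hy|q z].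
  + by rewrite ract0l !(additive_0 (pliftD (j_mor_bal1 s _))) ract0l.
  + by rewrite ractDl ractN !(additive_B (pliftD (j_mor_bal1 s _))) hx hy ractDl ractN.
  + by rewrite ptens_ract !(plift_ptens _ _ (j_mor_bal1 s _)) ptens_ract.
- move: z; apply: ptens_gr_ind => [|x y hx hy|k l q r hq hr e0].
  + by rewrite (additive_0 (pliftD (j_mor_bal1 s _))); apply: gr0.
  + by rewrite (additive_B (pliftD (j_mor_bal1 s _))); apply: grB.
  + rewrite (plift_ptens _ _ (j_mor_bal1 s _)).
    have -> : i + j - 1 + -1 = i + (k - 2) + l - 1.
      have -> : j = k + l - 1 by rewrite -e0; ring.
      by ring.
    by apply: ptens_gr => //; apply: polygrM => //; apply: demazure_gr.
Qed.

(* These elements are dual to the leaves: if the bits of [D] are the descents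
   of a subexpression, they make each j_s met along the leaf of that
   subexpression take the value 1. *)
Fixpoint probe e (D : seq bool) : BS e :=
  if e is s :: e' then
    ptens s (if head false D then xs V s else 1) (probe e' (behead D))
  else (1 : R).

Lemma probe_gr e D : size D = size e ->
  gr (2 * (count id D)%:Z - (size e)%:Z) (probe e D).
Proof.
elim: e D => [|s e IH] [|b D] //= => [_|[hD]].
  by rewrite -mpolyC1; apply: polygrC.
have -> : 2 * (b + count id D)%N%:Z - (size e).+1%:Z =
    2 * b%:Z + (2 * (count id D)%:Z - (size e)%:Z) - 1.
  by rewrite -addn1 !PoszD; ring.
apply: ptens_gr (IH _ hD); case: b => /=; first exact: xs_gr.
by rewrite -mpolyC1; apply: polygrC.
Qed.

End BottSamelsonBimodules.

(** * Localization *)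

(** Padded with zero columns, the matrix becomes square of determinant zero, and [det0P] gives a
    kernel vector with entries in [D] itself. *)
Lemma linear_dependence (D : idomainType) (I J : finType) (M : I -> J -> D) :
  (#|J| < #|I|)%N ->
  exists c : I -> D, (exists i, c i != 0) /\ forall j, \sum_i c i * M i j = 0.
Proof.
move=> hJI; pose A := \matrix_(i < #|I|, k < #|I|)
  oapp (fun j : 'I_#|J| => M (enum_val i) (enum_val j)) 0 (insub (val k)).
have /det0P[v v0 hv] : \det A == 0.
  apply/eqP; rewrite (expand_det_col _ (Ordinal hJI)) big1 // => i _.
  by rewrite mxE insubF ?mul0r //= ltnn.
exists (fun i => v 0 (enum_rank i)); split.
  have /rV0Pn[i hi] := v0; by exists (enum_val i); rewrite enum_valK.
move=> j; have hj : (enum_rank j < #|I|)%N by apply: ltn_trans hJI.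
move/rowP/(_ (Ordinal hj)): hv; rewrite !mxE => {2}<-.
rewrite (reindex (@enum_val I predT)) /=; last first.
  by exists enum_rank => i _; [apply: enum_valK | apply: enum_rankK].
apply: eq_bigr => i _; rewrite mxE enum_valK /=.
by rewrite (insubT (fun k => (k < #|J|)%N) (ltn_ord _)) /=;
  congr (_ * M _ _); rewrite -[LHS]enum_rankK; congr enum_val; apply: val_inj.
Qed.

Section Localization.
Variables (W : groupType) (S : Type) (C : coxeter_system W S).
Variables (K : realType) (d : nat) (V : refl_faithful C K d).
Local Notation R := {mpoly K[d]}.
Local Notation BS := (BS V).
Local Notation act := (wact V).
Local Notation wp := (word_prod C).
Local Notation ev := (@subword_eval _ _ _ _ _ V _).
Implicit Types (s : S) (e : seq S) (M m : seq bool) (p q : R).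

(** For [y] = 1 these are the bimodule maps to R_x, of any degree or none. The left twist is carried
    along because splitting off a first letter s changes it from [y] to ys on one of the two
    parts. *)
Definition twisted e (y x : W) (phi : BS e -> R) : Prop :=
  [/\ forall u v, phi (u + v) = phi u + phi v,
      forall r u, phi (lact r u) = act y r * phi u &
      forall u r, phi (ract u r) = phi u * act x r].

Lemma twisted_lin e y x (a : R) (phi psi : BS e -> R) :
  twisted y x phi -> twisted y x psi -> twisted y x (fun z => a * phi z + psi z).
Proof.
move=> [fD fl fr] [gD gl gr']; split=> [u v|r u|u r].
- by rewrite fD gD; ring.
- by rewrite fl gl; ring.
- by rewrite fr gr'; ring.
Qed.

Lemma bimod_twisted e x (phi : BS e -> standard V x) :
  bimod_hom phi -> twisted 1%g x (phi : BS e -> R).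
Proof. by move=> [fD fl fr]; split=> // r u; rewrite wact_id fl. Qed.

Section Halves.
Variables (s : S) (e : seq S) (y x : W) (phi : BS (s :: e) -> R).
Hypothesis phi_tw : twisted y x phi.

(** The two halves are [phi] applied to [z] multiplied by x_s (x) 1 + 1 (x) x_s and by x_s (x) 1 - 1
    (x) x_s. A scalar r passes through the first element as r and through the second as s(r), which
    splits B_s over the fraction field. *)
Definition half_plus (z : BS e) : R :=
  phi (ptens s 1 (lact (xs V s) z)) + act y (xs V s) * phi (ptens s 1 z).
Definition half_minus (z : BS e) : R :=
  act y (xs V s) * phi (ptens s 1 z) - phi (ptens s 1 (lact (xs V s) z)).

Let phi0 (z : BS e) := phi (ptens s 1 z).

Let phi0D z z' : phi0 (z + z') = phi0 z + phi0 z'.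
Proof. by have [hD _ _] := phi_tw; rewrite /phi0 ptensDr hD. Qed.

Let phi0_inv c z : act (C s) c = c -> phi0 (lact c z) = act y c * phi0 z.
Proof.
move=> hc; have [_ hl _] := phi_tw.
by rewrite /phi0 -ptens_inv // -hl ptens_lact mulrC.
Qed.

Let phi0_lact r z : phi0 (lact r z) =
  act y (symmetrize V s r) * phi0 z + act y (demazure V s r) * phi0 (lact (xs V s) z).
Proof.
rewrite {1}(split_inv V s r) lactDl mulrC lactA phi0D.
by rewrite (phi0_inv _ (symmetrize_inv V s r)) (phi0_inv _ (demazure_inv V s r)).
Qed.

Let phi0_xs_lact r z : phi0 (lact (xs V s) (lact r z)) =
  act y (symmetrize V s r) * phi0 (lact (xs V s) z) +
  act y (demazure V s r) * (act y (xs V s) * act y (xs V s)) * phi0 z.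
Proof.
have hx : act (C s) (xs V s * xs V s) = xs V s * xs V s.
  by rewrite wactM wact_xs mulrNN.
by rewrite -lactA mulrC lactA phi0_lact -lactA (phi0_inv _ hx) wactM !mulrA.
Qed.

Let phi0_ract z r : phi0 (ract z r) = phi0 z * act x r.
Proof. by have [_ _ hr] := phi_tw; rewrite /phi0 -ptens_ract hr. Qed.

Let act_split r :
  act y r = act y (symmetrize V s r) + act y (xs V s) * act y (demazure V s r).
Proof. by rewrite {1}(split_inv V s r) wactD wactM. Qed.

Lemma half_plus_twisted : twisted y x half_plus.
Proof.
split=> [z z'|r z|z r]; rewrite /half_plus -!/(phi0 _).
- by rewrite lactDr !phi0D; ring.
- rewrite phi0_xs_lact (phi0_lact r) (act_split r).
  move: (phi0 z) (phi0 (lact _ z)) (act y (symmetrize V s r))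
    (act y (demazure V s r)) (act y (xs V s)) => u v a b c; ring.
- by rewrite lractA !phi0_ract mulrDl mulrA.
Qed.

Lemma half_minus_twisted : twisted (y * C s)%g x half_minus.
Proof.
split=> [z z'|r z|z r]; rewrite /half_minus -!/(phi0 _).
- by rewrite lactDr !phi0D; ring.
- rewrite phi0_xs_lact (phi0_lact r) wact_mul.
  have -> : act y (act (C s) r) =
      act y (symmetrize V s r) - act y (xs V s) * act y (demazure V s r).
    rewrite {1}(split_inv V s r) !wactD !wactM symmetrize_inv demazure_inv.
    by rewrite wact_xs wactN mulNr.
  move: (phi0 z) (phi0 (lact _ z)) (act y (symmetrize V s r))
    (act y (demazure V s r)) (act y (xs V s)) => u v a b c; ring.
- by rewrite lractA !phi0_ract mulrBl mulrA.
Qed.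

(** The halves add up to 2 y(x_s) phi(1 (x) z), and R is a domain; the elements 1 (x) z generate on
    the left. *)
Lemma halves_eq0 : (forall z, half_plus z = 0) -> (forall z, half_minus z = 0) ->
  forall u, phi u = 0.
Proof.
move=> hp hm; have [hD hl _] := phi_tw.
have h0 z : phi0 z = 0.
  have : half_plus z + half_minus z = 2%:R * act y (xs V s) * phi0 z.
    rewrite /half_plus /half_minus -!/(phi0 _).
    by move: (phi0 z) (phi0 (lact _ z)) (act y _) => u v a; ring.
  rewrite hp hm addr0 => /esym/eqP.
  rewrite mulf_eq0 => /orP[|/eqP//]; rewrite -(wact0 V y).
  have -> : 2%:R * act y (xs V s) = act y (2%:R * xs V s).
    by rewrite !mulr_natl wactMn.
  by rewrite (inj_eq (@wact_inj _ _ _ _ _ V y)) (negbTE (two_xs_neq0 V s)).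
elim/ptens_ind => [|u v hu hv|p z].
- exact: additive_0 hD.
- by rewrite (additive_B hD) hu hv subrr.
- by rewrite -[p]mulr1 -ptens_lact hl -/(phi0 z) h0 mulr0.
Qed.

End Halves.

(** Halving letter by letter attaches to each subexpression [m] a functional [F m], the coordinate
    of [phi] on the summand of the localized bimodule labelled by [m]. A summand whose product is
    not [x] admits no nonzero map to R_x. *)
Lemma twisted_detect e y : exists F : seq bool -> (BS e -> R) -> R,
  (forall m a phi psi, F m (fun z => a * phi z + psi z) = a * F m phi + F m psi) /\
  forall x phi, twisted y x phi ->
    (forall m, size m = size e -> (y * wp (mask m e))%g = x -> F m phi = 0) ->
    forall z, phi z = 0.
Proof.
elim: e y => [|s e IH] y.
  exists (fun _ phi => phi (1 : R)); split=> // x phi [hD hl hr] h z.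
  (* With no letter left the map is determined by its value at 1. If that value is nonzero, the left
     twist [y] and the right twist [x] agree on R, hence in [W] by faithfulness. *)
  have ez : phi z = act y z * phi (1 : R) by rewrite -hl /= mulr1.
  have [h1|h1] := eqVneq (phi (1 : R)) 0; first by rewrite ez h1 mulr0.
  suff yx : y = x by rewrite ez (h [::]) ?mulr0 // mulg1.
  apply: (@wact_faithful _ _ _ _ _ V) => p; apply: (mulIf h1).
  by rewrite -hl mulrC -hr /= mulr1 mul1r.
have [F [FD FP]] := IH y; have [G [GD GP]] := IH (y * C s)%g.
exists (fun m phi => if head false m then G (behead m) (half_minus y phi)
                     else F (behead m) (half_plus y phi)); split.
  have hp a phi psi : half_plus y (fun z => a * phi z + psi z) =
      fun z => a * half_plus y phi z + half_plus y psi z :> R.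
    apply/funext => z; rewrite /half_plus; set u := ptens _ _ _; set v := ptens _ _ _.
    by move: (phi u) (phi v) (psi u) (psi v) (act y _) => ? ? ? ? ?; ring.
  have hm a phi psi : half_minus y (fun z => a * phi z + psi z) =
      fun z => a * half_minus y phi z + half_minus y psi z :> R.
    apply/funext => z; rewrite /half_minus; set u := ptens _ _ _; set v := ptens _ _ _.
    by move: (phi u) (phi v) (psi u) (psi v) (act y _) => ? ? ? ? ?; ring.
  by move=> [|[] m] a phi psi; rewrite [head _ _]/= ?hp ?hm ?FD ?GD.
move=> x phi tw h; apply: (halves_eq0 tw).
- apply: FP (half_plus_twisted tw) _ => m hm hx.
  by apply: (h (false :: m)); rewrite /= ?hm.
- apply: GP (half_minus_twisted tw) _ => m hm hx.
  by apply: (h (true :: m)); rewrite /= ?hm ?mulgA.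
Qed.

Definition masks_to e (x : W) : {pred (size e).-tuple bool} :=
  [pred m : (size e).-tuple bool | wp (mask m e) == x].

(* There are no more linearly independent maps to R_x than subexpressions
   for x; probes dual to that many maps therefore detect all maps. *)
Lemma twisted_dual e x (I : finType) (phi : I -> BS e -> R) (b : I -> BS e)
    (rk : I -> nat) (psi : BS e -> R) :
  (#|@masks_to e x| <= #|I|)%N -> injective rk ->
  (forall i, twisted 1%g x (phi i)) -> (forall i, phi i (b i) = 1) ->
  (forall i j, (rk j < rk i)%N -> phi i (b j) = 0) ->
  twisted 1%g x psi -> (forall j, psi (b j) = 0) -> forall z, psi z = 0.
Proof.
move=> hI rk_inj tw hd ht twp hp z.
have [F [FD FP]] := twisted_detect e 1%g.
pose Phi (o : option I) := oapp phi psi o.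
have twPhi o : twisted 1%g x (Phi o) by case: o.
pose J := {m : (size e).-tuple bool | @masks_to e x m}.
(* With [psi] adjoined as [None] there are more maps than functionals, so some nontrivial
   combination is killed by all of them and vanishes by [twisted_detect]. *)
have [|c [[o0 ho0] hc]] := @linear_dependence R (option I) J
  (fun o (m : J) => F (tval (val m)) (Phi o)).
  by rewrite card_option ltnS card_sig.
have tw0 : twisted 1%g x (fun _ : BS e => 0 : R).
  by split=> *; rewrite ?addr0 ?mulr0 ?mul0r.
have F0 m : F m (fun _ : BS e => 0 : R) = 0.
  have := FD m (- 1) (fun=> 0) (fun=> 0); rewrite [in RHS]mulN1r [in RHS]addNr.
  move=> h; rewrite -[RHS]h.
  by congr (F _ _); apply/funext => u; rewrite mulr0 addr0.
have [twc Fc] : twisted 1%g x (fun u => \sum_o c o * Phi o u) /\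
    forall m, F m (fun u => \sum_o c o * Phi o u) = \sum_o c o * F m (Phi o).
  elim: (index_enum _) => [|o l [IH1 IH2]].
    split=> [|m]; last first.
      rewrite big_nil -[RHS](F0 m); congr (F _ _).
      by apply/funext => u; rewrite big_nil.
    by under eq_fun do rewrite big_nil.
  under eq_fun do rewrite big_cons; split; first exact: twisted_lin.
  by move=> m; rewrite FD IH2 big_cons.
have h0 u : \sum_o c o * Phi o u = 0.
  apply: (FP x _ twc) => m hm hx; rewrite Fc.
  have hm' : size m == size e by rewrite hm.
  have hJ : @masks_to e x (Tuple hm') by rewrite /masks_to /= -hx mul1g.
  by have := hc (exist _ (Tuple hm') hJ).
(* Evaluating the relation at [b i], in order of increasing rank, leaves only the coefficient of
   [phi i]. What survives is a nonzero multiple of [psi]. *)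
have hcI n i : (rk i < n)%N -> c (Some i) = 0.
  elim: n i => // n IH i hi; have := h0 (b i).
  rewrite (bigD1 (Some i)) //= hd mulr1 big1 ?addr0 // => -[j|] hj /=; last first.
    by rewrite hp mulr0.
  have [h|h|/rk_inj e0] := ltngtP (rk i) (rk j); first by rewrite ht ?mulr0.
    by rewrite IH ?mul0r // (leq_trans h).
  by rewrite e0 eqxx in hj.
have hcN : c None != 0.
  by case: o0 ho0 => [i|//]; rewrite (hcI (rk i).+1) ?eqxx.
have := h0 z; rewrite (bigD1 None) //= big1 ?addr0; last first.
  by move=> [i|//] _; rewrite (hcI (rk i).+1) ?mul0r.
by move/eqP; rewrite mulf_eq0 (negbTE hcN) => /eqP.
Qed.

(** A mask that drops a letter leaves fewer letters than the length of the product. *)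
Lemma masks_to_reduced e : reduced C e -> (#|@masks_to e (wp e)| <= 1)%N.
Proof.
move=> /reducedP he; suff h (m : (size e).-tuple bool) :
    m \in @masks_to e (wp e) -> m = [tuple of nseq (size e) true].
  apply: leq_trans (eq_leq (card1 [tuple of nseq (size e) true])).
  by apply/subset_leq_card/fintype.subsetP => m /h ->; rewrite inE.
rewrite inE => /eqP hm; apply: val_inj => /=.
have := length_word C (mask m e); rewrite hm -he size_mask ?size_tuple // => hc.
have ha : all id m.
  by rewrite all_count size_tuple eqn_leq hc andbT -{2}[size e](size_tuple m) count_size.
by rewrite -[in nseq _](size_tuple m); apply/all_pred1P; move: ha; apply: sub_all => -[].
Qed.

(** The full subexpression is the only one for this product, so [beta] and the element 1 (x) ... (x)
    1 alone form a dual family for [twisted_dual]. This makes f_sr, known only through its value at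
    that element, compatible with [beta]. *)
Lemma beta_unique e (phi : BS e -> standard V (wp e)) : reduced C e ->
  bimod_hom phi -> phi (BS1 V e) = 1 -> forall z, phi z = beta z.
Proof.
move=> he hphi h1 z; apply/eqP; rewrite -subr_eq0; apply/eqP.
pose psi z := (phi z : R) - beta z.
have twb : twisted 1%g (wp e) (@beta _ _ _ _ _ V e).
  exact: bimod_twisted (beta_bimod V e).
have twp : twisted 1%g (wp e) psi.
  by apply: (bimod_twisted (bimod_hom_sub hphi (beta_bimod V e))).
have hb1 : beta (BS1 V e) = 1 by rewrite betaE eval_BS1.
apply: (@twisted_dual e (wp e) unit (fun=> @beta _ _ _ _ _ V e)
  (fun=> BS1 V e) (fun=> 0%N) psi) => //.
- by rewrite card_unit masks_to_reduced.
- by move=> [] [].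
- by move=> _; rewrite /psi h1 hb1 subrr.
Qed.

(** * Compatibility of local morphisms and braid moves with evaluation *)

Lemma eval_mid (l r a b : seq S) (f : BS a -> BS b) k Ml Ma Mb Mr :
  hom_degree k f -> size Ml = size l -> size Ma = size a -> size Mb = size b ->
  (forall y, ev Mb (f y) = ev Ma y) -> wp (mask Mb b) = wp (mask Ma a) ->
  forall x, ev (Ml ++ (Mb ++ Mr)) (@BSmid _ _ _ _ _ V _ _ l r f x) = ev (Ml ++ (Ma ++ Mr)) x.
Proof.
move=> hf hl ha hb hev hw.
have [[mD _ _] _] := BSmid_hom l r hf; have m0 := additive_0 mD.
have mB := additive_B mD.
elim/BScat_ind => [|x y hx hy|x].
- by rewrite m0 !eval0.
- by rewrite mB !evalB hx hy.
elim/BScat_ind => [|y z hy hz|y z].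
- by rewrite BScat0r m0 !eval0.
- by rewrite BScatBr mB !evalB hy hz.
- rewrite (BSmidE _ _ _ hf) (eval_cat _ _ _ hl) (eval_cat _ _ _ hb).
  by rewrite (eval_cat _ _ _ hl) (eval_cat _ _ _ ha) hev hw.
Qed.

Lemma beta_mid (l r a b : seq S) (f : BS a -> BS b) k :
  hom_degree k f -> (forall y, beta (f y) = beta y) -> wp b = wp a ->
  forall x, beta (@BSmid _ _ _ _ _ V _ _ l r f x) = beta x.
Proof.
move=> hf hb hw x; rewrite !betaE !size_cat !nseqD.
apply: (eval_mid _ hf); rewrite ?size_nseq ?mask_ones // => y.
by rewrite -!betaE.
Qed.

(** Conjugation by the involution [g] inverts [g * h]. *)
Lemma conj_pow (g h : W) n : (g * g = 1)%g -> (h * h = 1)%g ->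
  ((g * h) ^+ n * g * (g * h) ^+ n = g)%g.
Proof.
move=> gg hh; elim: n => [|n IH]; first by rewrite expg0 mul1g mulg1.
rewrite {1}expgSr expgS.
have -> : ((g * h) ^+ n * (g * h) * g * (g * h * (g * h) ^+ n) =
   (g * h) ^+ n * g * (h * (g * g) * (h * (g * h) ^+ n)))%g by rewrite !mulgA.
by rewrite gg mulg1 (mulgA h h) hh mul1g IH.
Qed.

Lemma alternating_prod s r n :
  (wp (alternating s r n) = (C s * C r) ^+ n * wp (alternating r s n))%g.
Proof.
elim: n => [|n IH]; first by rewrite expg0 mul1g.
rewrite [LHS]/= [alternating r s n.+1]/= [wp (_ :: _)]/= IH.
rewrite -[in LHS](conj_pow n (gen_invol C s) (gen_invol C r)) expgSr !mulgA.
by rewrite mulgenK.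
Qed.

Lemma alternating_braid s r n : has_order (C s * C r)%g n ->
  wp (alternating s r n) = wp (alternating r s n).
Proof. by case=> _ h _; rewrite alternating_prod h mul1g. Qed.

Lemma size_alternating s r n : size (alternating s r n) = n.
Proof. by elim: n s r => //= n IH s r; rewrite IH. Qed.

Lemma has_order_sym s r n : has_order (C s * C r)%g n -> has_order (C r * C s)%g n.
Proof.
have hinv k : ((C r * C s) ^+ k = ((C s * C r) ^+ k)^-1)%g.
  by rewrite -expVgn invgM !genV.
case=> h0 h1 h2; split=> // [|k hk]; first by rewrite hinv h1 invg1.
by rewrite hinv => /eqP; rewrite invg_eq1 => /eqP; apply: h2.
Qed.

Lemma beta_braid_relation s r n (f : BS (alternating s r n) -> BS (alternating r s n)) :
  has_order (C s * C r)%g n -> reduced C (alternating s r n) ->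
  hom_degree 0 f -> f (BS1 V _) = BS1 V _ -> forall y, beta (f y) = beta y.
Proof.
move=> hn hred [hf _] f1 y.
pose phi : BS (alternating s r n) -> standard V (wp (alternating s r n)) :=
  fun y => beta (f y).
suff : forall z, phi z = beta z by apply.
apply: beta_unique => //; last by rewrite /phi f1 betaE eval_BS1.
have [bD bl br] := beta_bimod V (alternating r s n); have [fD fl fr] := hf.
split=> [u v|p u|u p]; rewrite /phi.
- by rewrite fD bD.
- by rewrite fl bl.
- by rewrite fr br /= (alternating_braid hn).
Qed.

Variable L : leaf_choices V.

Lemma braid_mor_spec e e' (mv : braid_moves C e e') : reduced C e ->
  [/\ wp e' = wp e, reduced C e', hom_degree 0 (braid_mor (@f_mor _ _ _ _ _ V L) mv),
      forall x, beta (braid_mor (@f_mor _ _ _ _ _ V L) mv x) = beta x &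
      braid_mor (@f_mor _ _ _ _ _ V L) mv (BS1 V e) = BS1 V e'].
Proof.
elim: mv => {e e'} [e|a b s r n e hsr hn mv IH] he.
  by split=> //; apply: hom_degree_id.
have [hf f1] := f_morP L hsr hn.
have hw : wp (alternating r s n) = wp (alternating s r n) by rewrite (alternating_braid hn).
have hm : reduced C (alternating s r n).
  by have [_ /reduced_cat[]] := reduced_cat he.
have hew : wp (a ++ (alternating r s n ++ b)) = wp (a ++ (alternating s r n ++ b)).
  by rewrite !word_prod_cat hw.
have [|hw' he' hhom hbeta h1] := IH.
  by move: he; rewrite /reduced hew !size_cat !size_alternating.
split=> //.
- by rewrite hw' hew.
- rewrite -[0]add0r.
  exact: (@hom_degree_comp _ _ _ _ _ _ _ 0 0 hhom (BSmid_hom a b hf)).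
- move=> x; rewrite [LHS]hbeta; apply: (beta_mid hf) => //.
  exact: beta_braid_relation.
- rewrite /= -!BScat_BS1 (BSmidE _ _ _ hf) f1 !BScat_BS1; exact: h1.
Qed.

(** The moves are run backwards, with f_rs for f_sr. The result stands in for an inverse:
    compatibility with [beta] is enough for lifting maps through [beta]. *)
Lemma braid_reverse e e' (mv : braid_moves C e e') : reduced C e ->
  exists2 F : BS e' -> BS e, hom_degree 0 F & forall x, beta (F x) = beta x.
Proof.
elim: mv => {e e'} [e|a b s r n e hsr hn mv IH] he.
  by exists idfun => //; apply: hom_degree_id.
have hn' := has_order_sym hn.
have [hf f1] := f_morP L (fun h => hsr (esym h)) hn'.
have hw := alternating_braid hn.
have hew : wp (a ++ (alternating r s n ++ b)) = wp (a ++ (alternating s r n ++ b)).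
  by rewrite !word_prod_cat hw.
have he' : reduced C (a ++ (alternating r s n ++ b)).
  by move: he; rewrite /reduced hew !size_cat !size_alternating.
have [F hF hb] := IH he'.
exists (@BSmid _ _ _ _ _ V _ _ a b (@f_mor _ _ _ _ _ V L r s n) \o F).
  by rewrite -[0]add0r; apply: hom_degree_comp => //; apply: BSmid_hom.
move=> x; rewrite -hb; apply: (beta_mid hf) => // y.
apply: beta_braid_relation => //.
by have [_ /reduced_cat[]] := reduced_cat he'.
Qed.

End Localization.

(** * Leaves *)

(** Descent sequences are read as binary numbers, first bit most significant: for equal sizes, a
    smaller value means that the first difference is a descent of the larger one. *)
Definition bits_val (D : seq bool) : nat := foldl (fun n (b : bool) => n.*2 + b)%N 0 D.

Lemma bits_val_rcons D b : bits_val (rcons D b) = ((bits_val D).*2 + b)%N.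
Proof. by rewrite /bits_val -cats1 foldl_cat. Qed.

Lemma bits_val_inj D D' : size D = size D' -> bits_val D = bits_val D' -> D = D'.
Proof.
elim/last_ind: D D' => [|D b IH] D'; first by case: D'.
case/lastP: D' => [|D' b']; rewrite !size_rcons // => -[hs].
rewrite !bits_val_rcons => e0.
have eb : b = b'.
  by move/(congr1 odd): e0; rewrite !oddD !odd_double !oddb.
by move: e0; rewrite eb => /addIn/double_inj /(IH _ hs) ->.
Qed.

Lemma bits_val_rcons_lt D D' b b' : size D = size D' ->
  (bits_val (rcons D b) < bits_val (rcons D' b'))%N ->
  (bits_val D < bits_val D')%N \/ [/\ D = D', b = false & b' = true].
Proof.
move=> hs; rewrite !bits_val_rcons => h.
have [h1|h1|h1] := ltngtP (bits_val D) (bits_val D'); first by left.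
  move: h; rewrite ltnNge => /negP[]; move: h1; rewrite -leq_double doubleS => h1.
  apply: leq_trans (leq_trans (ltnW h1) (leq_addr b _)).
  by rewrite -addn1 leq_add2l; case: b'.
right; move: h; rewrite (bits_val_inj hs h1) ltn_add2l.
by case: b; case: b'.
Qed.

Section Leaves.
Variables (W : groupType) (S : Type) (C : coxeter_system W S).
Variables (K : realType) (d : nat) (V : refl_faithful C K d) (L : leaf_choices V).
Local Notation R := {mpoly K[d]}.
Local Notation BS := (BS V).
Local Notation act := (wact V).
Local Notation wp := (word_prod C).
Local Notation len := (length C).
Local Notation ev := (@subword_eval _ _ _ _ _ V _).
Local Notation ones n := (nseq n true).
Local Notation desc := (descents C 1%g).
Implicit Types (s : S) (e t r : seq S) (M : seq bool) (D : seq bool).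

(** The properties of a leaf, stated for a partial composite. The free tails [D] and [M'] concern
    the letters [r], on which [h] has not acted yet; they let the properties pass from a node to its
    children. *)
Definition node_spec e M t r (h : BS e -> BS (t ++ r)) : Prop :=
  exists e0, [/\ e = e0 ++ r, size M = size e0, reduced C t & wp t = wp (mask M e0)] /\
  [/\ exists k, hom_degree k h,
      forall D, h (probe V e (desc M e0 ++ D)) = BScat (BS1 V t) (probe V r D),
      forall D1 D, size D1 = size e0 -> (bits_val D1 < bits_val (desc M e0))%N ->
        h (probe V e (D1 ++ D)) = 0 &
      ~~ has id (desc M e0) -> forall M' z, size M' = size r ->
        ev (ones (size t) ++ M') (h z) = ev (M ++ M') z].

(** Common part of the four kinds of edges, with [X] the edge. A smaller probe either is smaller
    already on the earlier letters and is killed by [h], or has 1 instead of x_s at a final descent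
    and is killed by [X]. *)
Lemma node_step e M t s r (h : BS e -> BS (t ++ s :: r)) b t'
    (X : BS (t ++ s :: r) -> BS (t' ++ r)) k (down := (len (wp t * C s)%g < len (wp t))%N) :
  node_spec M h -> reduced C t' -> wp t' = (wp t * if b then C s else 1)%g ->
  hom_degree k X ->
  (forall y, X (BScat (BS1 V t) (ptens s (if down then xs V s else 1) y)) =
             BScat (BS1 V t') y) ->
  (down -> forall y, X (BScat (BS1 V t) (ptens s 1 y)) = 0) ->
  (~~ down -> forall M' z, size M' = size r ->
     ev (ones (size t') ++ M') (X z) = ev (ones (size t) ++ b :: M') z) ->
  node_spec (rcons M b) (X \o h).
Proof.
move=> [e0 [[ee sM ht hw] [[k0 hk] hP hQ hE]]] ht' hw' hX hX1 hX0 hXe.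
have hd : desc (rcons M b) (rcons e0 s) = rcons (desc M e0) down.
  by rewrite -!cats1 descents_cat // mul1g -hw.
exists (rcons e0 s); rewrite hd; split; split=> //.
- by rewrite ee cat_rcons.
- by rewrite !size_rcons sM.
- rewrite hw' hw mask_rcons // word_prod_cat; congr (_ * _)%g.
  by case: (b); rewrite //= mulg1.
- by exists (k0 + k); apply: hom_degree_comp.
- by move=> D; rewrite cat_rcons /= hP hX1.
- move=> D1 D; case/lastP: D1 => [|D1 c]; rewrite !size_rcons // => -[hs].
  have [[X_D _ _] _] := hX.
  case/bits_val_rcons_lt=> [|hlt|[-> -> hdown]].
  + by rewrite hs size_descents.
  + by rewrite cat_rcons /= hQ // (additive_0 X_D).
  + by rewrite cat_rcons /= hP; apply: hX0.
- rewrite has_rcons negb_or => /andP[hn hno] M' z hM'.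
  by rewrite cat_rcons /= hXe // hE //= hM'.
Qed.

Lemma BScat_mid_gen s r (t : seq S) p (y : BS r) :
  BScat (BS1 V t) (ptens s p y) =
  BScat (b := [:: s] ++ r) (BS1 V t) (BScat (a := [:: s]) (ptens s p (1 : BS [::])) y).
Proof. by rewrite BScat_gen. Qed.

Lemma BScast_append s r (t : seq S) (y : BS r) :
  BScast (catA t [:: s] r) (BScat (BS1 V t) (ptens s 1 y)) = BScat (BS1 V (t ++ [:: s])) y.
Proof.
by rewrite -BScat_BS1 -BScat_assoc; congr (BScast _ (BScat _ _)); rewrite BScat_gen.
Qed.

Lemma step_up0 e M t s r (h : BS e -> BS (t ++ s :: r)) :
  node_spec M h -> (len (wp t) < len (wp t * C s)%g)%N ->
  node_spec (rcons M false) (@BSmid _ _ _ _ _ V _ _ t r (@m_mor _ _ _ _ _ V s) \o h).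
Proof.
move=> hh hup; have hm := m_mor_hom V s.
have hdown : (len (wp t * C s)%g < len (wp t))%N = false by rewrite ltnNge ltnW.
have ht : reduced C t by case: hh => e0 [[]].
apply: (node_step hh ht _ (BSmid_hom t r hm)).
- by rewrite mulg1.
- by rewrite hdown => y; rewrite BScat_mid_gen (BSmidE _ _ _ hm) m_morE mulr1 BScat1.
- by rewrite hdown.
- move=> _ M' z hM'.
  apply: (eval_mid (Ma := [:: false]) (Mb := [::]) _ hm) => //.
    by rewrite size_nseq.
  exact: eval_m_mor.
Qed.

Lemma ones_rcons n (M' : seq bool) : ones (n + 1) ++ M' = ones n ++ true :: M'.
Proof. by rewrite nseqD -catA. Qed.

Lemma step_up1 e M t s r (h : BS e -> BS (t ++ s :: r)) :
  node_spec M h -> (len (wp t) < len (wp t * C s)%g)%N ->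
  node_spec (rcons M true) (BScast (catA t [:: s] r) \o h).
Proof.
move=> hh hup.
have hdown : (len (wp t * C s)%g < len (wp t))%N = false by rewrite ltnNge ltnW.
have ht : reduced C t by case: hh => e0 [[]].
apply: (node_step hh _ _ (BScast_hom V _)).
- exact: reduced_up.
- by rewrite word_prod_cat word_prod1.
- rewrite hdown => y; exact: BScast_append.
- by rewrite hdown.
- by move=> _ M' z hM'; rewrite eval_cast size_cat ones_rcons.
Qed.

Section Down.
Variables (t t' : seq S) (s : S) (r : seq S) (mv : braid_moves C t (t' ++ [:: s])).
Hypothesis ht : reduced C t.
Hypothesis hs : (len (wp t * C s)%g < len (wp t))%N.

Lemma down_mor_hom : exists k, hom_degree k (down_mor L (r := r) mv).
Proof.
have [_ _ hb _ _] := braid_mor_spec L mv ht.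
have h1 := BStens_hom hb (hom_degree_id (BS (s :: r))).
have h2 := BScast_hom V (esym (catA t' [:: s] (s :: r))).
have h3 := BSmid_hom t' r (j_mor_hom V s).
by eexists; apply: hom_degree_comp (hom_degree_comp h3 h2) h1.
Qed.

(** j_s applies the Demazure operator to [q], which gives 1 for x_s and 0 for 1: hence the factors
    x_s of the probes at descents. *)
Lemma down_morE q (y : BS r) :
  down_mor L mv (BScat (BS1 V t) (ptens s q y)) =
  BScat (BS1 V t') (ptens s (demazure V s q) y).
Proof.
have [_ _ hb _ h1] := braid_mor_spec L mv ht.
rewrite /down_mor /= BStensE; [|exact: hb.1|exact: (hom_degree_id _).1].
rewrite h1 -BScat_BS1 -BScat_assoc.
have castK a b (E : a = b) (x : BS a) : BScast (esym E) (BScast E x) = x by case: _ / E.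
rewrite castK.
have -> : BScat (BS1 V [:: s]) (ptens s q y) =
    BScat (ptens s 1 (ptens s q (1 : BS [::])) : BS [:: s; s]) y.
  by rewrite BScat_gen BScat_ptens BScat_gen.
by rewrite (BSmidE _ _ _ (j_mor_hom V s)) j_morE mul1r BScat_gen.
Qed.

Lemma down_prod : wp t' = (wp t * C s)%g.
Proof.
have [<- _ _ _ _] := braid_mor_spec L mv ht.
by rewrite word_prod_cat word_prod1 mulgenK.
Qed.

Lemma down_reduced : reduced C (t' ++ [:: s]).
Proof. by have [] := braid_mor_spec L mv ht. Qed.
End Down.

(** The word [t' ++ [:: s]] reached after j_s has the product of [t], and removing its last letter
    by m_s multiplies this product by [s]. So at a descent the child through m_s is the one that
    takes the letter, opposite to the ascending case. *)
Lemma step_down0 e M t s r (h : BS e -> BS (t ++ s :: r)) t'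
    (mv : braid_moves C t (t' ++ [:: s])) :
  node_spec M h -> (len (wp t * C s)%g < len (wp t))%N ->
  node_spec (rcons M true) (@BSmid _ _ _ _ _ V _ _ t' r (@m_mor _ _ _ _ _ V s) \o
    down_mor L mv \o h).
Proof.
move=> hh hs; have ht : reduced C t by case: hh => e0 [[]].
have hm := m_mor_hom V s; have [k hk] := down_mor_hom r mv ht.
have h1 := hom_degree_comp (BSmid_hom t' r hm) hk.
have [m_D _ _] := (BSmid_hom t' r hm).1.
apply: (node_step hh _ _ h1).
- by have [] := reduced_cat (down_reduced mv ht).
- exact: down_prod.
- rewrite hs => y /=.
  by rewrite down_morE // demazure_xs BScat_mid_gen (BSmidE _ _ _ hm) m_morE mulr1 BScat1.
- move=> _ y /=; rewrite down_morE // demazure1.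
  have -> : ptens s 0 y = 0 by apply: pure0l.
  by rewrite BScat0r (additive_0 m_D).
- by rewrite hs.
Qed.

Lemma step_down1 e M t s r (h : BS e -> BS (t ++ s :: r)) t'
    (mv : braid_moves C t (t' ++ [:: s])) :
  node_spec M h -> (len (wp t * C s)%g < len (wp t))%N ->
  node_spec (rcons M false) (BScast (catA t' [:: s] r) \o down_mor L mv \o h).
Proof.
move=> hh hs; have ht : reduced C t by case: hh => e0 [[]].
have [k hk] := down_mor_hom r mv ht.
have hc := BScast_hom V (catA t' [:: s] r).
have h1 := hom_degree_comp hc hk.
have [c_D _ _] := hc.1.
apply: (node_step hh _ _ h1).
- exact: down_reduced mv ht.
- by rewrite word_prod_cat word_prod1 (down_prod mv ht) mulgenK mulg1.
- rewrite hs => y /=.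
  rewrite down_morE // demazure_xs; exact: BScast_append.
- move=> _ y /=; rewrite down_morE // demazure1.
  have -> : ptens s 0 y = 0 by apply: pure0l.
  by rewrite BScat0r (additive_0 c_D).
- by rewrite hs.
Qed.

Lemma node_spec_root e : @node_spec e [::] [::] e idfun.
Proof.
exists [::]; split; split=> //=.
- by rewrite /reduced /= length1.
- by exists 0; apply: hom_degree_id.
- by move=> D; rewrite lact1.
Qed.

Lemma tree_node_spec e path t r (h : BS e -> BS (t ++ r)) :
  tree_node L path h -> exists M, node_spec M h.
Proof.
elim=> {path t r h} [|p t s r h _ [M hM] hs|p t s r h _ [M hM] hs
  |p t s r h ht hs _ [M hM]|p t s r h ht hs _ [M hM]].
- by exists [::]; apply: node_spec_root.
- by exists (rcons M false); apply: step_up0.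
- by exists (rcons M true); apply: step_up1.
- by exists (rcons M true); apply: step_down0.
- by exists (rcons M false); apply: step_down1.
Qed.

Lemma tree_node_exists e e0 r M : e = e0 ++ r -> size M = size e0 ->
  exists path t (h : BS e -> BS (t ++ r)), tree_node L path h /\ node_spec M h.
Proof.
elim/last_ind: e0 r M => [|e0 s IH] r M.
  move=> -> /size0nil->; exists [::], [::], idfun; split; first exact: tree_root.
  exact: node_spec_root.
case/lastP: M => [|M b]; rewrite cat_rcons !size_rcons // => ee [hM].
have [p [t [h [hn hspec]]]] := IH _ _ ee hM.
have ht : reduced C t by case: hspec => e1 [[]].
have [hs|hs] := boolP (len (wp t * C s)%g < len (wp t))%N; last first.
  rewrite -length_mulgen_gtNlt in hs; case: b.
    exists (rcons p true), (t ++ [:: s]), (BScast (catA t [:: s] r) \o h).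
    by split; [apply: tree_up1 | apply: step_up1].
  exists (rcons p false), t, (@BSmid _ _ _ _ _ V _ _ t r (@m_mor _ _ _ _ _ V s) \o h).
  by split; [apply: tree_up0 | apply: step_up0].
case: b.
  by do 3 eexists; split; [apply: (tree_down0 ht hs hn) | apply: step_down0].
by do 3 eexists; split; [apply: (tree_down1 ht hs hn) | apply: step_down1].
Qed.

Definition leaf_spec e M x (l : BS e -> BS (rex L x)) : Prop :=
  [/\ size M = size e, x = wp (mask M e) & exists k, hom_degree k l] /\
  [/\ l (probe V e (desc M e)) = BS1 V (rex L x),
      forall D, size D = size e -> (bits_val D < bits_val (desc M e))%N ->
        l (probe V e D) = 0 &
      ~~ has id (desc M e) -> forall z, beta (l z) = ev M z].

Lemma leaf_end_spec e M t (h : BS e -> BS (t ++ [::])) (ht : reduced C t) :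
  node_spec M h ->
  @leaf_spec e M (wp t)
    (braid_mor (@f_mor _ _ _ _ _ V L) (end_moves L ht) \o BScast (cats0 t) \o h).
Proof.
move=> [e0 [[ee hM _ hw] [[k hk] hP hQ hE]]].
rewrite cats0 in ee; subst e0.
have [_ _ hb hbeta h1] := braid_mor_spec L (end_moves L ht) ht.
have hc := BScast_hom V (cats0 t).
have [b_D _ _] := hb.1; have [c_D _ _] := hc.1.
split; split=> //.
- by eexists; apply: hom_degree_comp (hom_degree_comp hb hc) hk.
- have := hP [::]; rewrite (cats0 (desc M e)) /= => ->.
  by rewrite (BScat_BS1 V t [::]) BScast_BS1.
- move=> D hD hlt; have := hQ D [::] hD hlt; rewrite (cats0 D) /= => ->.
  by rewrite (additive_0 c_D) (additive_0 b_D).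
- move=> hn z; rewrite /= hbeta betaE eval_cast.
  by have := hE hn [::] z erefl; rewrite (cats0 (ones _)) (cats0 M).
Qed.

Lemma leaf_has_spec e x (l : BS e -> BS (rex L x)) :
  leaf L e x l -> exists M, leaf_spec M l.
Proof.
by case=> path t h ht /tree_node_spec[M hM]; exists M; apply: leaf_end_spec.
Qed.

Lemma leaf_exists e M x : size M = size e -> x = wp (mask M e) ->
  exists l : BS e -> BS (rex L x), leaf L e x l /\ leaf_spec M l.
Proof.
move=> hM ->; have [p [t [h [hn hs]]]] := @tree_node_exists e e [::] M (esym (cats0 e)) hM.
have [e0 [[ee _ ht hw] _]] := hs.
have -> : wp (mask M e) = wp t by rewrite hw ee cats0.
by exists (braid_mor (@f_mor _ _ _ _ _ V L) (end_moves L ht) \o BScast (cats0 t) \o h);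
  split; [apply: LeafEnd hn | apply: leaf_end_spec].
Qed.

End Leaves.

(** * The leaf basis *)

Section PolygrTheory.
Variables (K : realType) (d : nat).
Local Notation R := {mpoly K[d]}.
Implicit Types (p q : R).

Lemma polygr_one i : polygr i (1 : R) -> i = 0.
Proof.
case=> [/eqP|[n -> hn]]; first by rewrite oner_eq0.
have := dhomog_nemf_coeff (m := 0%MM) hn; rewrite mf0 mcoeff1 eqxx.
by case: n {hn} => // n /(_ isT) /eqP; rewrite oner_eq0.
Qed.

Lemma polygrD i p q : polygr i p -> polygr i q -> polygr i (p + q).
Proof.
by move=> hp hq; rewrite -[q]opprK -[- q]sub0r; do 2 apply: polygrB => //; apply: polygr0.
Qed.

Lemma polygr_sum i (I : finType) (f : I -> R) :
  (forall k, polygr i (f k)) -> polygr i (\sum_k f k).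
Proof. by move=> hf; elim/big_ind: _ => //; [apply: polygr0 | apply: polygrD]. Qed.

End PolygrTheory.

Section LeafBasis.
Variables (W : groupType) (S : Type) (C : coxeter_system W S).
Variables (K : realType) (d : nat) (V : refl_faithful C K d) (L : leaf_choices V).
Local Notation R := {mpoly K[d]}.
Local Notation BS := (BS V).
Local Notation act := (wact V).
Local Notation wp := (word_prod C).
Local Notation len := (length C).
Local Notation ev := (@subword_eval _ _ _ _ _ V _).
Local Notation ones n := (nseq n true).
Local Notation desc := (descents C 1%g).
Implicit Types (s : S) (e t r : seq S) (M : seq bool) (D : seq bool) (x : W).

Lemma size_rex x : size (rex L x) = len x.
Proof. by have [hx /reducedP->] := rexP L x; rewrite hx. Qed.

Lemma beta_rex_hom x :
  hom_degree 0 (@beta _ _ _ _ _ V (rex L x) : BS (rex L x) -> standard V x).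
Proof.
have [hx hr] := rexP L x.
by have := beta_hom V hr; move: (@beta _ _ _ _ _ V (rex L x)); rewrite hx.
Qed.

(** Triangular elimination against the probes finds the coefficients, and [twisted_dual] shows that
    nothing remains. All bimodule maps are covered, homogeneous or not; in the homogeneous case the
    degrees of the coefficients are controlled as well. *)
Lemma leaf_span e x : exists (I : finType) (l : I -> BS e -> BS (rex L x)) (dg : I -> int),
  (forall i, leaf L e x (l i) /\ hom_degree (dg i) (l i)) /\
  forall psi : BS e -> standard V x, bimod_hom psi -> exists c : I -> R,
    (forall z, psi z = \sum_i c i * beta (l i z)) /\
    forall k, hom_degree k psi -> forall i, polygr (k - dg i) (c i).
Proof.
pose I := {m : (size e).-tuple bool | @masks_to _ _ C e x m}.
have /choice[l hl] : forall i : I, exists l : BS e -> BS (rex L x),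
    leaf L e x l /\ leaf_spec (tval (val i)) l.
  by move=> [m /= /eqP hm]; apply: leaf_exists; rewrite ?size_tuple.
have /choice[dg hdg] : forall i, exists k, hom_degree k (l i).
  by move=> i; have [_ [[]]] := hl i.
exists I, l, dg; split=> [i|psi hpsi]; first by split; [case: (hl i)|].
pose D (i : I) := desc (tval (val i)) e.
pose b i := probe V e (D i); pose rk i := bits_val (D i).
pose phi i z : R := beta (l i z).
have sD i : size (D i) = size e by rewrite size_descents.
have rk_inj : injective rk.
  move=> i j /bits_val_inj; rewrite !sD => /(_ erefl) hD.
  apply/val_inj/val_inj; apply: (descents_inj _ _ hD _).2; rewrite ?size_tuple //.
  by rewrite !mul1g; have [[_ <- _] _] := (hl i).2; have [[_ <- _] _] := (hl j).2.
have [[bD bl br] bg] := beta_rex_hom x.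
have phi1 i : phi i (b i) = 1.
  by have [_ [h _ _]] := (hl i).2; rewrite /phi h betaE eval_BS1.
have phi0 i j : (rk j < rk i)%N -> phi i (b j) = 0.
  by have [_ [_ h _]] := (hl i).2 => hij; rewrite /phi h ?sD // (additive_0 bD).
pose g i : int := 2 * (count id (D i))%:Z - (size e)%:Z.
have gb i : gr (g i) (b i) by apply: probe_gr.
have phi_gr i j : polygr (g j + dg i + (len x)%:Z) (phi i (b j)).
  by have := bg _ _ ((hdg i).2 _ _ (gb j)); rewrite addr0.
(* The value of [phi i] at [b i] is 1, of degree zero, which ties the degree of [l i] to that of its
   probe. *)
have gE i : g i + dg i + (len x)%:Z = 0.
  by apply: (@polygr_one K d); rewrite -(phi1 i).
have elim_step n : exists c : I -> R,
    (forall j, (rk j < n)%N -> psi (b j) = \sum_i c i * phi i (b j)) /\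
    forall k, hom_degree k psi -> forall i, polygr (k - dg i) (c i).
  elim: n => [|n [c [hc hk]]]; first by exists (fun=> 0); split=> // *; apply: polygr0.
  case: (pickP (fun i => rk i == n)) => [i0 /eqP hi0|hno]; last first.
    exists c; split=> // j; rewrite ltnS leq_eqVlt hno; exact: hc.
  (* The defect at [b i0] is absorbed by the coefficient of [phi i0], which vanishes on the probes
     of lower rank and so leaves their equations intact. *)
  pose dl : R := (psi (b i0) : R) - \sum_i c i * phi i (b i0).
  have hsum j : \sum_i (c i + (i == i0)%:R * dl) * phi i (b j) =
      \sum_i c i * phi i (b j) + dl * phi i0 (b j).
    under eq_bigr do rewrite mulrDl.
    rewrite big_split /=; congr (_ + _); rewrite (bigD1 i0) //= eqxx mul1r.
    by rewrite big1 ?addr0 // => i /negbTE->; rewrite !mul0r.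
  exists (fun i => c i + (i == i0)%:R * dl); split=> [j|k hpk i].
    rewrite ltnS leq_eqVlt hsum -hi0 => /orP[/eqP/rk_inj->|hj].
      by rewrite phi1 mulr1 addrC subrK.
    by rewrite phi0 // mulr0 addr0 hc // -hi0.
  apply: polygrD; first exact: hk.
  case: eqP => [->|_]; last by rewrite mul0r; apply: polygr0.
  have e0 : k - dg i0 = g i0 + k + (len x)%:Z.
    apply: (addIr (dg i0)); rewrite subrK -[LHS]addr0 -(gE i0); ring.
  rewrite mul1r; apply: polygrB; first by rewrite e0; apply: hpk.2 (gb i0).
  apply: polygr_sum => j.
  have -> : k - dg i0 = (k - dg j) + (g i0 + dg j + (len x)%:Z) by rewrite e0; ring.
  by apply: polygrM => //; apply: hk.
have [c [hc hk]] := elim_step (\max_i rk i).+1.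
exists c; split=> // z; apply/eqP; rewrite -subr_eq0; apply/eqP.
have bphi i : bimod_hom (phi i : BS e -> standard V x).
  exact: bimod_hom_comp (beta_rex_hom x).1 (hdg i).1.
apply: (@twisted_dual _ _ _ _ _ V e x I phi b rk
  (fun z => (psi z : R) - \sum_i c i * phi i z)) => //.
- by rewrite card_sig.
- by move=> i; apply: bimod_twisted (bphi i).
- apply: (@bimod_twisted _ _ _ _ _ V e x); apply: bimod_hom_sub => //.
  by apply: bimod_hom_sum => i _; apply: bimod_hom_lact (bphi i).
- by move=> j; rewrite -hc ?subrr // ltnS leq_bigmax.
Qed.

(** A combination of leaves is a finite sum of homogeneous maps. Bimodule maps to R_x can thus be
    taken as elements of Hom^Z without exhibiting degrees. *)
Lemma bimod_isHomZ e x (psi : BS e -> standard V x) : bimod_hom psi -> isHomZ psi.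
Proof.
move=> hpsi; have [I [l [dg [hl hspan]]]] := leaf_span e x.
have [c [hc _]] := hspan psi hpsi.
have -> : psi = fun z => \sum_i lact (c i) (beta (l i z) : standard V x).
  by apply/funext => z; rewrite hc.
apply: isHomZ_sum => i _; apply: isHomZ_lact.
apply: (@isHomZ1 _ _ _ _ (dg i + 0)).
exact: hom_degree_comp (beta_rex_hom x) (hl i).2.
Qed.

Definition bimodZ e x (psi : BS e -> standard V x) (h : bimod_hom psi) :
  homZ (BS e) (standard V x) := mkHomZ (bimod_isHomZ h).

(** The leaves in the expansion of [g] end at the chosen word of [wp e1]; [braid_reverse] carries
    them to [e1] itself without changing [beta]. *)
Lemma beta_lift e e1 (g : BS e -> standard V (wp e1)) :
  reduced C e1 -> bimod_hom g ->
  exists2 h : BS e -> BS e1, bimod_hom h & forall z, beta (h z) = g z.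
Proof.
move=> he1 hg; have [I [l [dg [hl hspan]]]] := leaf_span e (wp e1).
have [c [hc _]] := hspan g hg.
have [F hF hb] := braid_reverse L (end_moves L he1) he1.
exists (fun z => \sum_i lact (c i) (F (l i z))).
  apply: bimod_hom_sum => i _; apply: bimod_hom_lact.
  exact: bimod_hom_comp hF.1 (hl i).2.1.
move=> z; rewrite hc betaE (big_morph _ (@evalD _ _ _ _ _ V e1 _) (eval0 V e1 _)).
by apply: eq_bigr => i _; rewrite eval_lact -betaE hb.
Qed.

(** * Classes of maps modulo R^+ *)

Lemma redhom_scaleE B B' (f : homZ B B') (a c : K) :
  a *: redhom_tens (d := d) f c = redhom_tens f (c * a).
Proof.
rewrite -[LHS]/(redhom_scale a (redhom_tens f c)) /redhom_scale.
transitivity (pure predT (f : HomZ_bimod B B') (ract (c : residue) (a%:MP : R))).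
  exact: tens_ract_pure.
by rewrite /redhom_tens /= mcoeffC eqxx mulr1.
Qed.

Lemma redhom_tensD B B' (f g : homZ B B') (c : K) :
  redhom_tens (d := d) (f + g) c = redhom_tens f c + redhom_tens g c.
Proof. exact: pureDl. Qed.

(* The right action of [p] on maps to [R_x] is the left action of [x p], and
   both reduce to the constant term of [p]. *)
Lemma redhom_expand e x (I : finType) (c : I -> R)
    (f : I -> homZ (BS e) (standard V x)) (g : homZ (BS e) (standard V x)) :
  (forall z, g z = \sum_i c i * (f i z : R)) ->
  redhom_tens g 1 = \sum_i (c i)@_0%MM *: redhom_tens (f i) 1.
Proof.
move=> hg; have -> : g = \sum_i homZ_ract (f i) (act x^-1%g (c i)).
  apply: homZ_eq => z; rewrite hg.
  elim/big_rec2: _ => [//|i a b _ ->]; rewrite homZDE; congr (_ + _).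
  by rewrite /= wactVK mulrC.
have h0 : redhom_tens (0 : homZ (BS e) (standard V x)) 1 = 0 by apply: pure0l.
have hD (a b : homZ (BS e) (standard V x)) :
  redhom_tens (a + b) 1 = redhom_tens a 1 + redhom_tens b 1 by apply: redhom_tensD.
rewrite (big_morph _ hD h0); apply: eq_bigr => i _.
rewrite redhom_scaleE mul1r.
transitivity (pure predT (f i : HomZ_bimod (BS e) (standard V x))
  (lact (act x^-1%g (c i)) (1 : residue))).
  exact: pureA.
by rewrite /= mulr1 wact_const.
Qed.

(** Vanishing modulo R^+, for a bare function: quantifying over [g'] avoids fixing a proof of
    membership in Hom^Z. *)
Definition negligible e x (g : BS e -> standard V x) : Prop :=
  forall g' : homZ (BS e) (standard V x), (forall z, g' z = g z) -> redhom_tens g' 1 = 0.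

Lemma negligibleD e x (f g : BS e -> standard V x) (a : R) :
  bimod_hom f -> bimod_hom g -> negligible f -> a@_0%MM = 0 ->
  @negligible e x (fun z => (f z : R) + a * g z).
Proof.
move=> hf hg nf a0 h he.
rewrite (@redhom_expand _ _ bool (fun b => if b then 1 else a)
  (fun b => if b then bimodZ hf else bimodZ hg)).
  by rewrite big_bool /= a0 scale0r addr0 nf ?scaler0.
by move=> z; rewrite he big_bool /= mul1r.
Qed.

Lemma negligible0 e x (f : BS e -> standard V x) : (forall z, f z = 0) -> negligible f.
Proof.
move=> hf g hg; rewrite (@redhom_expand _ _ 'I_0 (fun=> 0) (fun=> g)) ?big_ord0 //.
by move=> z; rewrite big_ord0 hg hf.
Qed.

Lemma mcoeff0_xs x s : (act x (xs V s))@_0%MM = 0.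
Proof.
rewrite wact_const xsE /linform raddf_sum big1 // => k _ /=.
by rewrite mcoeffZ mcoeffX mnm1_eq0 mulr0.
Qed.

(** * Deleting the skipped letters of an ascending subexpression *)

Local Notation forget t r := (@BSmid _ _ _ _ _ V _ _ t r (@m_mor _ _ _ _ _ V _)).

Lemma eval_forget t s r M' (y : BS (t ++ s :: r)) :
  ev (ones (size t) ++ M') (forget t r y) = ev (ones (size t) ++ false :: M') y.
Proof.
apply: (eval_mid (Ma := [:: false]) (Mb := [::]) _ (m_mor_hom V s)) => //.
  by rewrite size_nseq.
exact: eval_m_mor.
Qed.

(** Skipping [s] instead of applying it changes a value p by p - s(p), a multiple of x_s, which the
    prefix [t] turns into a multiple of t(x_s). *)
Lemma beta_forget t s r (y : BS (t ++ s :: r)) :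
  exists q, beta (forget t r y) - beta y = act (wp t) (xs V s) * q.
Proof.
rewrite !betaE !size_cat !nseqD eval_forget.
have hsz : size (ones (size t)) = size t by rewrite size_nseq.
elim/BScat_ind: y => [|y y' [q hq] [q' hq']|y x].
- by exists 0; rewrite !eval0 subrr mulr0.
- by exists (q - q'); rewrite !evalB mulrBr -hq -hq' !opprD !opprK addrACA.
rewrite !(eval_cat _ _ _ hsz) mask_ones -mulrBr -wactB.
suff [q ->] : exists q,
    ev (false :: ones (size r)) x - ev (ones (size (s :: r))) x = xs V s * q.
  by exists (ev (ones (size t)) y * act (wp t) q); rewrite wactM mulrCA.
elim/ptens_ind: x => [|x x' [q hq] [q' hq']|p z].
- by exists 0; rewrite !eval0 subrr mulr0.
- by exists (q - q'); rewrite !evalB mulrBr -hq -hq' !opprD !opprK addrACA.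
- exists (p * (2%:R * demazure V s (ev (ones (size r)) z))).
  rewrite !eval_ptens wact_id -mulrBr -demazureE [RHS]mulrCA; congr (_ * _).
  by rewrite mulrA [xs V s * _]mulrC.
Qed.

Lemma has_negb_split M : has negb M -> exists k M', M = ones k ++ false :: M'.
Proof.
elim: M => // -[] M IH /=; last by exists 0%N, M.
by move=> /IH[k [M' ->]]; exists k.+1, M'.
Qed.

Lemma no_id D : ~~ has id D -> D = nseq (size D) false.
Proof. by elim: D => // -[] D IH //= /IH {1}->. Qed.

(* Collapsing an ascending subexpression of the reduced word [e] one letter at
   a time: at each stage beta of the shorter word agrees with beta modulo a
   linear form, and the quotient lifts to a Bott-Samelson bimodule. *)
Lemma eval_negligible w e M x (f : BS w -> BS e) :
  reduced C e -> size M = size e -> x = wp (mask M e) -> ~~ has id (desc M e) ->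
  bimod_hom f -> (forall z, beta (f z) = 0) ->
  @negligible w x (fun z => ev M (f z)).
Proof.
move en : (count negb M) => n.
elim: n e M en f => [|n IH] e M en f he hM hx hd hf hb.
  (* With nothing skipped [M] is the full mask, so the evaluation is [beta], which vanishes on the
     image of [f]. *)
  apply: negligible0 => z; rewrite -(hb z) betaE; congr (ev _ (f z)).
  rewrite -hM; apply/all_pred1P; rewrite all_count.
  by have := count_predC negb M; rewrite en add0n => <-; apply/eqP/eq_count => -[].
have /has_negb_split[k [m eM]] : has negb M by rewrite has_count en.
have [t [s [r [ee ht]]]] : exists t s r, e = t ++ s :: r /\ size t = k.
  have hk : (k < size e)%N by rewrite -hM eM size_cat size_nseq /= addnS ltnS leq_addr.
  move: (cat_take_drop k e) (size_drop k e) (size_takel (ltnW hk)).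
  case: (drop k e) => [_ /eqP|s r] /=; first by rewrite eq_sym subn_eq0 leqNgt hk.
  by move=> h _ hs; exists (take k e), s, r.
subst e k M; have hsz : size (ones (size t)) = size t by rewrite size_nseq.
have sm : size m = size r.
  by move: hM; rewrite !size_cat size_nseq /= => /addnI[].
have [rt /(@reduced_cat _ _ C [:: s])[_ rr]] := reduced_cat he.
move: hd; rewrite descents_cat // mask_ones mul1g has_cat /= !negb_or => /and3P[hd1 hd2 hd3].
(* Starting from [wp t], the steps of [m] along [r] have no descents, so [t] and [r] concatenate to
   a reduced word. *)
have re1 : reduced C (t ++ r).
  rewrite /reduced word_prod_cat (reduced_no_descents sm rr) ?size_cat.
    by rewrite (reducedP rt).
  by rewrite (no_id hd3) size_descents.
pose al := act (wp t) (xs V s).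
have al0 : al != 0.
  by rewrite /al -(wact0 V (wp t)) (inj_eq (@wact_inj _ _ _ _ _ V _)) xs_neq0.
have hmid := (BSmid_hom t r (m_mor_hom V s)).1.
have hmf : bimod_hom (forget t r \o f) := bimod_hom_comp hmid hf.
(* As [beta] kills the image of [f], its value after the deletion is divisible by [al]. The quotient
   is a bimodule map because R is a domain, and [beta_lift] writes it as [beta] of some [h]. *)
have /choice[g hg] : forall z, exists q : R, beta (forget t r (f z)) = al * q.
  by move=> z; have [q] := beta_forget (f z); rewrite hb subr0; exists q.
have bg : bimod_hom (g : BS w -> standard V (wp (t ++ r))).
  have [hD hl hr] := bimod_hom_comp (beta_bimod V (t ++ r)) hmf.
  split=> [y z|q z|z q]; apply: (mulfI al0).
  - by rewrite mulrDr -!hg; apply: hD.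
  - by rewrite /= mulrCA -!hg; apply: hl.
  - by rewrite /= mulrA -!hg; apply: hr.
have [h bh hh] := beta_lift re1 bg.
(* Subtracting [al] times [h] makes [beta] vanish, as the induction requires. Since [al] has zero
   constant term, the correction disappears modulo R^+. *)
pose f1 z := forget t r (f z) - lact al (h z).
have bf1 : bimod_hom f1 := bimod_hom_sub hmf (bimod_hom_lact al bh).
have bf1_0 z : beta (f1 z) = 0.
  by rewrite /f1 betaE evalB eval_lact -!betaE hg hh subrr.
pose M1 := ones (size t) ++ m.
have sM1 : size M1 = size (t ++ r) by rewrite !size_cat hsz sm.
have xM1 : x = wp (mask M1 (t ++ r)).
  by rewrite hx !mask_cat //= !mask_ones.
have nM1 : ~~ has id (desc M1 (t ++ r)).
  by rewrite descents_cat // mask_ones mul1g has_cat negb_or hd1.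
have cM1 : count negb M1 = n.
  by move: en; rewrite !count_cat /= addnCA => -[].
have n1 := IH _ _ cM1 f1 re1 sM1 xM1 nM1 bf1 bf1_0.
have be : bimod_hom (@subword_eval _ _ _ _ _ V (t ++ r) M1 : _ -> standard V x).
  by rewrite xM1; apply: eval_bimod.
have := negligibleD (bimod_hom_comp be bf1) (bimod_hom_comp be bh) n1 (mcoeff0_xs (wp t) s).
have -> // : (fun z => (ev M1 \o f1) z + act (wp t) (xs V s) * (ev M1 \o h) z) =
  (fun z => ev (ones (size t) ++ false :: m) (f z)) :> (BS w -> R).
by apply/funext => z; rewrite /= /f1 evalB eval_lact subrK eval_forget.
Qed.

End LeafBasis.

(** * Reduction modulo R^+ *)

Section ReducedHom.
Variables (K : realType) (d : nat).
Implicit Types B : gbimod K d.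

Lemma redhom_ind B B' (Q : redhom B B' -> Prop) : Q 0 ->
  (forall x y, Q x -> Q y -> Q (x - y)) ->
  (forall (f : homZ B B') c, Q (redhom_tens f c)) -> forall x, Q x.
Proof. exact: tens_ind. Qed.

Lemma redhom_tens0r B B' (f : homZ B B') : redhom_tens f 0 = 0.
Proof. exact: pure0r. Qed.

Lemma redhom_compBl B1 B2 B3 (x x' : redhom B2 B3) (y : redhom B1 B2) :
  redhom_comp (x - x') y = redhom_comp x y - redhom_comp x' y.
Proof. exact: tens_liftB (redhom_comp_bal2 _ y) x x'. Qed.

Lemma redhom_comp0l B1 B2 B3 (y : redhom B1 B2) :
  redhom_comp (0 : redhom B2 B3) y = 0.
Proof. by rewrite -[0]subr0 redhom_compBl subrr. Qed.

Lemma redhom_compDl B1 B2 B3 (x x' : redhom B2 B3) (y : redhom B1 B2) :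
  redhom_comp (x + x') y = redhom_comp x y + redhom_comp x' y.
Proof. by apply: (addIr (- redhom_comp x' y)); rewrite -redhom_compBl !addrK. Qed.

Lemma redhom_compBr B1 B2 B3 (x : redhom B2 B3) (y y' : redhom B1 B2) :
  redhom_comp x (y - y') = redhom_comp x y - redhom_comp x y'.
Proof.
elim/redhom_ind: x => [|x x' hx hx'|f c]; first by rewrite !redhom_comp0l subrr.
  by rewrite !redhom_compBl hx hx' !opprD !opprK addrACA.
have hE z : redhom_comp (redhom_tens f c) z =
    tens_lift (fun (a : HomZ_bimod B1 B2) (e : residue) =>
      redhom_tens (homZ_comp f a) (c * e)) z.
  exact: tens_lift_pure (redhom_comp_bal2 _ z) f c.
by rewrite !hE; apply: tens_liftB (redhom_comp_bal1 B1 f c) y y'.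
Qed.

Lemma redhom_comp0r B1 B2 B3 (x : redhom B2 B3) :
  redhom_comp x (0 : redhom B1 B2) = 0.
Proof. by rewrite -[0]subr0 redhom_compBr subrr. Qed.

Lemma redhom_compZl B1 B2 B3 a (x : redhom B2 B3) (y : redhom B1 B2) :
  redhom_comp (a *: x) y = a *: redhom_comp x y.
Proof.
elim/redhom_ind: x => [|x x' hx hx'|f c].
- by rewrite scaler0 !redhom_comp0l scaler0.
- by rewrite scalerBr !redhom_compBl hx hx' scalerBr.
elim/redhom_ind: y => [|y y' hy hy'|g k].
- by rewrite !redhom_comp0r scaler0.
- by rewrite !redhom_compBr hy hy' scalerBr.
- by rewrite redhom_scaleE !redhom_compE redhom_scaleE mulrAC.
Qed.

Lemma redhom_comp_suml B1 B2 B3 (I : finType) (f : I -> redhom B2 B3)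
    (y : redhom B1 B2) :
  redhom_comp (\sum_i f i) y = \sum_i redhom_comp (f i) y.
Proof.
elim/big_rec2: _ => [|i a b _ <-]; first exact: redhom_comp0l.
exact: redhom_compDl.
Qed.

(** The residue field sits in degree zero, so a homogeneous class is a combination of classes of
    maps of that same degree. *)
Lemma redhom_gr_ind B B' i (Q : redhom B B' -> Prop) : Q 0 ->
  (forall x y, Q x -> Q y -> Q (x - y)) ->
  (forall (f : homZ B B') c, hom_degree i f -> Q (redhom_tens f c)) ->
  forall x, redhom_gr i x -> Q x.
Proof.
move=> Q0 QB Qf x; elim=> {x} [//|x y _ hx _ hy|j k f c hf hc ei]; first exact: QB.
case: hc => [->|hk]; first by rewrite -[pure _ f 0]/(redhom_tens f 0) redhom_tens0r.
by apply: Qf; rewrite ei hk addr0.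
Qed.

Lemma redhom_gr_scale B B' i a (x : redhom B B') :
  redhom_gr i x -> redhom_gr i (a *: x).
Proof.
move=> hx; rewrite /redhom_gr -[i]addr0; apply: (grr hx); exact: polygrC.
Qed.

Lemma redhom_gr_tens B B' i (f : homZ B B') :
  hom_degree i f -> redhom_gr i (redhom_tens f 1).
Proof.
move=> hf; apply: (@tens_gr_pure K d predT (HomZ_bimod B B') residue i i 0 f 1 hf).
  by right.
by rewrite addr0.
Qed.

Lemma redhom_gr_sum B B' i (I : finType) (f : I -> redhom B B') :
  (forall k, redhom_gr i (f k)) -> redhom_gr i (\sum_k f k).
Proof.
move=> hf; elim/big_ind: _ => [|x y|k _]; [exact: gr0 | exact: grD | exact: hf].
Qed.

End ReducedHom.

(** * Homogeneity and module linearity of [Phi] *)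

Theorem proposition5p5
  (W : groupType) (S : Type) (C : coxeter_system W S)
  (K : realType) (d : nat) (V : refl_faithful C K d) (L : leaf_choices V)
  (u v w : W)
  (leaf_id : forall x, x \in [:: u; v; w] ->
     forall l, leaf L (rex L x) x l -> l = idfun)
  (uv : bruhat C u v) (vw : bruhat C v w)
  (G : BS V (rex L v) -> BS V (rex L u))
  (G_leaf : leaf L (rex L v) u G)
  (G_deg : hom_degree ((length C v)%:Z - (length C u)%:Z) G)
  (Phi : {linear redhom (BS V (rex L w)) (standard V v) ->
                 redhom (BS V (rex L w)) (standard V u)})
  (Phi_leaf : forall (l : BS V (rex L w) -> BS V (rex L v))
      (g : homZ (BS V (rex L w)) (standard V v))
      (g' : homZ (BS V (rex L w)) (standard V u)),
    leaf L (rex L w) v l ->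
    (forall b, g b = beta (l b)) ->
    (forall b, g' b = beta (G (l b))) ->
    Phi (redhom_tens g 1) = redhom_tens g' 1) :
  (forall i x, redhom_gr i x ->
     redhom_gr (i + ((length C v)%:Z - (length C u)%:Z)) (Phi x)) /\
  (forall (x : redhom (BS V (rex L w)) (standard V v))
          (a : redhom (BS V (rex L w)) (BS V (rex L w))),
     Phi (redhom_comp x a) = redhom_comp (Phi x) a).
Proof.
have [rv_prod rv_red] := rexP L v.
have [M [[sM uM _] [G1 _ GM]]] := leaf_has_spec G_leaf.
set D := descents C 1%g M (rex L v) in G1 GM.
have sD : size D = size (rex L v) by rewrite size_descents.
(* The probe of [M] has degree 2k - l(v), for k descents, and [G] sends it to 1 (x) ... (x) 1, of
   degree -l(u). As [G] has degree l(v) - l(u), k is zero. *)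
have noD : ~~ has id D.
  have := (beta_rex_hom L u).2 _ _ (G_deg.2 _ _ (probe_gr V sD)).
  rewrite G1 betaE eval_BS1 size_rex /= => /polygr_one.
  rewrite addr0 addrA !subrK => /eqP; rewrite mulf_eq0 /= => h.
  by rewrite has_count; case: (count _ _) h.
have {GM} GM := GM noD.
have [I [l [dg [hl hspan]]]] := leaf_span L (rex L w) v.
have bl i := bimod_hom_comp (beta_rex_hom L v).1 (hl i).2.1.
have bGl i := bimod_hom_comp (beta_rex_hom L u).1 (bimod_hom_comp G_deg.1 (hl i).2.1).
pose g i := bimodZ L (bl i); pose g' i := bimodZ L (bGl i).
have Phi_g i : Phi (redhom_tens (g i) 1) = redhom_tens (g' i) 1.
  by apply: Phi_leaf (hl i).1 _ _.
have Phi_expand (c : I -> {mpoly K[d]}) (f : homZ (BS V (rex L w)) (standard V v)) :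
    (forall z, f z = \sum_i c i * beta (l i z)) ->
    Phi (redhom_tens f 1) = \sum_i (c i)@_0%MM *: redhom_tens (g' i) 1.
  move=> hf; rewrite (redhom_expand (f := g) hf) linear_sum.
  by apply: eq_bigr => i _; rewrite linearZ Phi_g.
(* The defining property of [Phi] extends from leaves to every bimodule map [f]: subtracting from
   [f] its expansion in leaves gives an [f'] killed by [beta], and then [beta] after [G] and [f'] is
   negligible. *)
have Phi_comp (f : BS V (rex L w) -> BS V (rex L v))
    (h : homZ (BS V (rex L w)) (standard V v))
    (h' : homZ (BS V (rex L w)) (standard V u)) :
    bimod_hom f -> (forall z, h z = beta (f z)) -> (forall z, h' z = beta (G (f z))) ->
    Phi (redhom_tens h 1) = redhom_tens h' 1.
  move=> bf hh hh'; have [c [hc _]] := hspan h (homZ_bimod h).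
  rewrite (Phi_expand _ _ hc).
  pose f' z := f z - \sum_i lact (c i) (l i z).
  have bf' : bimod_hom f'.
    apply: bimod_hom_sub => //; apply: bimod_hom_sum => i _.
    exact: bimod_hom_lact (hl i).2.1.
  have eval_sum e N (F : I -> BS V e) : subword_eval N (\sum_i lact (c i) (F i)) =
      \sum_i c i * subword_eval N (F i).
    rewrite (big_morph _ (@evalD _ _ _ _ _ V e N) (eval0 V e N)).
    by apply: eq_bigr => i _; rewrite eval_lact.
  have f'0 z : beta (f' z) = 0.
    rewrite betaE evalB eval_sum -betaE -hh hc; apply/eqP; rewrite subr_eq0.
    by apply/eqP/eq_bigr => i _; rewrite -betaE.
  have bM : bimod_hom (@subword_eval _ _ _ _ _ V (rex L v) M : _ -> standard V u).
    by rewrite uM; apply: eval_bimod.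
  have := eval_negligible L rv_red sM uM noD bf' f'0 (g' := bimodZ L (bimod_hom_comp bM bf')).
  move/(_ (fun=> erefl)) => n0.
  (* [hn] is the negligible part of [h'], and [hS] turns out to be the combination of the [g' i]
     with coefficients [c]. *)
  set hn := bimodZ L _ in n0; pose hS := h' - hn.
  have hE : h' = hn + hS by rewrite addrC subrK.
  rewrite hE redhom_tensD n0 add0r (redhom_expand (c := c) (f := g')) // => z.
  apply: (addrI (hn z : {mpoly K[d]})).
  have -> : (hn z : {mpoly K[d]}) + hS z = h' z by rewrite hE homZDE.
  rewrite hh' GM /= /f' evalB eval_sum.
  rewrite [X in _ = _ - X + _](eq_bigr (fun i => c i * beta (G (l i z)))) ?subrK //.
  by move=> i _; rewrite GM.
split.
- move=> j; apply: redhom_gr_ind => [|x y hx hy|f c hf].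
  + by rewrite linear0; apply: gr0.
  + by rewrite linearB; apply: grB.
  have -> : redhom_tens f c = c *: redhom_tens f 1 by rewrite redhom_scaleE mul1r.
  rewrite linearZ; apply: redhom_gr_scale.
  have [a [ha hda]] := hspan f (homZ_bimod f).
  rewrite (Phi_expand a) //; apply: redhom_gr_sum => t.
  (* A coefficient with nonzero constant term has degree zero, so only the leaves of the same degree
     as [f] contribute. *)
  case: (residue_gr (hda j hf t)) => [->|/eqP]; first by rewrite scale0r; apply: gr0.
  rewrite subr_eq0 => /eqP->; apply/redhom_gr_scale/redhom_gr_tens.
  rewrite -[_ - _]addr0 addrA.
  exact: hom_degree_comp (beta_rex_hom L u) (hom_degree_comp G_deg (hl t).2).
- move=> x a.
  elim/redhom_ind: x => [|x y hx hy|f c].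
  + by rewrite redhom_comp0l !linear0 redhom_comp0l.
  + by rewrite redhom_compBl !linearB redhom_compBl hx hy.
  elim/redhom_ind: a => [|x y hx hy|b k].
  + by rewrite !redhom_comp0r linear0.
  + by rewrite !redhom_compBr linearB hx hy.
  have -> : redhom_tens f c = c *: redhom_tens f 1 by rewrite redhom_scaleE mul1r.
  rewrite linearZ !redhom_compZl linearZ; congr (_ *: _).
  have [e [he _]] := hspan f (homZ_bimod f).
  rewrite (Phi_expand e) // redhom_comp_suml redhom_compE mul1r.
  have -> : redhom_tens (homZ_comp f b) k = k *: redhom_tens (homZ_comp f b) 1.
    by rewrite redhom_scaleE mul1r.
  rewrite linearZZ (redhom_expand (c := e) (f := fun i => homZ_comp (g i) b)); last first.
    by move=> z /=; rewrite he.
  rewrite linear_sum scaler_sumr; apply: eq_bigr => i _.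
  rewrite linearZZ redhom_compZl scalerA mulrC -scalerA; congr (_ *: _).
  rewrite redhom_compE mul1r -[k in RHS]mul1r -redhom_scaleE; congr (_ *: _).
  (* A leaf composed with an endomorphism need not be a leaf, which is why [Phi_comp] is stated for
     all bimodule maps. *)
  apply: (Phi_comp (l i \o b)) => //.
  exact: bimod_hom_comp (hl i).2.1 (homZ_bimod b).
Qed.
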